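(* Consider a general network of $N$ beams as described in the context, suppose that $R_i \in C^2([0,\ell_i];\mathrm{SO}(3))$ for all $i\in\mathcal I$, and that for all $i \in \mathcal{I}$ the following holds: (1) $\mathbf{C}_i, \mathbf{M}_i \in C^2([0,\ell_i];\mathcal{S}_{++}^6)$; (2) for $\Theta_i := (\mathbf{C}_i^{1/2}\mathbf{M}_i\mathbf{C}_i^{1/2})^{-1}$ there exist $U_i, D_i \in C^2([0,\ell_i];\mathbb{R}^{6\times 6})$ such that $\Theta_i = U_i^\intercal D_i^2 U_i$ in $[0,\ell_i]$, where $D_i(x)$ is a positive definite diagonal matrix whose diagonal entries are the square roots of the eigenvalues of $\Theta_i(x)$ and $U_i(x)$ is unitary. Then, for any $T>0$, there exists $\varepsilon_0>0$ such that for every $\varepsilon\in(0,\varepsilon_0)$ there is $\delta>0$ such that for all initial data $y_i^0\in C^1([0,\ell_i];\mathbb{R}^{12})$ ($i\in\mathcal I$) and nodal data $q_n\in C^1([0,T];\mathbb{R}^6)$ ($n\in\mathcal N$) satisfying $\|y_i^0\|_{C^1([0,\ell_i])}+\|q_n\|_{C^1([0,T])}\le\delta$ for all $i \in \mathcal{I}$, $n \in \mathcal{N}$, and satisfying the first-order compatibility conditions of the IGEB network system, there exists a unique solution $(y_i)_{i\in\mathcal I}\in\prod_{i=1}^N C^1([0,\ell_i]\times[0,T];\mathbb{R}^{12})$ to the IGEB network system, and it satisfies $\|y_i\|_{C^1([0,\ell_i]\times[0,T])}\le\varepsilon$ for all $i\in\mathcal I$.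
   Context: **Notation.** $\mathcal{S}_{++}^6$ is the set of symmetric positive definite real $6\times6$ matrices. For $u\in\mathbb{R}^3$, $\widehat u$ is the skew-symmetric $3\times3$ matrix with $\widehat u\,\zeta=u\times\zeta$; for a skew-symmetric $\mathbf u\in\mathbb R^{3\times 3}$, $\mathrm{vec}(\mathbf u)\in\mathbb{R}^3$ is such that $\widehat{\mathrm{vec}(\mathbf u)}=\mathbf u$. $e_1=(1,0,0)^\intercal$. $\mathbf 0_k$ is the $k\times k$ zero matrix. **Network.** A network of beams is an oriented graph with edges (beams) $i\in\mathcal I=\{1,\dots,N\}$, edge $i$ being identified with $[0,\ell_i]$, $\ell_i>0$, and with nodes $n\in\mathcal N = \{1, \ldots, \#\mathcal{N}\}$. $\mathcal I^n$ is the set of edges incident to node $n$, $k_n=\#\mathcal I^n$, $i^n=\min \mathcal I^n$. $\mathcal N=\mathcal N_S\cup\mathcal N_M$ (disjoint) where $\mathcal N_S$ are the simple nodes ($k_n=1$) and $\mathcal N_M$ the multiple nodes ($k_n\ge2$); $\mathcal N_S=\mathcal N_S^D\cup\mathcal N_S^N$ is a given partition (Dirichlet and Neumann simple nodes). For $i\in\mathcal I^n$, $\mathbf x_i^n\in\{0,\ell_i\}$ is the end of $[0,\ell_i]$ corresponding to node $n$, and $\tau_i^n=-1$ if $\mathbf x_i^n=0$, $\tau_i^n=+1$ if $\mathbf x_i^n=\ell_i$. **Beam parameters.** For each $i$, given functions on $[0,\ell_i]$: mass matrix $\mathbf M_i$ and flexibility matrix $\mathbf C_i$ (values in $\mathcal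 S_{++}^6$), and $R_i$ (values in $\mathrm{SO}(3)$). Set $\overline R_i=\mathrm{diag}(R_i,R_i)$, $\Upsilon_c^i=\mathrm{vec}(R_i^\intercal\frac{\mathrm d}{\mathrm dx}R_i)$, $$A_i=-\begin{bmatrix}\mathbf 0_6&\mathbf M_i^{-1}\\ \mathbf C_i^{-1}&\mathbf 0_6\end{bmatrix},\quad \overline B_i=\begin{bmatrix}\mathbf 0_6&-\mathbf M_i^{-1}\mathbf E_i\\ \mathbf C_i^{-1}\mathbf E_i^\intercal&\mathbf 0_6\end{bmatrix},\quad \mathbf E_i=\begin{bmatrix}\widehat\Upsilon_c^i&\mathbf 0_3\\ \widehat e_1&\widehat\Upsilon_c^i\end{bmatrix},$$ and, for $u=(u_1^\intercal,u_2^\intercal,u_3^\intercal,u_4^\intercal)^\intercal\in\mathbb R^{12}$, $u_j\in\mathbb R^3$, $$\overline g_i(x,u)=-\begin{bmatrix}\mathbf M_i(x)^{-1}&\mathbf 0_6\\ \mathbf 0_6&\mathbf C_i(x)^{-1}\end{bmatrix}\begin{bmatrix}\widehat u_2&\mathbf 0_3&\mathbf 0_3&\widehat u_3\\ \widehat u_1&\widehat u_2&\widehat u_3&\widehat u_4\\ \mathbf 0_3&\mathbf 0_3&\widehat u_2&\widehat u_1\\ \mathbf 0_3&\mathbf 0_3&\mathbf 0_3&\widehat u_2\end{bmatrix}\begin{bmatrix}\mathbf M_i(x)&\mathbf 0_6\\ \mathbf 0_6&\mathbf C_i(x)\end{bmatrix}u.$$ **IGEB network system.** The unknowns are $y_i=\begin{bmatrix}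 v_i \\ z_i \end{bmatrix}:[0,\ell_i]\times[0,T]\to\mathbb R^{12}$, with $v_i,z_i$ being $\mathbb R^6$-valued, and the system is $$\begin{cases}\partial_ty_i+A_i\partial_xy_i+\overline B_iy_i=\overline g_i(\cdot,y_i)&\text{in }(0,\ell_i)\times(0,T),\ i\in\mathcal I\\ (\overline R_iv_i)(\mathbf x_i^n,t)=(\overline R_{i^n}v_{i^n})(\mathbf x_{i^n}^n,t)&t\in(0,T),\ i\in\mathcal I^n,\ n\in\mathcal N_M\\ \sum_{i\in\mathcal I^n}\tau_i^n(\overline R_iz_i)(\mathbf x_i^n,t)=q_n(t)&t\in(0,T),\ n\in\mathcal N_M\\ \tau_{i^n}^nz_{i^n}(\mathbf x_{i^n}^n,t)=q_n(t)&t\in(0,T),\ n\in\mathcal N_S^N\\ v_{i^n}(\mathbf x_{i^n}^n,t)=q_n(t)&t\in(0,T),\ n\in\mathcal N_S^D\\ y_i(x,0)=y_i^0(x)&x\in(0,\ell_i),\ i\in\mathcal I.\end{cases}$$ **First-order compatibility conditions.** Write $y_i^0=\begin{bmatrix} v_i^0 \\ z_i^0 \end{bmatrix}$ and $y_i^1:=-A_i\frac{\mathrm dy_i^0}{\mathrm dx}-\overline B_iy_i^0+\overline g_i(\cdot,y_i^0)=\begin{bmatrix} v_i^1 \\ z_i^1 \end{bmatrix}$. The data $(y_i^0)_{i \in \mathcal{I}},(q_n)_{n \in \mathcal{N}}$ fulfill the first-order compatibility conditions if, for both $k=0$ and $k=1$, with $q_n^{(0)}=q_n(0)$ and $q_n^{(1)}=\frac{\mathrm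 dq_n}{\mathrm dt}(0)$: $(\overline R_iv_i^k)(\mathbf x_i^n)=(\overline R_jv_j^k)(\mathbf x_j^n)$ for $i,j\in\mathcal I^n$, $n\in\mathcal N_M$; $\sum_{i\in\mathcal I^n}\tau_i^n(\overline R_iz_i^k)(\mathbf x_i^n)=q_n^{(k)}$ for $n\in\mathcal N_M$; $\tau_{i^n}^nz_{i^n}^k(\mathbf x_{i^n}^n)=q_n^{(k)}$ for $n\in\mathcal N_S^N$; $v_{i^n}^k(\mathbf x_{i^n}^n)=q_n^{(k)}$ for $n\in\mathcal N_S^D$. *)

(* Defs.v *)
From mathcomp Require Import all_boot all_order all_algebra.
From mathcomp Require Import all_classical all_reals all_analysis.
Set Implicit Arguments.
Unset Strict Implicit.
Unset Printing Implicit Defensive.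
Import Order.TTheory GRing.Theory Num.Theory.
Import numFieldNormedType.Exports.
Local Open Scope classical_set_scope.
Local Open Scope ring_scope.

(* A function on [a, b] (or on [0, l] x [0, T]) is represented by a total
   function on R (resp. R -> R -> _) whose values elsewhere are never used: in
   particular all derivatives below are taken within [a, b], hence one-sided at
   the end points. *)
Section Calculus.
Variables (R : realType) (V : normedModType R).
Implicit Types (a b x l t T : R) (f : R -> V) (y : R -> R -> V).

Definition diff_quot f x : R -> V := fun z => (z - x)^-1 *: (f z - f x).

Definition derivable_on a b f x : Prop :=
  cvg (diff_quot f x @ within `[a, b] x^').

Definition deriv_on a b f x : V := lim (diff_quot f x @ within `[a, b] x^').

Fixpoint Ck_on (k : nat) a b f : Prop :=
  if k is k'.+1 then
    (forall x, x \in `[a, b] -> derivable_on a b f x) /\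
    Ck_on k' a b (deriv_on a b f)
  else {within `[a, b], continuous f}.

Definition sup_norm_on a b f : R := sup [set `|f x| | x in `[a, b]].

Definition C1_norm_on a b f : R :=
  sup_norm_on a b f + sup_norm_on a b (deriv_on a b f).

Definition partial_x l y : R -> R -> V :=
  fun x t => deriv_on 0 l (fun z => y z t) x.

Definition partial_t T y : R -> R -> V :=
  fun x t => deriv_on 0 T (fun s => y x s) t.

Definition C0_rect l T y : Prop :=
  {within `[0, l] `*` `[0, T], continuous (fun p : R * R => y p.1 p.2)}.

Definition C1_rect l T y : Prop :=
  [/\ forall x t, x \in `[0, l] -> t \in `[0, T] ->
        derivable_on 0 l (fun z => y z t) x /\
        derivable_on 0 T (fun s => y x s) t,
      C0_rect l T y, C0_rect l T (partial_x l y) & C0_rect l T (partial_t T y)].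

Definition sup_norm_rect l T y : R :=
  sup [set `|y p.1 p.2| | p in `[0, l] `*` `[0, T]].

Definition C1_norm_rect l T y : R :=
  sup_norm_rect l T y + sup_norm_rect l T (partial_x l y)
  + sup_norm_rect l T (partial_t T y).

End Calculus.

Section Matrices.
Variable R : realType.

Definition posdefmx n (A : 'M[R]_n) : Prop :=
  A^T = A /\ forall v : 'cV[R]_n, v != 0 -> 0 < (v^T *m A *m v) 0 0.

(* The positive definite square root of a positive definite matrix; the
   default value 0 is only taken when no such root exists. *)
Definition sqrtmx n (A : 'M[R]_n) : 'M[R]_n :=
  xget 0 [set S : 'M[R]_n | posdefmx S /\ S *m S = A].

Definition SO3 (A : 'M[R]_3) : Prop := A^T *m A = 1%:M /\ \det A = 1.

Definition hat (u : 'cV[R]_3) : 'M[R]_3 :=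
  \matrix_(i < 3, j < 3)
    (nth [::] [:: [:: 0; - u 2%:R 0; u 1 0];
                  [:: u 2%:R 0; 0; - u 0 0];
                  [:: - u 1 0; u 0 0; 0]] i)`_j.

Definition vee (A : 'M[R]_3) : 'cV[R]_3 :=
  \col_(i < 3) [:: A 2%:R 1; A 0 2%:R; A 1 0]`_i.

Lemma hatK : cancel hat vee.
Proof.
move=> u; apply/colP => -[[|[|[|//]]] hi]; rewrite !mxE /=;
  by congr (u _ _); apply: val_inj.
Qed.

Lemma veeK (A : 'M[R]_3) : A^T = - A -> hat (vee A) = A.
Proof.
move=> /matrixP sA.
have A0 i : A i i = 0.
  by have := sA i i; rewrite !mxE => /esym/eqP; rewrite eqNr => /eqP.
have AC i j : - A i j = A j i by have := sA i j; rewrite !mxE.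
apply/matrixP => -[[|[|[|//]]] hi] -[[|[|[|//]]] hj]; rewrite !mxE /= ?AC;
  by [rewrite -(A0 (Ordinal hi)); congr (A _ _); apply: val_inj
     |congr (A _ _); apply: val_inj].
Qed.

End Matrices.

Definition incident N P (src tgt : 'I_N -> 'I_P) (n : 'I_P) : {set 'I_N} :=
  [set i | (src i == n) || (tgt i == n)]%SET.

(* Nodes are 'I_P, beams are 'I_N; beam i is oriented from the node [src i]
   (at x = 0) to the node [tgt i] (at x = len i). *)
Record network (R : realType) (N P : nat) := Network {
  len : 'I_N -> R;
  src : 'I_N -> 'I_P;
  tgt : 'I_N -> 'I_P;
  len_gt0 : forall i, 0 < len i;
  (* without loops, the end of beam i located at an incident node is unique *)
  src_neq_tgt : forall i, src i != tgt i;
  incident_edge : forall n, exists i, i \in incident src tgt n;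
  dirichlet : {set 'I_P};
  dirichlet_simple : forall n, n \in dirichlet ->
    #|incident src tgt n| = 1%N
}.

Section Network.
Variables (R : realType) (N P : nat) (G : network R N P).

Definition edges (n : 'I_P) : {set 'I_N} :=
  incident (src G) (tgt G) n.

Definition simple_nodes : {set 'I_P} := [set n | #|edges n| == 1%N]%SET.
Definition multiple_nodes : {set 'I_P} := [set n | (2 <= #|edges n|)%N]%SET.
Definition dirichlet_nodes : {set 'I_P} := dirichlet G.
Definition neumann_nodes : {set 'I_P} := simple_nodes :\: dirichlet_nodes.

Definition first_edge (n : 'I_P) : 'I_N :=
  [arg min_(i < xchoose (incident_edge G n) in edges n) (i : nat)]%N.

Definition end_of (i : 'I_N) (n : 'I_P) : R :=
  if src G i == n then 0 else len G i.

Definition end_sign (i : 'I_N) (n : 'I_P) : R :=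
  if src G i == n then -1 else 1.

End Network.

(* [Mass], [Flex] and [Rot] are the mass matrices, the flexibility matrices and
   the rotations of the beams; a state is y = col_mx v z. *)
Section IGEB.
Variables (R : realType) (N P : nat) (G : network R N P).
Variables (Mass Flex : 'I_N -> R -> 'M[R]_6) (Rot : 'I_N -> R -> 'M[R]_3).
Implicit Types (i : 'I_N) (x : R) (u : 'cV[R]_(6 + 6)).

Definition e1 : 'cV[R]_3 := delta_mx 0 0.

Definition Rbar i x : 'M[R]_6 :=
  (block_mx (Rot i x) 0 0 (Rot i x) : 'M[R]_(3 + 3)).

Definition curvature i x : 'cV[R]_3 :=
  vee ((Rot i x)^T *m deriv_on 0 (len G i) (Rot i) x).

Definition Emx i x : 'M[R]_6 :=
  (block_mx (hat (curvature i x)) 0 (hat e1) (hat (curvature i x))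
    : 'M[R]_(3 + 3)).

Definition Amx i x : 'M[R]_(6 + 6) :=
  - block_mx 0 (invmx (Mass i x)) (invmx (Flex i x)) 0.

Definition Bmx i x : 'M[R]_(6 + 6) :=
  block_mx 0 (- (invmx (Mass i x) *m Emx i x))
           (invmx (Flex i x) *m (Emx i x)^T) 0.

Definition Gmx u : 'M[R]_(6 + 6) :=
  let v : 'cV[R]_(3 + 3) := usubmx u in
  let z : 'cV[R]_(3 + 3) := dsubmx u in
  let u1 := hat (usubmx v) in let u2 := hat (dsubmx v) in
  let u3 := hat (usubmx z) in let u4 := hat (dsubmx z) in
  block_mx
    (block_mx u2 0  u1 u2 : 'M[R]_(3 + 3)) (block_mx 0 u3  u3 u4 : 'M[R]_(3 + 3))
    (0 : 'M[R]_(3 + 3))                    (block_mx u2 u1  0 u2 : 'M[R]_(3 + 3)).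

Definition gfun i x u : 'cV[R]_(6 + 6) :=
  - (block_mx (invmx (Mass i x)) 0 0 (invmx (Flex i x)) *m Gmx u
     *m block_mx (Mass i x) 0 0 (Flex i x) *m u).

Definition igeb_solution (T : R) (q : 'I_P -> R -> 'cV[R]_6)
    (y0 : 'I_N -> R -> 'cV[R]_(6 + 6)) (y : 'I_N -> R -> R -> 'cV[R]_(6 + 6)) :
    Prop :=
  let v i x t := usubmx (y i x t) in
  let z i x t := dsubmx (y i x t) in
  [/\ forall i x t, x \in `]0, len G i[ -> t \in `]0, T[ ->
        partial_t T (y i) x t + Amx i x *m partial_x (len G i) (y i) x t
        + Bmx i x *m y i x t = gfun i x (y i x t),
      forall n, n \in multiple_nodes G -> forall t, t \in `]0, T[ ->
        (forall i, i \in edges G n ->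
           let j := first_edge G n in
           Rbar i (end_of G i n) *m v i (end_of G i n) t
           = Rbar j (end_of G j n) *m v j (end_of G j n) t) /\
        \sum_(i in edges G n)
          end_sign G i n *: (Rbar i (end_of G i n) *m z i (end_of G i n) t)
        = q n t,
      forall n, n \in neumann_nodes G -> forall t, t \in `]0, T[ ->
        let j := first_edge G n in
        end_sign G j n *: z j (end_of G j n) t = q n t,
      forall n, n \in dirichlet_nodes G -> forall t, t \in `]0, T[ ->
        let j := first_edge G n in v j (end_of G j n) t = q n t &
      forall i x, x \in `]0, len G i[ -> y i x 0 = y0 i x].

Definition nodal_compat (y : 'I_N -> R -> 'cV[R]_(6 + 6))
    (q : 'I_P -> 'cV[R]_6) : Prop :=
  let v i x := usubmx (y i x) in
  let z i x := dsubmx (y i x) in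
  [/\ forall n, n \in multiple_nodes G ->
        forall i j, i \in edges G n -> j \in edges G n ->
        Rbar i (end_of G i n) *m v i (end_of G i n)
        = Rbar j (end_of G j n) *m v j (end_of G j n),
      forall n, n \in multiple_nodes G ->
        \sum_(i in edges G n)
          end_sign G i n *: (Rbar i (end_of G i n) *m z i (end_of G i n))
        = q n,
      forall n, n \in neumann_nodes G ->
        let j := first_edge G n in
        end_sign G j n *: z j (end_of G j n) = q n &
      forall n, n \in dirichlet_nodes G ->
        let j := first_edge G n in v j (end_of G j n) = q n].

Definition initial_dt (y0 : 'I_N -> R -> 'cV[R]_(6 + 6)) i x :
    'cV[R]_(6 + 6) :=
  - (Amx i x *m deriv_on 0 (len G i) (y0 i) x) - Bmx i x *m y0 i x
  + gfun i x (y0 i x).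

Definition compat1 (T : R) (y0 : 'I_N -> R -> 'cV[R]_(6 + 6))
    (q : 'I_P -> R -> 'cV[R]_6) : Prop :=
  nodal_compat y0 (fun n => q n 0) /\
  nodal_compat (initial_dt y0) (fun n => deriv_on 0 T (q n) 0).

Definition Theta i x : 'M[R]_6 :=
  invmx (sqrtmx (Flex i x) *m Mass i x *m sqrtmx (Flex i x)).

(* The condition on char_poly says that the squares of the diagonal entries of
   D are the eigenvalues of Theta counted with multiplicity. *)
Definition Theta_diag i (U D : R -> 'M[R]_6) : Prop :=
  forall x, x \in `[0, len G i] ->
  [/\ Theta i x = (U x)^T *m (D x *m D x) *m U x,
      is_diag_mx (D x), posdefmx (D x),
      char_poly (Theta i x) = \prod_(j < 6) ('X - (D x j j ^+ 2)%:P) &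
      (U x)^T *m U x = 1%:M].

End IGEB.

(* Main.v *)
(** In the Riemann coordinates [r = L y] of each beam the first-order part of the
    system becomes diagonal, with speeds that depend on [x] only; measuring [x]
    by the travel time of each component turns every speed into 1.  The nodal
    conditions then express the waves that enter a beam at a node as an affine
    function of the waves that reach this node, with the nodal data as
    inhomogeneity.  Differentiating in time, [w = d_t r] satisfies integral
    equations along characteristic lines; in the sup norm weighted by
    [exp (mu x - kp t)] reflections are damped by [mu] and source terms by [kp],
    so that for small data the Picard iteration contracts.  The first-order
    compatibility conditions make the iterates continuous across the
    characteristics issued from the nodes, and the solution inherits a bound
    proportional to the size of the data.  The same weighted estimate, applied to
    the difference of two solutions, gives uniqueness. *)

Require Import Defs.
From mathcomp Require Import all_boot all_order all_algebra.
From mathcomp Require Import all_classical all_reals all_analysis.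
From mathcomp Require Import ring lra.
Set Implicit Arguments.
Unset Strict Implicit.
Unset Printing Implicit Defensive.
Import Order.TTheory GRing.Theory Num.Theory.
Import numFieldNormedType.Exports.
Local Open Scope classical_set_scope.
Local Open Scope ring_scope.

(** * Integration and uniform continuity *)

Section Primitives.
Variable R : realType.
Implicit Types (f g F G : R -> R) (a b c x y : R).

(** The iteration runs on [w = d_t r] because the coefficients are independent of [t] and only known
    to be continuous in [x]: differentiating in [t] leaves them alone. The [x]-derivative is never
    iterated; it is defined by the equation as the source minus [w] and shown afterwards to be the
    derivative of [r]. The price of unit speeds is that the components of one beam live on different
    intervals; [theta] matches the coordinates of one point of the beam. The factors [U] and [D] are
    assumed smooth since eigenvectors of a smooth family need not be smooth where eigenvalues cross;
    the smoothness of the square root of [Flex] is proved, through a Sylvester equation. Solving the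
    conditions at a multiple node for the entering waves rests on the positive definiteness of a sum
    of impedances. Functions on intervals are extended by clamping, which turns continuity into
    uniform continuity on the plane, a property stable under composition. All bounds are linear in
    the data, so [eps] is reached by shrinking [delta]. For uniqueness, [kp] is chosen after a
    common bound of the two solutions, so large solutions are covered too. *)

Lemma mean_value_ineq F dF G dG a b : a <= b ->
  (forall x, a < x < b -> is_derive x 1 F (dF x)) ->
  (forall x, a < x < b -> is_derive x 1 G (dG x)) ->
  {within `[a, b], continuous F} -> {within `[a, b], continuous G} ->
  (forall x, a < x < b -> `|dF x| <= dG x) ->
  `|F b - F a| <= G b - G a.
Proof.
move=> ab dFE dGE cF cG dFG.
(* Applied with [s = 1] and [s = -1], this bounds the absolute value; for each sign it is the mean
   value theorem for [G - s F], whose derivative is nonnegative. *)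
have half (s : R) : `|s| = 1 -> s * (F b - F a) <= G b - G a.
  move=> s1.
  have dH x : x \in `]a, b[ ->
      is_derive x 1 (G - (s \*: F)) (dG x - s *: dF x).
    rewrite in_itv /= => xab; have := dFE _ xab; have := dGE _ xab => ? ?.
    exact: is_deriveB.
  have cH : {within `[a, b], continuous (G - (s \*: F))}.
    by move=> x; apply: cvgB; [exact: cG | apply: cvgZr; exact: cF].
  move: ab; rewrite le_eqVlt => /predU1P[<-|ab]; first by rewrite !subrr mulr0.
  have [z] := MVT ab dH cH; rewrite in_itv /= => zab.
  have -> : (G - s \*: F) b - (G - s \*: F) a = (G b - G a) - s * (F b - F a).
    rewrite -![(G - s \*: F) _]/(G _ - s * F _); ring.
  move=> E; rewrite -subr_ge0 E mulr_ge0 ?subr_ge0 ?(ltW ab)//.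
  apply: le_trans (dFG _ zab); rewrite (le_trans (ler_norm _)) //.
  by rewrite normrZ s1 mul1r.
rewrite ler_norml lerNl -mulN1r half ?normrN1 //=.
by rewrite -[F b - F a]mul1r half ?normr1.
Qed.

Lemma is_derive_continuous F dF a b :
  (forall x, is_derive x 1 F (dF x)) -> {within `[a, b], continuous F}.
Proof.
move=> dFE; apply: continuous_subspaceT => x.
by apply/differentiable_continuous/derivable1_diffP; have := dFE x; case.
Qed.

Lemma is_derive_unique F G dF : (forall x, is_derive x 1 F (dF x)) ->
  (forall x, is_derive x 1 G (dF x)) -> F 0 = G 0 -> F = G.
Proof.
move=> dFE dGE FG0; apply/funext => x.
have dH y : is_derive y 1 (F - G) 0.
  have := dFE y; have := dGE y => ? ?.
  by rewrite -(subrr (dF y)); exact: is_deriveB.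
have := @is_derive_0_is_cst _ (F - G) x 0 dH.
rewrite -![(F - G) _]/(F _ - G _) FG0 subrr => /eqP.
by rewrite subr_eq0 => /eqP.
Qed.

(** The integral starts at [- M] with [M = n + 1], so that every [x] with [|x| < n] is interior and
    the fundamental theorem applies. Subtracting the value at 0 makes the primitives for different
    [n] comparable. *)
Lemma local_primitive f (n : nat) : continuous f ->
  exists G, G 0 = 0 /\
   forall x, `|x| < n%:R -> is_derive x 1 G (f x).
Proof.
move=> cf; pose M : R := n%:R + 1.
pose F x := (\int[lebesgue_measure]_(t in [set` `[- M, x]]) f t)%R.
have M0 : 0 <= n%:R :> R by [].
have intf : lebesgue_measure.-integrable `[- M, M] (EFin \o f).
  apply: continuous_compact_integrable; first exact: segment_compact.
  exact: continuous_subspaceT.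
exists (F - cst (F 0)); split; first by rewrite /= /GRing.add /= /GRing.opp /= subrr.
move=> x; rewrite ltr_norml => /andP[xn xn'].
have xM : x < M by rewrite /M; lra.
have Mx : - M < x by rewrite /M; lra.
have [dx Ex] := continuous_FTC1_closed xM intf Mx (cf x).
have dF : is_derive x 1 F (f x).
  by apply: DeriveDef; [exact: dx | rewrite -derive1E; exact: Ex].
by rewrite -[f x]subr0; exact: is_deriveB.
Qed.

Lemma primitive_exists f : continuous f ->
  exists F, F 0 = 0 /\ forall x, is_derive x 1 F (f x).
Proof.
move=> cf.
have /choice[G GP] := fun n => local_primitive n cf.
have GE n m x : `|x| < n%:R -> (n <= m)%N -> G n x = G m x.
  move=> xn nm; have [Gn0 dGn] := GP n; have [Gm0 dGm] := GP m.
  have nmR : n%:R <= m%:R :> R by rewrite ler_nat.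
  have dH y : `|y| < n%:R -> is_derive y 1 (G n - G m) 0.
    move=> yn; have := dGn _ yn; have := dGm _ (lt_le_trans yn nmR) => ? ?.
    by rewrite -(subrr (f y)); exact: is_deriveB.
  have H0 : (G n - G m) 0 = 0.
    by rewrite -[(G n - G m) 0]/(G n 0 - G m 0) Gn0 Gm0 subrr.
  have aux u v : u <= v -> `|u| < n%:R -> `|v| < n%:R ->
      (G n - G m) v = (G n - G m) u.
    move=> uv un vn.
    have un' z : u <= z <= v -> `|z| < n%:R.
      by move: un vn; rewrite !ltr_norml; lra.
    have [] := @MVT_segment R (G n - G m) (fun=> 0) u v uv.
    - by move=> z; rewrite in_itv /= => /andP[uz zv]; apply/dH/un'; rewrite !ltW.
    - apply: derivable_within_continuous => z; rewrite in_itv /= => uzv.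
      by have [] := dH _ (un' _ uzv).
    by move=> c _; rewrite mul0r => /eqP; rewrite subr_eq0 => /eqP.
  have n0 : `|0 : R| < n%:R by rewrite normr0 (le_lt_trans _ xn).
  suff : (G n - G m) x = 0.
    by rewrite -[(G n - G m) x]/(G n x - G m x) => /eqP; rewrite subr_eq0 => /eqP.
  have [x0|/ltW x0] := leP 0 x; first by rewrite (aux 0 x).
  by rewrite -(aux x 0).
(* [N x] exceeds [|x| + 1], so [G (N x)] is a primitive on a whole unit ball around [x]; there the
   glued function coincides with this single primitive although its index moves with the point. *)
pose N x := (Num.truncn `|x|).+2.
have NP x : `|x| + 1 < (N x)%:R.
  by rewrite /N -addn1 natrD ltrD2r truncnS_gt.
exists (fun x => G (N x) x); split; first by have [] := GP (N 0).
move=> x.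
have [_ /(_ x) dG] := GP (N x).
have xN : `|x| < (N x)%:R by apply: lt_trans (NP x); rewrite ltrDl.
have [dG1 dG2] := dG xN.
have E : \forall y \near x, G (N x) y = G (N y) y.
  near=> y.
  have yx : `|y - x| < 1.
    near: y; apply/nbhs_ballP; exists 1 => //= y.
    by rewrite /ball /= distrC.
  have yN : `|y| < (N x)%:R.
    apply: le_lt_trans (NP x); rewrite -[y](subrK x) addrC (le_trans (ler_normD _ _)) //.
    by rewrite lerD2l ltW.
  have yN' : `|y| < (N y)%:R by apply: lt_trans (NP y); rewrite ltrDl.
  by case: (leqP (N x) (N y)) => [|/ltnW] ?; [|symmetry]; apply: GE.
have [:d] @H : is_derive x 1 (fun y => G (N y) y) (f x).
  apply: DeriveDef; last first.
    rewrite -dG2; apply: esym; apply: near_eq_derive => //.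
  abstract: d.
  apply: near_eq_derivable dG1 => //.
exact: H.
Unshelve. all: by end_near. Qed.

End Primitives.

Section Integral.
Variable R : realType.
Implicit Types (f g F G : R -> R) (a b c x y : R).

Definition primitive f : R -> R :=
  xget (fun=> 0) [set F | F 0 = 0 /\ forall x, is_derive x 1 F (f x)].

Lemma primitiveP f : continuous f ->
  primitive f 0 = 0 /\ forall x, is_derive x 1 (primitive f) (f x).
Proof. by move=> cf; apply: (xgetPex _ (primitive_exists cf)). Qed.

Lemma is_derive_primitive f x : continuous f -> is_derive x 1 (primitive f) (f x).
Proof. by case/primitiveP. Qed.

Lemma primitive0 f : continuous f -> primitive f 0 = 0.
Proof. by case/primitiveP. Qed.

(** An oriented integral through a chosen primitive: additivity holds for end points in any order,
    as a mere algebraic identity. *)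
Definition integ f a b : R := primitive f b - primitive f a.

Lemma integE f F a b : continuous f -> (forall x, is_derive x 1 F (f x)) ->
  integ f a b = F b - F a.
Proof.
move=> cf dF; rewrite /integ.
have -> : primitive f = F - cst (F 0).
  apply: (@is_derive_unique _ _ _ f) => [x|x|].
  - exact: is_derive_primitive.
  - by have := dF x => ?; rewrite -[f x]subr0; exact: is_deriveB.
  - by rewrite primitive0 //= /GRing.add /= /GRing.opp /= subrr.
by rewrite -![(F - _) _]/(F _ - F 0); ring.
Qed.

Lemma integ_cat f a b c : integ f a b + integ f b c = integ f a c.
Proof. by rewrite /integ; ring. Qed.

Lemma integ_le f G dG a b : a <= b -> continuous f ->
  (forall x, is_derive x 1 G (dG x)) ->
  (forall x, a < x < b -> `|f x| <= dG x) -> `|integ f a b| <= G b - G a.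
Proof.
move=> ab cf dGE fG; apply: (@mean_value_ineq _ (primitive f) f G dG) => //.
- by move=> x _; exact: is_derive_primitive.
- by move=> x; exact: (is_derive_continuous (fun x => is_derive_primitive x cf)).
- by move=> x; exact: (is_derive_continuous dGE).
Qed.

Lemma integ_lin f g c a b : continuous f -> continuous g ->
  integ (fun x => f x + c * g x) a b = integ f a b + c * integ g a b.
Proof.
move=> cf cg.
have ch : continuous (fun x => f x + c * g x).
  by move=> x; apply: cvgD; [exact: cf|apply: cvgZr; exact: cg].
have dh x : is_derive x 1 (primitive f + c \*: primitive g) (f x + c * g x).
  have := is_derive_primitive x cf.
  by have := is_derive_primitive x cg => ? ?; exact: is_deriveD.
rewrite (integE _ _ ch dh) -![(_ + _ \*: _) _]/(primitive f _ + c * primitive g _) /integ.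
ring.
Qed.

Lemma is_derive_scale c x : is_derive x 1 (c \*: (id : R -> R)) c.
Proof. by rewrite -[X in is_derive _ _ _ X]mulr1; exact: is_deriveZ. Qed.

Lemma integ_cst c a b : integ (fun=> c) a b = c * (b - a).
Proof.
have cc : continuous (fun _ : R => c) by move=> ?; exact: cvg_cst.
by rewrite (integE _ _ cc (is_derive_scale c)) -![(_ \*: _) _]/(c * _) mulrBr.
Qed.

Lemma integB f g a b : continuous f -> continuous g ->
  integ (fun x => f x - g x) a b = integ f a b - integ g a b.
Proof.
move=> cf cg; rewrite -mulN1r -integ_lin //; congr integ.
by apply/funext => x; rewrite mulN1r.
Qed.

Lemma integZ g c a b : continuous g ->
  integ (fun x => c * g x) a b = c * integ g a b.
Proof.
move=> cg; have := @integ_lin (fun=> 0) g c a b (fun _ => cvg_cst _) cg.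
rewrite integ_cst mul0r add0r => <-; congr integ.
by apply/funext => x; rewrite add0r.
Qed.

Lemma integ_sum (I : Type) (s : seq I) (F : I -> R -> R) a b :
  (forall i, continuous (F i)) ->
  integ (fun x => \sum_(i <- s) F i x) a b = \sum_(i <- s) integ (F i) a b.
Proof.
move=> cF; elim: s => [|i s IHs].
  rewrite big_nil; transitivity (integ (fun=> 0) a b); last by rewrite integ_cst mul0r.
  by congr integ; apply/funext => x; rewrite big_nil.
rewrite big_cons -IHs -[X in _ + X]mul1r -integ_lin //.
  by congr integ; apply/funext => x; rewrite big_cons mul1r.
by move=> x; apply: cvg_big => [|j _]; [exact: add_continuous|exact: cF].
Qed.

Lemma integ_shift f c a b : continuous f ->
  integ (fun x => f (x + c)) a b = integ f (a + c) (b + c).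
Proof.
move=> cf.
have cs : continuous (fun x => f (x + c)).
  move=> x; apply: continuous_comp; last exact: cf.
  by apply: cvgD; [exact: cvg_id | exact: cvg_cst].
have ds x : is_derive x 1 (primitive f \o (fun x => x + c)) (f (x + c)).
  have := is_derive_primitive (x + c) cf => d.
  rewrite -[f (x + c)]mulr1 -[X in _ * X]addr0.
  exact: (@is_derive1_comp _ (primitive f) (fun x => x + c)).
by rewrite (integE _ _ cs ds).
Qed.

Lemma integ_bound f B a b : continuous f ->
  (forall x, Num.min a b < x < Num.max a b -> `|f x| <= B) ->
  `|integ f a b| <= B * `|b - a|.
Proof.
move=> cf.
wlog ab : a b / a <= b => [H|].
  case/orP: (le_total a b) => [ab|ba]; first exact: H.
  rewrite minC maxC (distrC b a).
  have -> : integ f a b = - integ f b a by rewrite /integ opprB.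
  by rewrite normrN; exact: H.
rewrite min_l // max_r // => fB; rewrite [`|b - a|]ger0_norm ?subr_ge0 // mulrBr.
apply: (integ_le (G := B \*: id) (dG := fun=> B)) => //.
exact: is_derive_scale.
Qed.

Lemma integ_near_cst f v e a b : continuous f -> a <= b ->
  (forall x, a < x < b -> `|f x - v| <= e) ->
  `|integ f a b - v * (b - a)| <= e * (b - a).
Proof.
move=> cf ab fv.
have cv : continuous (fun _ : R => v) by move=> ?; exact: cvg_cst.
rewrite -(integ_cst v) -integB // -[X in _ <= _ * X]ger0_norm ?subr_ge0 //.
apply: integ_bound => [x|x]; first by apply: cvgB; [exact: cf|exact: cvg_cst].
by rewrite min_l // max_r //; exact: fv.
Qed.

Lemma eq_integ f g a b : a <= b -> continuous f -> continuous g ->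
  (forall x, a < x < b -> f x = g x) -> integ f a b = integ g a b.
Proof.
move=> ab cf cg fg; apply/eqP; rewrite -subr_eq0 -integB // -normr_le0.
rewrite -(mul0r `|b - a|); apply: integ_bound => [x|x].
  by apply: cvgB; [exact: cf|exact: cg].
by rewrite min_l // max_r // => /fg ->; rewrite subrr normr0.
Qed.

End Integral.

Section Clamp.
Variable R : realType.
Implicit Types (a b x y : R).

Definition clamp a b x : R := Num.max a (Num.min b x).

Lemma clamp_itv a b x : a <= b -> a <= clamp a b x <= b.
Proof. by move=> ab; rewrite /clamp le_max lexx /= ge_max ab ge_min lexx. Qed.

Lemma clamp_id a b x : a <= x <= b -> clamp a b x = x.
Proof. by case/andP=> ax xb; rewrite /clamp min_r // max_r. Qed.

Lemma maxr_lip a x y : `|Num.max a x - Num.max a y| <= `|x - y|.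
Proof.
rewrite ler_norml; case: (leP a x) => ax; case: (leP a y) => ay;
  case: (leP 0 (x - y)) => xy; rewrite ?(ger0_norm xy) ?(ltr0_norm xy); lra.
Qed.

Lemma minr_lip a x y : `|Num.min a x - Num.min a y| <= `|x - y|.
Proof.
rewrite ler_norml; case: (leP a x) => ax; case: (leP a y) => ay;
  case: (leP 0 (x - y)) => xy; rewrite ?(ger0_norm xy) ?(ltr0_norm xy); lra.
Qed.

Lemma clamp_lip a b x y : `|clamp a b x - clamp a b y| <= `|x - y|.
Proof. exact: le_trans (maxr_lip _ _ _) (minr_lip _ _ _). Qed.

End Clamp.

Section UniformContinuity.
Variable R : realType.
Implicit Types (f g h : R -> R -> R).

Definition ucont2 f := forall e : R, 0 < e -> exists2 d : R, 0 < d &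
  forall x x' t t', `|x - x'| < d -> `|t - t'| < d -> `|f x t - f x' t'| < e.

Definition bounded2 f := exists B : R, forall x t, `|f x t| <= B.

(* Bounded and uniformly continuous on the plane; functions of one variable
   are treated as functions of two variables that ignore one of them. *)
Definition buc f := bounded2 f /\ ucont2 f.

Lemma lip_ucont2 f M :
  (forall x x' t t', `|f x t - f x' t'| <= M * (`|x - x'| + `|t - t'|)) -> ucont2 f.
Proof.
move=> fM e e0; pose M' := `|M| + 1.
have M0 : 0 < M' by rewrite ltr_wpDl.
exists (e / (2 * M')) => [|x x' t t' xx tt]; first by rewrite divr_gt0 // mulr_gt0.
apply: le_lt_trans (fM _ _ _ _) _.
apply: (@le_lt_trans _ _ (M' * (`|x - x'| + `|t - t'|))).
  rewrite ler_wpM2r ?addr_ge0 // (le_trans (ler_norm _)) // lerDl //.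
have -> : e = M' * (e / (2 * M') + e / (2 * M')) by field; exact: lt0r_neq0.
by rewrite ltr_pM2l // ltrD.
Qed.

Lemma ucont2_fst : ucont2 (fun x _ => x).
Proof. by apply: (@lip_ucont2 _ 1) => x x' t t'; rewrite mul1r lerDl. Qed.

Lemma ucont2_snd : ucont2 (fun _ t => t).
Proof. by apply: (@lip_ucont2 _ 1) => x x' t t'; rewrite mul1r lerDr. Qed.

Lemma ucont2_cst (c : R) : ucont2 (fun _ _ => c).
Proof. by move=> e e0; exists 1 => // *; rewrite subrr normr0. Qed.

Lemma ucont2D f g : ucont2 f -> ucont2 g -> ucont2 (fun x t => f x t + g x t).
Proof.
move=> uf ug e e0; have e2 : 0 < e / 2 by rewrite divr_gt0.
have [d d0 fd] := uf _ e2; have [d' d'0 gd] := ug _ e2.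
exists (Num.min d d') => [|x x' t t']; first by rewrite lt_min d0.
rewrite !lt_min => /andP[x1 x2] /andP[t1 t2].
rewrite opprD addrACA (le_lt_trans (ler_normD _ _)) // [e]splitr ltrD //.
  exact: fd.
exact: gd.
Qed.

Lemma ucont2_comp f g h : ucont2 f -> ucont2 g -> ucont2 h ->
  ucont2 (fun x t => f (g x t) (h x t)).
Proof.
move=> uf ug uh e e0; have [d d0 fd] := uf _ e0.
have [d1 d10 gd] := ug _ d0; have [d2 d20 hd] := uh _ d0.
exists (Num.min d1 d2) => [|x x' t t']; first by rewrite lt_min d10.
by rewrite !lt_min => /andP[x1 x2] /andP[t1 t2]; apply: fd; [exact: gd|exact: hd].
Qed.

Lemma ucont2N f : ucont2 f -> ucont2 (fun x t => - f x t).
Proof.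
move=> uf e e0; have [d d0 fd] := uf _ e0; exists d => // x x' t t' xx tt.
by rewrite -opprD normrN; exact: fd.
Qed.

Lemma ucont2B f g : ucont2 f -> ucont2 g -> ucont2 (fun x t => f x t - g x t).
Proof. by move=> uf ug; apply: ucont2D => //; exact: ucont2N. Qed.

Lemma ucont2_max (a : R) f : ucont2 f -> ucont2 (fun x t => Num.max a (f x t)).
Proof.
move=> uf e e0; have [d d0 fd] := uf _ e0; exists d => // x x' t t' xx tt.
exact: le_lt_trans (maxr_lip _ _ _) (fd _ _ _ _ xx tt).
Qed.

Lemma ucont2_clamp (a b : R) f : ucont2 f -> ucont2 (fun x t => clamp a b (f x t)).
Proof.
move=> uf e e0; have [d d0 fd] := uf _ e0; exists d => // x x' t t' xx tt.
exact: le_lt_trans (clamp_lip _ _ _ _) (fd _ _ _ _ xx tt).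
Qed.

Lemma bounded2_ge0 f : bounded2 f -> exists2 B : R, 0 < B & forall x t, `|f x t| <= B.
Proof.
move=> [B fB]; exists (`|B| + 1); first by rewrite ltr_wpDl.
by move=> x t; rewrite (le_trans (fB _ _)) // (le_trans (ler_norm _)) // lerDl.
Qed.

Lemma buc_cst (c : R) : buc (fun _ _ => c).
Proof. by split; [exists `|c| | exact: ucont2_cst]. Qed.

Lemma bucD f g : buc f -> buc g -> buc (fun x t => f x t + g x t).
Proof.
move=> [[B fB] uf] [[C gC] ug]; split; last exact: ucont2D.
by exists (B + C) => x t; rewrite (le_trans (ler_normD _ _)) // lerD.
Qed.

Lemma bucN f : buc f -> buc (fun x t => - f x t).
Proof.
move=> [[B fB] uf]; split; last exact: ucont2N.
by exists B => x t; rewrite normrN.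
Qed.

Lemma bucB f g : buc f -> buc g -> buc (fun x t => f x t - g x t).
Proof. by move=> bf bg; apply: bucD => //; exact: bucN. Qed.

Lemma bucM f g : buc f -> buc g -> buc (fun x t => f x t * g x t).
Proof.
move=> [/bounded2_ge0[B B0 fB] uf] [/bounded2_ge0[C C0 gC] ug]; split.
  by exists (B * C) => x t; rewrite normrM ler_pM.
move=> e e0.
have [d d0 fd] := uf (e / (2 * C)) (divr_gt0 e0 (mulr_gt0 (ltr0Sn R _) C0)).
have [d' d'0 gd] := ug (e / (2 * B)) (divr_gt0 e0 (mulr_gt0 (ltr0Sn R _) B0)).
exists (Num.min d d') => [|x x' t t']; first by rewrite lt_min d0.
rewrite !lt_min => /andP[x1 x2] /andP[t1 t2].
have -> : f x t * g x t - f x' t' * g x' t' =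
  (f x t - f x' t') * g x t + f x' t' * (g x t - g x' t') by ring.
have -> : e = e / (2 * C) * C + B * (e / (2 * B)).
  by field; rewrite !lt0r_neq0.
rewrite (le_lt_trans (ler_normD _ _)) // !normrM; apply: ltr_leD.
  apply: le_lt_trans (_ : `|f x t - f x' t'| * C < _); first by rewrite ler_wpM2l.
  by rewrite ltr_pM2r //; exact: fd.
by rewrite ler_pM //; apply/ltW/gd.
Qed.

Lemma buc_sum (I : Type) (s : seq I) (F : I -> R -> R -> R) :
  (forall i, buc (F i)) -> buc (fun x t => \sum_(i <- s) F i x t).
Proof.
move=> bF; elim: s => [|i s IHs].
  have -> : (fun x t => \sum_(i <- [::]) F i x t) = (fun _ _ => 0).
    by apply/funext => x; apply/funext => t; rewrite big_nil.
  exact: buc_cst.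
have -> : (fun x t => \sum_(j <- i :: s) F j x t) =
          (fun x t => F i x t + \sum_(j <- s) F j x t).
  by apply/funext => x; apply/funext => t; rewrite big_cons.
exact: bucD.
Qed.

Lemma buc_comp f g h : buc f -> ucont2 g -> ucont2 h ->
  buc (fun x t => f (g x t) (h x t)).
Proof.
by move=> [[B fB] uf] ug uh; split; [exists B => x t|exact: ucont2_comp].
Qed.

Lemma ucont2_slice f (x : R) : ucont2 f -> continuous (f x).
Proof.
move=> uf t; apply/cvgrPdist_lt => e e0; have [d d0 fd] := uf _ e0.
near=> s; apply: fd; first by rewrite subrr normr0.
by near: s; apply/nbhs_ballP; exists d.
Unshelve. all: by end_near. Qed.

Lemma ucont2_swap f : ucont2 f -> ucont2 (fun x t => f t x).
Proof.
by move=> uf; exact: (ucont2_comp uf ucont2_snd ucont2_fst).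
Qed.

(** The change of the value splits into the change of the integrand over an interval of length at
    most [M] and two end pieces, whose lengths follow the moduli of [lo] and [hi]; each of the three
    takes a third of [e]. Writing [M + 1] keeps a divisor positive. *)
Lemma buc_integ f c lo hi M : buc f -> ucont2 c -> ucont2 lo -> ucont2 hi ->
  (forall x t, 0 <= lo x t <= M) -> (forall x t, 0 <= hi x t <= M) ->
  buc (fun x t => integ (f (c x t)) (lo x t) (hi x t)).
Proof.
move=> [/bounded2_ge0[B B0 fB] uf] uc ulo uhi loM hiM.
have cf y := ucont2_slice (x := y) uf.
have M0 : 0 <= M by have := loM 0 0; case/andP; apply: le_trans.
have dist u v : 0 <= u <= M -> 0 <= v <= M -> `|u - v| <= M.
  by rewrite ler_norml => /andP[? ?] /andP[? ?]; lra.
split.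
  exists (B * M) => x t; apply: (@le_trans _ _ (B * `|hi x t - lo x t|)).
    by apply: integ_bound.
  by rewrite ler_pM2l // dist.
move=> e e0.
have M10 : 0 < M + 1 by rewrite ltr_wpDl.
have [d1 d10 fd] := uf (e / (3 * (M + 1))) (divr_gt0 e0 (mulr_gt0 (ltr0Sn R _) M10)).
have [d2 d20 cd] := uc _ d10.
have eB : 0 < e / (3 * B) by rewrite divr_gt0 // mulr_gt0.
have [d3 d30 lod] := ulo _ eB; have [d4 d40 hid] := uhi _ eB.
exists (Num.min d2 (Num.min d3 d4)) => [|x x' t t']; first by rewrite !lt_min d20 d30.
rewrite !lt_min => /and3P[x2 x3 x4] /and3P[t2 t3 t4].
set c1 := c x t; set c2 := c x' t'; set l1 := lo x t; set l2 := lo x' t'.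
set h1 := hi x t; set h2 := hi x' t'.
have -> : integ (f c1) l1 h1 - integ (f c2) l2 h2 =
  integ (fun y => f c1 y - f c2 y) l1 h1 + (integ (f c2) l1 l2 + integ (f c2) h2 h1).
  by rewrite integB // /integ; ring.
have -> : e = e / (3 * (M + 1)) * (M + 1) + (B * (e / (3 * B)) + B * (e / (3 * B))).
  by field; rewrite !lt0r_neq0.
rewrite (le_lt_trans (ler_normD _ _)) //; apply: ler_ltD.
  apply: (@le_trans _ _ (e / (3 * (M + 1)) * `|h1 - l1|)).
    apply: integ_bound => [y|y _]; first by apply: cvgB; exact: cf.
    by apply/ltW/fd; [exact: cd|rewrite subrr normr0].
  apply: ler_wpM2l; first by rewrite divr_ge0 // ?ltW // mulr_gt0.
  by apply: (@le_trans _ _ M); [apply: dist; [exact: hiM|exact: loM]|rewrite lerDl].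
rewrite (le_lt_trans (ler_normD _ _)) //; apply: ltrD.
  apply: (@le_lt_trans _ _ (B * `|l2 - l1|)); first exact: integ_bound.
  by rewrite ltr_pM2l // distrC; exact: lod.
apply: (@le_lt_trans _ _ (B * `|h1 - h2|)); first exact: integ_bound.
by rewrite ltr_pM2l //; exact: hid.
Qed.

Lemma ucont2_lim (u : nat -> R -> R -> R) (l : R -> R -> R) :
  (forall n, ucont2 (u n)) ->
  (forall e : R, 0 < e -> exists n, forall x t, `|u n x t - l x t| <= e) ->
  ucont2 l.
Proof.
move=> uu ul e e0; have e4 : 0 < e / 4 by rewrite divr_gt0.
have [n un] := ul _ e4; have [d d0 und] := uu n _ e4.
exists d => // x x' t t' xx tt; have := und _ _ _ _ xx tt.
have := un x t; have := un x' t'.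
rewrite !ler_norml !ltr_norml; lra.
Qed.

End UniformContinuity.

(** * Differentiation within an interval *)

Section DerivIn.
Variable R : realType.
Implicit Types (f g q : R -> R) (a b x z d : R).

Definition cont_at a b f x := f @ within `[a, b] (nbhs x) --> f x.

Lemma cont_atP a b f x : cont_at a b f x <->
  forall e, 0 < e -> exists2 r : R, 0 < r &
    forall z, a <= z <= b -> `|z - x| < r -> `|f z - f x| < e.
Proof.
split=> [/cvgrPdist_lt fx e e0|fx].
  have := fx _ e0; rewrite near_withinE => /nbhs_ballP[r r0 rx].
  by exists r => // z zab zx; rewrite distrC; apply: rx => //; rewrite /ball /= distrC.
apply/cvgrPdist_lt => e e0; have [r r0 rx] := fx _ e0.
rewrite near_withinE; apply/nbhs_ballP; exists r => // z.
by rewrite /ball /= distrC (distrC (f x)) => zx zab; apply: rx.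
Qed.

Lemma within_contP a b f :
  (forall x, a <= x <= b -> cont_at a b f x) <-> {within `[a, b], continuous f}.
Proof.
rewrite subspace_continuousP; split=> H x; have := H x; rewrite /= in_itv /=; exact.
Qed.

(* Caratheodory's form of the derivative within [a, b]. *)
Definition deriv_in a b f x d := exists q,
  [/\ forall z, a <= z <= b -> f z - f x = q z * (z - x), q x = d & cont_at a b q x].

Lemma deriv_inP a b f x d : deriv_in a b f x d <->
  forall e, 0 < e -> exists2 r : R, 0 < r &
    forall z, a <= z <= b -> `|z - x| < r -> `|f z - f x - d * (z - x)| <= e * `|z - x|.
Proof.
split=> [[q [fq qx /cont_atP cq]] e e0|fx].
  have [r r0 rq] := cq _ e0; exists r => // z zab zx.
  by rewrite fq // -mulrBl normrM ler_wpM2r // -qx ltW // rq.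
pose q z := if z == x then d else (f z - f x) / (z - x).
have qx : q x = d by rewrite /q eqxx.
exists q; split=> //.
  move=> z zab; rewrite /q; case: eqP => [->|/eqP zx]; first by rewrite !subrr mulr0.
  by rewrite divfK // subr_eq0.
apply/cont_atP => e e0; have e2 : 0 < e / 2 by rewrite divr_gt0.
have [r r0 rx] := fx _ e2; exists r => // z zab zx.
rewrite qx /q; case: eqP => [_|/eqP nzx]; first by rewrite subrr normr0.
have zx0 : 0 < `|z - x| by rewrite normr_gt0 subr_eq0.
rewrite -(ltr_pM2r zx0) -normrM mulrBl divfK ?subr_eq0 //.
apply: le_lt_trans (rx _ zab zx) _.
by rewrite ltr_pM2r // gtr_pMr // invf_lt1 // ltr1n.
Qed.

Lemma cont_atD a b f g x :
  cont_at a b f x -> cont_at a b g x -> cont_at a b (fun z => f z + g z) x.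
Proof. by move=> cf cg; apply: cvgD. Qed.

Lemma cont_atM a b f g x :
  cont_at a b f x -> cont_at a b g x -> cont_at a b (fun z => f z * g z) x.
Proof. by move=> cf cg; apply: cvgM. Qed.

Lemma cont_at_cst a b (c : R) x : cont_at a b (fun=> c) x.
Proof. exact: cvg_cst. Qed.

Lemma cont_at_sum a b (I : Type) (s : seq I) (F : I -> R -> R) x :
  (forall i, cont_at a b (F i) x) -> cont_at a b (fun z => \sum_(i <- s) F i z) x.
Proof. by move=> cF; apply: cvg_big => [|i _]; [exact: add_continuous|exact: cF]. Qed.

Lemma cont_at_prod a b (I : Type) (s : seq I) (F : I -> R -> R) x :
  (forall i, cont_at a b (F i) x) -> cont_at a b (fun z => \prod_(i <- s) F i z) x.
Proof. by move=> cF; apply: cvg_big => [|i _]; [exact: mul_continuous|exact: cF]. Qed.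

Lemma cont_atV a b f x : f x != 0 ->
  cont_at a b f x -> cont_at a b (fun z => (f z)^-1) x.
Proof. by move=> fx cf; apply: cvgV. Qed.

Lemma cont_at_eq a b f g x : (forall z, a <= z <= b -> f z = g z) ->
  a <= x <= b -> cont_at a b f x -> cont_at a b g x.
Proof.
move=> fg xab /cont_atP cf; apply/cont_atP => e e0; have [r r0 rf] := cf _ e0.
by exists r => // z zab zx; rewrite -!fg //; exact: rf.
Qed.

Lemma cont_at_comp a b a' b' f g x : (forall z, a <= z <= b -> a' <= g z <= b') ->
  cont_at a b g x -> cont_at a' b' f (g x) -> cont_at a b (fun z => f (g z)) x.
Proof.
move=> gI /cont_atP cg /cont_atP cf; apply/cont_atP => e e0.
have [r r0 rf] := cf _ e0; have [s s0 sg] := cg _ r0; exists s => // z zab zx.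
by apply: rf; [exact: gI|exact: sg].
Qed.

Lemma deriv_in_cont a b f x d : deriv_in a b f x d -> cont_at a b f x.
Proof.
move=> [q [fq _ cq]]; apply/cont_atP.
have : cont_at a b (fun z => q z * (z - x)) x.
  apply: cont_atM => //; apply: cvgB; last exact: cvg_cst.
  exact: cvg_within.
rewrite cont_atP subrr mulr0 => H e /H[r r0 rq]; exists r => // z zab zx.
by have := rq _ zab zx; rewrite subr0 fq.
Qed.

Lemma deriv_in_eq a b f g x d : (forall z, a <= z <= b -> f z = g z) ->
  a <= x <= b -> deriv_in a b f x d -> deriv_in a b g x d.
Proof.
by move=> fg xab [q [fq qx cq]]; exists q; split=> // z zab; rewrite -!fg // fq.
Qed.

Lemma deriv_in_cst a b (c : R) x : deriv_in a b (fun=> c) x 0.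
Proof.
by exists (fun=> 0); split=> // [z _|]; [rewrite subrr mul0r|exact: cont_at_cst].
Qed.

Lemma deriv_inD a b f g x d d' : deriv_in a b f x d -> deriv_in a b g x d' ->
  deriv_in a b (fun z => f z + g z) x (d + d').
Proof.
move=> [q [fq qx cq]] [p [gp px cp]]; exists (fun z => q z + p z); split=> //.
- by move=> z zab; rewrite mulrDl -fq // -gp //; ring.
- by rewrite qx px.
- exact: cont_atD.
Qed.

Lemma deriv_inM a b f g x d d' : deriv_in a b f x d -> deriv_in a b g x d' ->
  deriv_in a b (fun z => f z * g z) x (d * g x + f x * d').
Proof.
move=> df dg; have cg := deriv_in_cont dg.
have [q [fq qx cq]] := df; have [p [gp px cp]] := dg.
exists (fun z => q z * g z + f x * p z); split=> //.
- move=> z zab; rewrite mulrDl mulrAC -fq // -mulrA -gp //; ring.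
- by rewrite qx px.
- by apply: cont_atD; apply: cont_atM => //; exact: cont_at_cst.
Qed.

Lemma deriv_inZ a b (c : R) f x d : deriv_in a b f x d ->
  deriv_in a b (fun z => c * f z) x (c * d).
Proof.
by move=> df; have := deriv_inM (deriv_in_cst a b c x) df; rewrite mul0r add0r.
Qed.

Lemma deriv_in_sum a b (I : Type) (s : seq I) (F : I -> R -> R) (D : I -> R) x :
  (forall i, deriv_in a b (F i) x (D i)) ->
  deriv_in a b (fun z => \sum_(i <- s) F i z) x (\sum_(i <- s) D i).
Proof.
move=> dF; elim: s => [|i s IHs].
  have -> : (fun z => \sum_(i <- [::]) F i z) = (fun=> 0).
    by apply/funext => z; rewrite big_nil.
  by rewrite big_nil; exact: deriv_in_cst.
have -> : (fun z => \sum_(j <- i :: s) F j z) = (fun z => F i z + \sum_(j <- s) F j z).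
  by apply/funext => z; rewrite big_cons.
by rewrite big_cons; exact: deriv_inD.
Qed.

Lemma deriv_in_comp a b a' b' f g x d d' : (forall z, a <= z <= b -> a' <= g z <= b') ->
  deriv_in a b g x d -> deriv_in a' b' f (g x) d' ->
  deriv_in a b (fun z => f (g z)) x (d' * d).
Proof.
move=> gI dg [q [fq qx cq]]; have cg := deriv_in_cont dg.
have [p [gp px cp]] := dg; exists (fun z => q (g z) * p z); split.
- by move=> z zab; rewrite -mulrA -gp // fq //; exact: gI.
- by rewrite qx px.
- by apply: cont_atM => //; exact: (cont_at_comp gI).
Qed.

Lemma is_derive_deriv_in a b f x d : is_derive x 1 f d -> deriv_in a b f x d.
Proof.
move=> /is_derive1_caratheodory[q [fq cq qx]]; exists q; split=> //.
exact: cvg_within_filter.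
Qed.

Lemma deriv_in_is_derive a b f x d : a < x < b -> deriv_in a b f x d ->
  is_derive x 1 f d.
Proof.
move=> /andP[ax xb] [q [fq qx cq]].
pose p z := if z == x then d else (f z - f x) / (z - x).
have px : p x = d by rewrite /p eqxx.
apply/is_derive1_caratheodory; exists p; split => //.
  move=> z; rewrite /p; case: eqP => [->|/eqP zx]; first by rewrite !subrr mulr0.
  by rewrite divfK // subr_eq0.
apply/cvgrPdist_lt => e e0; move/cont_atP: cq => /(_ _ e0)[r r0 rq].
near=> z.
have zm : `|z - x| < Num.min (x - a) (b - x).
  near: z; apply/nbhs_ballP; exists (Num.min (x - a) (b - x)) => [|y].
    by rewrite /= lt_min !subr_gt0 ax.
  by rewrite /ball /= distrC.
have zab : a <= z <= b by move: zm; rewrite lt_min !ltr_norml; lra.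
have zx : `|z - x| < r.
  by near: z; apply/nbhs_ballP; exists r => // y; rewrite /ball /= distrC.
have := rq _ zab zx; rewrite distrC px /p qx; case: eqP => [_ _|/eqP nzx].
  by rewrite subrr normr0.
by rewrite fq // mulfK // subr_eq0.
Unshelve. all: by end_near. Qed.

(** Makes the punctured neighbourhoods within [[a, b]] a proper filter, also at the end points. A
    step of half of [min r (b - a)] fits to the right of [x] or, failing that, to its left. *)
Lemma itv_punctured_point a b x r : a < b -> a <= x <= b -> 0 < r ->
  exists z, [/\ a <= z <= b, `|z - x| < r & z != x].
Proof.
move=> ab /andP[ax xb] r0; pose m := Num.min r (b - a) / 2.
have m0 : 0 < m by rewrite divr_gt0 // lt_min r0 subr_gt0.
have mm : 2 * m = Num.min r (b - a) by rewrite /m; field.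
have mba : 2 * m <= b - a by rewrite mm ge_min lexx orbT.
have mr : m < r by have : 2 * m <= r; [rewrite mm ge_min lexx|lra].
have [xm|xm] := leP (x + m) b.
  exists (x + m); rewrite (addrC x) addrK gtr0_norm //; split=> //; first lra.
  by rewrite -subr_eq0 addrK gt_eqF.
exists (x - m); rewrite (addrC x) addrK normrN gtr0_norm //; split=> //; first lra.
by rewrite -subr_eq0 addrK oppr_eq0 gt_eqF.
Qed.

Lemma deriv_in_within a b f df : (forall x, a <= x <= b -> deriv_in a b f x (df x)) ->
  {within `[a, b], continuous f}.
Proof. by move=> dfE; apply/within_contP => x /dfE/deriv_in_cont. Qed.

Lemma within_sub a b u v f : a <= u -> v <= b ->
  {within `[a, b], continuous f} -> {within `[u, v], continuous f}.
Proof.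
move=> au vb; apply: continuous_subspaceW => z /=; rewrite !in_itv /=; lra.
Qed.

(** [f] minus a primitive of [g] is continuous up to the ends and has zero derivative inside.
    Matching [df] with [g] in the interior lets [g] be a clamped extension of [df]. *)
Lemma deriv_in_integ a b f df g u v : continuous g ->
  (forall x, a <= x <= b -> deriv_in a b f x (df x)) ->
  (forall x, a < x < b -> df x = g x) ->
  a <= u <= b -> a <= v <= b -> f v - f u = integ g u v.
Proof.
move=> cg dfE fg.
wlog uv : u v / u <= v => [H uab vab|/andP[au ub] /andP[av vb]].
  case/orP: (le_total u v) => [uv|vu]; first exact: H.
  by rewrite -opprB H // /integ opprB.
apply/eqP; rewrite -subr_eq0 -normr_le0 /integ.
set p := primitive g.
have -> : f v - f u - (p v - p u) = (f v - p v) - (f u - p u) by ring.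
rewrite -(subrr (0 : R)); apply: (@mean_value_ineq _ (f - p) (fun=> 0) (cst 0) (fun=> 0)) => //.
- move=> x /andP[ux xv]; have xab : a < x < b by lra.
  rewrite -(subrr (g x)) -{1}fg //.
  have xab' : a <= x <= b by lra.
  have := deriv_in_is_derive xab (dfE _ xab').
  by have := is_derive_primitive x cg => ? ?; exact: is_deriveB.
- move=> x; apply: cvgB; last exact: (is_derive_continuous (fun x => is_derive_primitive x cg)).
  by apply: (within_sub au vb); exact: deriv_in_within dfE.
- by move=> x; exact: cvg_cst.
- by rewrite normr0.
Qed.

End DerivIn.

(** * Semilinear transport along characteristics *)

Section Preliminaries.
Variable R : realType.

Lemma fin_bound (K : finType) (f : K -> R) : exists2 M : R, 0 < M & forall k, f k <= M.
Proof.
exists (1 + \sum_k `|f k|); first by rewrite ltr_pwDl // sumr_ge0.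
move=> k; rewrite (bigD1 k) //= (le_trans (ler_norm _)) // addrCA lerDl.
by rewrite addr_ge0 // sumr_ge0.
Qed.

(** The intervals with centre [u n] and half-length [2 A / 2 ^ n] are nested, and the supremum of
    their left ends lies in all of them. The result is a [sig], so that a limit function can be
    defined pointwise by [sval]. *)
Lemma geometric_limit (u : nat -> R) (A : R) :
  (forall n, `|u n.+1 - u n| <= A / 2 ^+ n) ->
  {l | forall n, `|u n - l| <= 2 * A / 2 ^+ n}.
Proof.
move=> uA; have A0 : 0 <= A.
  by have := uA 0; rewrite expr0 divr1; apply: le_trans.
pose p n := A / 2 ^+ n.
have p0 n : 0 <= p n by rewrite divr_ge0 // exprn_ge0.
have half n : p n = 2 * p n.+1 by rewrite /p exprS; field; rewrite expf_neq0.
pose lo n := u n - 2 * p n; pose hi n := u n + 2 * p n.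
have lo_step n : lo n <= lo n.+1.
  have := uA n; rewrite -/(p n) /lo ler_norml half; lra.
have hi_step n : hi n.+1 <= hi n.
  have := uA n; rewrite -/(p n) /hi ler_norml half; lra.
have lohi n : lo n <= hi n.
  by rewrite /lo /hi; have := p0 n; lra.
have lo_mono n m : (n <= m)%N -> lo n <= lo m.
  by elim: m => [|m IHm]; rewrite leq_eqVlt => /predU1P[->//|//]; rewrite ltnS => /IHm/le_trans; apply.
have hi_mono n m : (n <= m)%N -> hi m <= hi n.
  elim: m => [|m IHm]; rewrite leq_eqVlt => /predU1P[->//|//]; rewrite ltnS => /IHm.
  by apply: le_trans.
have lo_hi n m : lo n <= hi m.
  have [nm|/ltnW mn] := leqP n m.
    exact: le_trans (lo_mono _ _ nm) (lohi m).
  exact: le_trans (lohi n) (hi_mono _ _ mn).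
exists (sup [set lo n | n in setT]) => n.
have ub m : ubound [set lo n | n in setT] (hi m) by move=> _ [i _ <-].
have h1 : lo n <= sup [set lo n | n in setT].
  by apply: ub_le_sup; [exists (hi 0); exact: ub|exists n].
have h2 : sup [set lo n | n in setT] <= hi n.
  by apply: ge_sup; [exists (lo 0), 0%N|exact: ub].
by move: h1 h2; rewrite -mulrA -/(p n) /lo /hi ler_norml; lra.
Qed.

Lemma half_pow_small (A e : R) : 0 < e -> exists n, A / 2 ^+ n <= e.
Proof.
move=> e0; pose n := (Num.truncn (`|A| / e)).+1; exists n.
have n2 : (n%:R : R) <= 2 ^+ n by rewrite -natrX ler_nat ltnW // ltn_expl.
have p2 : 0 < (2 : R) ^+ n by rewrite exprn_gt0.
rewrite ler_pdivrMr //; apply: (le_trans (ler_norm _)).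
by rewrite mulrC -ler_pdivrMr // (le_trans _ n2) // ltW // truncnS_gt.
Qed.

Lemma is_derive_exp_lin (kp b x : R) : kp != 0 ->
  is_derive x 1 (fun y => kp^-1 * expR (kp * y + b)) (expR (kp * x + b)).
Proof.
move=> kp0.
have d1 : is_derive x 1 (fun y : R => kp * y + b) kp.
  have := is_derive_scale kp x => ?.
  rewrite -[X in is_derive _ _ _ X]addr0.
  exact: (@is_deriveD _ _ _ (kp \*: (id : R -> R)) (cst b)).
have d2 : is_derive x 1 (fun y : R => expR (kp * y + b)) (expR (kp * x + b) * kp).
  exact: (@is_derive1_comp _ expR (fun y : R => kp * y + b)).
rewrite -[X in is_derive _ _ _ X](mulKf kp0) [kp * expR _]mulrC.
exact: (@is_deriveZ _ _ _ _ kp^-1 _ _ _ d2).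
Qed.

(* The weight [expR (kp * t - mu * x)] makes the reflections at the entry ends
   contractive through [mu], and the source terms through [kp]. *)
Lemma exp_weights (K : finType) (L : K -> R) (S C : R) :
  (forall k, 0 < L k) -> 0 <= S -> 0 <= C ->
  exists mu kp : R, [/\ 0 < mu, 1 <= kp, mu <= kp,
    forall k, S * expR (- (mu * L k)) <= 1 / 4 &
    forall k, C * expR (mu * L k) / kp <= 1 / 4].
Proof.
move=> L0 S0 C0.
have [m m0 Lm] := fin_bound (fun k => (L k)^-1).
have [M M0 LM] := fin_bound L.
(* [m] bounds every [1 / L k], so [mu * L k >= 4 S + 1], and [1 + y <= expR y] then gives
   [expR (mu * L k) >= 4 S]. *)
pose mu := (4 * S + 1) * m.
have S4 : 0 < 4 * S + 1 by lra.
have mu0 : 0 < mu by rewrite mulr_gt0.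
pose kp := Num.max (Num.max 1 mu) (4 * C * expR (mu * M)).
have kp1 : 1 <= kp by rewrite !le_max lexx.
have kp0 : 0 < kp by lra.
exists mu, kp; split=> //.
- by rewrite !le_max lexx orbT.
- move=> k; have e4 : 4 * S <= expR (mu * L k).
    apply: (@le_trans _ _ (1 + mu * L k)); last by rewrite expR_ge1Dx.
    have : 4 * S + 1 <= mu * L k.
      by rewrite /mu -mulrA ler_pMr // -ler_pdivrMr // div1r.
    lra.
  by rewrite expRN ler_pdivrMr ?expR_gt0 //; lra.
- move=> k; rewrite ler_pdivrMr //.
  have : C * expR (mu * L k) <= C * expR (mu * M).
    by rewrite ler_wpM2l // ler_expR ler_pM2l.
  have : 4 * C * expR (mu * M) <= kp by rewrite !le_max lexx !orbT.
  lra.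
Qed.

End Preliminaries.

(** * Quadratic source terms and their time derivatives *)

Section Source.
Variables (R : realType) (K : finType).

Lemma buc_fin_bound (I : finType) (F : I -> R -> R -> R) : (forall i, buc (F i)) ->
  exists2 M : R, 0 < M & forall i x t, `|F i x t| <= M.
Proof.
move=> bF; have /choice[B BP] : forall i, exists B : R, forall x t, `|F i x t| <= B.
  by move=> i; have [] := bF i.
have [M M0 BM] := fin_bound B; exists M => // i x t.
exact: le_trans (BP _ _ _) (BM _).
Qed.

Lemma sum_coef_le (I : finType) (b u : I -> R) (d : R) : (forall i, `|u i| <= d) ->
  `|\sum_i b i * u i| <= (\sum_i `|b i|) * d.
Proof.
move=> ud; apply: le_trans (ler_norm_sum _ _ _) _; rewrite mulr_suml ler_sum // => i _.
by rewrite normrM ler_wpM2l.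
Qed.

Variables (a : K -> K -> R -> R) (c : K -> K -> K -> R -> R).

Definition source k x (u : K -> R) : R :=
  \sum_l a k l x * u l + \sum_(p : K * K) c k p.1 p.2 x * (u p.1 * u p.2).

(** The derivative of [source] in [u] along [w]. As [a] and [c] depend on [x] only, it is the time
    derivative of the source when [w] is the time derivative of [u]. *)
Definition dsource k x (u w : K -> R) : R :=
  \sum_l a k l x * w l +
  \sum_(p : K * K) c k p.1 p.2 x * (w p.1 * u p.2 + u p.1 * w p.2).

Variable M : R.
Hypothesis aM : forall k x, \sum_l `|a k l x| <= M.
Hypothesis cM : forall k x, \sum_(p : K * K) `|c k p.1 p.2 x| <= M.

Lemma source_lip k x u u' B d : 0 <= B -> 0 <= d ->
  (forall l, `|u l| <= B) -> (forall l, `|u' l| <= B) ->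
  (forall l, `|u l - u' l| <= d) ->
  `|source k x u - source k x u'| <= M * (1 + 2 * B) * d.
Proof.
move=> B0 d0 uB u'B uu'.
have -> : source k x u - source k x u' = \sum_l a k l x * (u l - u' l) +
  \sum_(p : K * K) c k p.1 p.2 x * (u p.1 * u p.2 - u' p.1 * u' p.2).
  rewrite /source opprD addrACA -!sumrB.
  by congr (_ + _); apply: eq_bigr => i _; rewrite mulrBr.
apply: le_trans (ler_normD _ _) _.
have -> : M * (1 + 2 * B) * d = M * d + M * (2 * B * d) by ring.
apply: lerD.
  by apply: le_trans (sum_coef_le _ uu') _; rewrite ler_wpM2r.
apply: le_trans (sum_coef_le (d := 2 * B * d) _ _) _; last first.
  by rewrite ler_wpM2r // !mulr_ge0.
move=> [l m] /=.
have -> : u l * u m - u' l * u' m = (u l - u' l) * u m + u' l * (u m - u' m) by ring.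
apply: le_trans (ler_normD _ _) _; rewrite !normrM.
have -> : 2 * B * d = d * B + B * d by ring.
by rewrite lerD // ler_pM.
Qed.

Lemma source_bound k x u B : 0 <= B -> (forall l, `|u l| <= B) ->
  `|source k x u| <= M * (1 + 2 * B) * B.
Proof.
move=> B0 uB; have := @source_lip k x u (fun=> 0) B B B0 B0 uB.
have -> : source k x (fun=> 0) = 0.
  by rewrite /source !big1 ?addr0 // => i _; rewrite ?mul0r mulr0.
by rewrite subr0; apply=> l; rewrite ?normr0 ?subr0.
Qed.

Lemma dsource_lip k x u u' w w' B d : 0 <= B -> 0 <= d ->
  (forall l, `|u l| <= B) -> (forall l, `|u' l| <= B) ->
  (forall l, `|w l| <= B) -> (forall l, `|w' l| <= B) ->
  (forall l, `|u l - u' l| <= d) -> (forall l, `|w l - w' l| <= d) ->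
  `|dsource k x u w - dsource k x u' w'| <= M * (1 + 4 * B) * d.
Proof.
move=> B0 d0 uB u'B wB w'B uu' ww'.
have -> : dsource k x u w - dsource k x u' w' = \sum_l a k l x * (w l - w' l) +
  \sum_(p : K * K) c k p.1 p.2 x * ((w p.1 * u p.2 + u p.1 * w p.2) -
    (w' p.1 * u' p.2 + u' p.1 * w' p.2)).
  rewrite /dsource opprD addrACA -!sumrB.
  by congr (_ + _); apply: eq_bigr => i _; rewrite mulrBr.
apply: le_trans (ler_normD _ _) _.
have -> : M * (1 + 4 * B) * d = M * d + M * (4 * B * d) by ring.
apply: lerD.
  by apply: le_trans (sum_coef_le _ ww') _; rewrite ler_wpM2r.
apply: le_trans (sum_coef_le (d := 4 * B * d) _ _) _; last first.
  by rewrite ler_wpM2r // !mulr_ge0.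
move=> [l m] /=.
have -> : w l * u m + u l * w m - (w' l * u' m + u' l * w' m) =
  ((w l - w' l) * u m + w' l * (u m - u' m)) +
  ((u l - u' l) * w m + u' l * (w m - w' m)) by ring.
have -> : 4 * B * d = (d * B + B * d) + (d * B + B * d) by ring.
by do 3!rewrite ?lerD ?(le_trans (ler_normD _ _)) //; rewrite !normrM ?ler_pM.
Qed.

Lemma dsource_bound k x u w B W : 0 <= B -> 0 <= W ->
  (forall l, `|u l| <= B) -> (forall l, `|w l| <= W) ->
  `|dsource k x u w| <= M * (1 + 2 * B) * W.
Proof.
move=> B0 W0 uB wW; apply: le_trans (ler_normD _ _) _.
have -> : M * (1 + 2 * B) * W = M * W + M * (2 * B * W) by ring.
apply: lerD.
  by apply: le_trans (sum_coef_le _ wW) _; rewrite ler_wpM2r.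
apply: le_trans (sum_coef_le (d := 2 * B * W) _ _) _; last first.
  by rewrite ler_wpM2r // !mulr_ge0.
move=> [l m] /=; apply: le_trans (ler_normD _ _) _; rewrite !normrM.
have -> : 2 * B * W = W * B + B * W by ring.
by rewrite lerD // ler_pM.
Qed.

(** [u] carries the index [k] as well because component [l] will be read at a position depending on
    [k], namely [th k l x]. *)
Lemma source_buc (u : K -> K -> R -> R -> R) k :
  (forall k l, buc (fun x _ => a k l x)) ->
  (forall k l m, buc (fun x _ => c k l m x)) ->
  (forall l, buc (u k l)) ->
  buc (fun x t => source k x (fun l => u k l x t)).
Proof.
move=> ba bc bu; apply: bucD; apply: buc_sum => i; apply: bucM => //.
exact: bucM.
Qed.

Lemma dsource_buc (u w : K -> K -> R -> R -> R) k :
  (forall k l, buc (fun x _ => a k l x)) ->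
  (forall k l m, buc (fun x _ => c k l m x)) ->
  (forall l, buc (u k l)) -> (forall l, buc (w k l)) ->
  buc (fun x t => dsource k x (fun l => u k l x t) (fun l => w k l x t)).
Proof.
move=> ba bc bu bw; apply: bucD; apply: buc_sum => i; apply: bucM => //.
by apply: bucD; apply: bucM.
Qed.

Lemma source_deriv_in k x (u w : K -> R -> R) (lo hi t : R) :
  (forall l, deriv_in lo hi (u l) t (w l t)) ->
  deriv_in lo hi (fun s => source k x (fun l => u l s)) t
    (dsource k x (fun l => u l t) (fun l => w l t)).
Proof.
move=> du; apply: deriv_inD; apply: deriv_in_sum => i; apply: deriv_inZ => //.
exact: deriv_inM.
Qed.

End Source.

(** * Exponentially weighted bounds along characteristics *)

Section Weights.
Variables (R : realType) (K : finType) (L : K -> R) (T : R) (kap : K -> K -> R).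
Variables (S C mu kp : R).
Hypothesis L0 : forall k, 0 < L k.
Hypothesis kapS : forall k, \sum_l `|kap k l| <= S.
Hypothesis S0 : 0 < S.
Hypothesis C0 : 0 <= C.
Hypothesis mu0 : 0 < mu.
Hypothesis kp1 : 1 <= kp.
Hypothesis mukp : mu <= kp.
Hypothesis S4 : forall k, S * expR (- (mu * L k)) <= 1 / 4.
Hypothesis C4 : forall k, C * expR (mu * L k) / kp <= 1 / 4.
Implicit Types (s t x y d : R).

Definition in_rect k x t := 0 <= x <= L k /\ 0 <= t <= T.

Definition weight x t := expR (kp * t - mu * x).

Lemma kp_gt0 : 0 < kp.
Proof. by have := kp1; lra. Qed.

Lemma weight_le x t : 0 <= x -> weight x t <= expR (kp * t).
Proof. by move=> x0; rewrite /weight ler_expR gerBl mulr_ge0 // ltW. Qed.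

(** Either the characteristic through [(x, t)] starts on [t = 0], and the exit values of [e] vanish
    there, or it entered at time [s = t - x]. In the second case the reflected terms are read at the
    far ends, whose weights carry [expR (- mu L l)], enough to beat the sum [S] of the reflection
    coefficients; then [mu <= kp] gives [expR (kp (t - x)) <= weight x t]. *)
Lemma entry_contraction (e : K -> R -> R -> R) d k x t : 0 <= d ->
  (forall k x t, in_rect k x t -> `|e k x t| <= d * weight x t) ->
  (forall l, e l (L l) 0 = 0) -> in_rect k x t ->
  `|\sum_l kap k l * e l (L l) (Num.max 0 (t - x))| <= d * (1 / 4 * weight x t).
Proof.
move=> d0 ed e0 [xL tT]; set s := Num.max 0 (t - x).
have [x0 t0] : 0 <= x /\ 0 <= t by case/andP: xL => ? ?; case/andP: tT.
have [tx|xt] := leP t x.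
  have -> : s = 0 by rewrite /s max_l // subr_le0.
  rewrite big1 ?normr0 ?mulr_ge0 ?expR_ge0 // => l _.
  by rewrite e0 mulr0.
have sE : s = t - x by rewrite /s max_r // subr_ge0 ltW.
have sT : 0 <= s <= T by rewrite sE; lra.
apply: (@le_trans _ _ (\sum_l `|kap k l| * (d * weight (L l) s))).
  apply: le_trans (ler_norm_sum _ _ _) _; apply: ler_sum => l _.
  rewrite normrM ler_wpM2l //; apply: ed; split=> //.
  by rewrite lexx ltW.
pose b := d * (expR (kp * s) * (1 / 4 / S)).
have b0 : 0 <= b by rewrite !mulr_ge0 ?expR_ge0 // invr_ge0 ltW.
apply: (@le_trans _ _ (\sum_l `|kap k l| * b)).
  apply: ler_sum => l _; rewrite ler_wpM2l // ler_wpM2l //.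
  by rewrite /weight expRD ler_wpM2l ?expR_ge0 // ler_pdivlMr // mulrC.
rewrite -mulr_suml; apply: (@le_trans _ _ (S * b)); first by rewrite ler_wpM2r.
have -> : S * b = d * (1 / 4 * expR (kp * s)).
  by rewrite /b; field; rewrite lt0r_neq0.
rewrite !ler_wpM2l // /weight ler_expR sE mulrBr lerD2l lerN2.
by rewrite ler_wpM2r.
Qed.

(** A primitive in [y] of the time part of the weight along the characteristic through [(x, t)]. *)
Definition growth t x y := kp^-1 * expR (kp * y + kp * (t - x)).

Lemma is_derive_growth d t x y :
  is_derive y 1 ((C * d) \*: growth t x) (C * d * expR (kp * (t - x + y))).
Proof.
rewrite mulrDr addrC.
have := is_derive_exp_lin (kp * (t - x)) y (lt0r_neq0 kp_gt0) => ?.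
exact: is_deriveZ.
Qed.

(** Integration in time yields [1 / kp]. The factor [expR (- mu x)] missing from the integrand costs
    at most [expR (mu * L k)], and [C4] says that [1 / kp] pays for it. *)
Lemma growth_bound d k x t y : 0 <= d -> 0 <= x <= L k ->
  C * d * growth t x x - C * d * growth t x y <= d * (1 / 4 * weight x t).
Proof.
move=> d0 xL; have kp0 := kp_gt0.
apply: (@le_trans _ _ (C * d * growth t x x)).
  rewrite gerBl; apply: mulr_ge0; first exact: mulr_ge0.
  by rewrite mulr_ge0 ?expR_ge0 // invr_ge0 ltW.
have -> : growth t x x = kp^-1 * expR (kp * t) by rewrite /growth -mulrDr addrC subrK.
set E := expR (kp * t).
have e1 : expR (mu * L k) * expR (- (mu * L k)) = 1 by rewrite -expRD subrr expR0.
have -> : C * d * (kp^-1 * E) =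
    d * (C * expR (mu * L k) / kp * (E * expR (- (mu * L k)))).
  rewrite -[LHS]mulr1 -e1; ring.
apply: ler_wpM2l => //; apply: ler_pM.
- by apply: divr_ge0; [rewrite mulr_ge0 ?expR_ge0|exact: ltW].
- by rewrite mulr_ge0 ?expR_ge0.
- exact: C4.
- rewrite -expRD ler_expR lerD2l lerN2 ler_pM2l //.
  by case/andP: xL.
Qed.

End Weights.

(** * Picard iteration for the time derivative *)

Section Picard.
Variables (R : realType) (K : finType) (L : K -> R) (T : R).
Variables (kap : K -> K -> R) (th : K -> K -> R -> R).
Variables (a : K -> K -> R -> R) (c : K -> K -> K -> R -> R).
Hypothesis L0 : forall k, 0 < L k.
Hypothesis T0 : 0 < T.
Hypothesis th_itv : forall k l x, 0 <= th k l x <= L l.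
Hypothesis th_uc : forall k l, ucont2 (fun x _ => th k l x).
Hypothesis a_buc : forall k l, buc (fun x _ => a k l x).
Hypothesis c_buc : forall k l m, buc (fun x _ => c k l m x).

Variables r0 dr0 dQ : K -> R -> R.
Hypothesis r0_buc : forall k, buc (fun x _ => r0 k x).
Hypothesis dr0_buc : forall k, buc (fun x _ => dr0 k x).
Hypothesis dQ_buc : forall k, buc (fun t _ => dQ k t).

(* [r1] is the initial value of [w = d_t r], and [tint w] recovers [r] from [w]. *)
Definition r1 k x : R := source a c k x (fun l => r0 l (th k l x)) - dr0 k x.

Implicit Types (w : K -> R -> R -> R) (s t x y d : R).

Definition tint w k x t : R := r0 k x + integ (w k x) 0 (clamp 0 T t).

Definition rhs w k x t : R :=
  dsource a c k x (fun l => tint w l (th k l x) t)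
    (fun l => w l (th k l x) (clamp 0 T t)).

(* The equation for [w = d_t r], integrated along the characteristic line from
   its entry point, which is on [t = 0] or on [x = 0]. *)
Definition picard w k x t : R :=
  let x := clamp 0 (L k) x in let t := clamp 0 T t in
  \sum_l kap k l * w l (L l) (Num.max 0 (t - x)) + dQ k (Num.max 0 (t - x))
  + r1 k (Num.max 0 (x - t)) - r1 k 0
  + integ (fun y => rhs w k y (t - x + y)) (Num.max 0 (x - t)) x.

Lemma r1_buc k : buc (fun x _ => r1 k x).
Proof.
apply: bucB => //.
apply: (source_buc (u := fun k l x _ => r0 l (th k l x)) (k := k) a_buc c_buc) => l.
exact: (buc_comp (r0_buc l) (th_uc k l) (@ucont2_cst _ 0)).
Qed.

Lemma tint_buc w k : (forall k, buc (w k)) -> buc (tint w k).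
Proof.
move=> bw; apply: bucD.
  exact: (buc_comp (r0_buc k) (@ucont2_fst _) (@ucont2_cst _ 0)).
apply: (buc_integ (M := T) (bw k) (@ucont2_fst _) (@ucont2_cst _ 0)).
- exact: ucont2_clamp _ _ (@ucont2_snd _).
- by move=> _ _; rewrite lexx ltW.
- by move=> _ t; exact: clamp_itv (ltW T0).
Qed.

Lemma rhs_buc w k : (forall k, buc (w k)) -> buc (rhs w k).
Proof.
move=> bw.
apply: (dsource_buc (u := fun k l x t => tint w l (th k l x) t)
  (w := fun k l x t => w l (th k l x) (clamp 0 T t)) (k := k) a_buc c_buc) => l.
  apply: (buc_comp (tint_buc l bw)); last exact: ucont2_snd.
  exact: (ucont2_comp (th_uc k l) (@ucont2_fst _) (@ucont2_snd _)).
apply: (buc_comp (bw l)); last exact: ucont2_clamp _ _ (@ucont2_snd _).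
exact: (ucont2_comp (th_uc k l) (@ucont2_fst _) (@ucont2_snd _)).
Qed.

Lemma rhs_char_buc w k : (forall k, buc (w k)) -> buc (fun s y => rhs w k y (s + y)).
Proof.
move=> bw; apply: (buc_comp (rhs_buc k bw) (@ucont2_snd _)).
exact: ucont2D (@ucont2_fst _) (@ucont2_snd _).
Qed.

Lemma picard_buc w k : (forall k, buc (w k)) -> buc (picard w k).
Proof.
move=> bw.
have ux : ucont2 (fun x t : R => clamp 0 (L k) x) := ucont2_clamp _ _ (@ucont2_fst _).
have ut : ucont2 (fun x t : R => clamp 0 T t) := ucont2_clamp _ _ (@ucont2_snd _).
have utx := ucont2_max 0 (ucont2B ut ux).
have uxt := ucont2_max 0 (ucont2B ux ut).
apply: bucD; last first.
  apply: (buc_integ (M := L k) (rhs_char_buc k bw) (ucont2B ut ux) uxt ux).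
    move=> x t; have h := clamp_itv x (ltW (L0 k)); have h' := clamp_itv t (ltW T0).
    by rewrite le_max lexx ge_max /=; lra.
  by move=> x t; exact: clamp_itv (ltW (L0 k)).
apply: bucB; last exact: buc_cst.
apply: bucD; last exact: (buc_comp (r1_buc k) uxt (@ucont2_cst _ 0)).
apply: bucD; last exact: (buc_comp (dQ_buc k) utx (@ucont2_cst _ 0)).
apply: buc_sum => l; apply: bucM; first exact: buc_cst.
exact: (buc_comp (bw l) (@ucont2_cst _ (L l)) utx).
Qed.

Hypothesis r1_entry : forall k, r1 k 0 = \sum_l kap k l * r1 l (L l) + dQ k 0.

(** This is where first-order compatibility enters. For [t <= x] the entry terms of [picard] are
    taken at time 0 and, for [w] with these initial values, equal [r1 k 0] by [r1_entry], cancelling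
    the subtracted [r1 k 0]; for [t >= x] the two [r1] terms cancel each other. One continuous
    formula thus serves on both sides of the characteristic issued from the node. *)
Lemma picard_init w k x :
  (forall l, w l (L l) 0 = r1 l (L l)) -> 0 <= x <= L k -> picard w k x 0 = r1 k x.
Proof.
move=> w0 xL; rewrite /picard (clamp_id xL) (clamp_id (x := 0)) ?lexx ?ltW //.
have x0 : 0 <= x by case/andP: xL.
rewrite subr0 sub0r (max_l (y := - x)) ?oppr_le0 // (max_r x0) /integ subrr addr0.
have -> : \sum_l kap k l * w l (L l) 0 = \sum_l kap k l * r1 l (L l).
  by apply: eq_bigr => l _; rewrite w0.
by rewrite r1_entry; ring.
Qed.

Section Contraction.
Variables (M S mu kp : R).
Hypothesis aM : forall k x, \sum_l `|a k l x| <= M.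
Hypothesis cM : forall k x, \sum_(p : K * K) `|c k p.1 p.2 x| <= M.
Hypothesis kapS : forall k, \sum_l `|kap k l| <= S.
Hypothesis S0 : 0 < S.
Hypothesis mu0 : 0 < mu.
Hypothesis kp1 : 1 <= kp.
Hypothesis mukp : mu <= kp.
(** The Lipschitz constant of [dsource] on the ball of radius [2 + T], which contains [w] and also
    [tint w] (at most 1 from [r0] plus [T] from the integral) as long as [|w| <= 1]. *)
Let C := M * (1 + 4 * (2 + T)).
Hypothesis S4 : forall k, S * expR (- (mu * L k)) <= 1 / 4.
Hypothesis C4 : forall k, C * expR (mu * L k) / kp <= 1 / 4.
Hypothesis r0_le1 : forall k x, `|r0 k x| <= 1.

Local Notation in_rect := (in_rect L T).
Local Notation weight := (weight mu kp).
Let kp0 := kp_gt0 kp1.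
Let weight_le := weight_le kp mu0.

Definition bounded1 w := forall k x t, in_rect k x t -> `|w k x t| <= 1.

Lemma tint_bound w k x t : (forall k, buc (w k)) -> bounded1 w ->
  in_rect k x t -> `|tint w k x t| <= 2 + T.
Proof.
move=> bw w1 [xL tT]; rewrite /tint (clamp_id tT).
apply: le_trans (ler_normD _ _) _.
have t0 : 0 <= t by case/andP: tT.
have : `|integ (w k x) 0 t| <= 1 * `|t - 0|.
  apply: integ_bound; first exact: ucont2_slice (bw k).2.
  rewrite min_l // max_r // => s st; apply: w1; split=> //; lra.
rewrite mul1r subr0 (ger0_norm t0).
by have := r0_le1 k x; lra.
Qed.

(** Integrating [expR (kp * s)] in time gives a factor [1 / kp <= 1], so [tint] does not worsen the
    estimate. *)
Lemma tint_contraction w w' d k x t :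
  (forall k, buc (w k)) -> (forall k, buc (w' k)) -> 0 <= d ->
  (forall k x t, in_rect k x t -> `|w k x t - w' k x t| <= d * weight x t) ->
  in_rect k x t -> `|tint w k x t - tint w' k x t| <= d * expR (kp * t).
Proof.
move=> bw bw' d0 ww' [xL tT]; rewrite /tint (clamp_id tT) opprD addrACA subrr add0r.
have cw l y := ucont2_slice (x := y) (bw l).2.
have cw' l y := ucont2_slice (x := y) (bw' l).2.
have [x0 t0] : 0 <= x /\ 0 <= t by case/andP: xL => ? ?; case/andP: tT.
rewrite -integB //.
apply: (@le_trans _ _ (d * (kp^-1 * expR (kp * t + 0)) - d * (kp^-1 * expR (kp * 0 + 0)))).
  apply: (integ_le (G := d \*: (fun y => kp^-1 * expR (kp * y + 0)))
    (dG := fun y => d * expR (kp * y + 0))) => //.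
  - by move=> y; apply: cvgB; [exact: cw|exact: cw'].
  - move=> y; have := is_derive_exp_lin 0 y (lt0r_neq0 kp0) => ?.
    exact: is_deriveZ.
  - move=> s st; have st' : 0 <= s <= T by move: tT; lra.
    apply: le_trans (ww' k x s (conj xL st')) _; rewrite addr0 ler_wpM2l //.
    exact: weight_le.
rewrite !addr0; apply: (@le_trans _ _ (d * (kp^-1 * expR (kp * t)))).
  by rewrite gerBl !mulr_ge0 ?expR_ge0 // invr_ge0 ltW.
by rewrite ler_wpM2l // ler_piMl ?expR_ge0 // invf_le1.
Qed.

Lemma M_ge0 (k : K) : 0 <= M.
Proof. by apply: le_trans (aM k 0); rewrite sumr_ge0. Qed.

(** Only the time part of the weight survives: component [l] is read at [th k l x], whose weight in
    space is not comparable with the one at [x]. The loss is made up in [growth_bound]. *)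
Lemma rhs_contraction w w' d k x t :
  (forall k, buc (w k)) -> (forall k, buc (w' k)) -> 0 <= d ->
  bounded1 w -> bounded1 w' ->
  (forall k x t, in_rect k x t -> `|w k x t - w' k x t| <= d * weight x t) ->
  0 <= t <= T -> `|rhs w k x t - rhs w' k x t| <= C * (d * expR (kp * t)).
Proof.
move=> bw bw' d0 w1 w'1 ww' tT.
have rect l : in_rect l (th k l x) t by split.
have T2 : 0 <= 2 + T by have := T0; lra.
rewrite /rhs (clamp_id tT); apply: (dsource_lip aM cM) => //.
- by rewrite mulr_ge0 ?expR_ge0.
- by move=> l; exact: tint_bound.
- by move=> l; exact: tint_bound.
- by move=> l; apply: le_trans (w1 _ _ _ (rect l)) _; have := T0; lra.
- by move=> l; apply: le_trans (w'1 _ _ _ (rect l)) _; have := T0; lra.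
- by move=> l; exact: tint_contraction.
- move=> l; apply: le_trans (ww' _ _ _ (rect l)) _; rewrite ler_wpM2l //.
  by apply: weight_le; case/andP: (th_itv k l x).
Qed.

(** The data terms cancel in the difference. The reflected terms and the integral take a quarter
    each, by [entry_contraction] and by [growth_bound]. *)
Lemma picard_contraction w w' d :
  (forall k, buc (w k)) -> (forall k, buc (w' k)) -> 0 <= d ->
  bounded1 w -> bounded1 w' -> (forall l, w l (L l) 0 = w' l (L l) 0) ->
  (forall k x t, in_rect k x t -> `|w k x t - w' k x t| <= d * weight x t) ->
  forall k x t, in_rect k x t -> `|picard w k x t - picard w' k x t| <= d / 2 * weight x t.
Proof.
move=> bw bw' d0 w1 w'1 w00 ww' k x t [xL tT].
have C0 : 0 <= C by rewrite mulr_ge0 ?(M_ge0 k) //; have := T0; lra.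
rewrite /picard (clamp_id xL) (clamp_id tT).
set s := Num.max 0 (t - x); set y0 := Num.max 0 (x - t).
set I := integ _ y0 x; set I' := integ _ y0 x.
have -> : \sum_l kap k l * w l (L l) s + dQ k s + r1 k y0 - r1 k 0 + I -
  (\sum_l kap k l * w' l (L l) s + dQ k s + r1 k y0 - r1 k 0 + I') =
  \sum_l kap k l * (w l (L l) s - w' l (L l) s) + (I - I').
  under [in RHS]eq_bigr do rewrite mulrBr.
  by rewrite sumrB; ring.
have -> : d / 2 * weight x t = d * (1 / 4 * weight x t) + d * (1 / 4 * weight x t) by field.
have [x0 t0] : 0 <= x /\ 0 <= t by case/andP: xL => ? ?; case/andP: tT.
apply: le_trans (ler_normD _ _) _; apply: lerD.
  apply: (entry_contraction (T := T) (e := fun k x t => w k x t - w' k x t) L0 kapS S0 mukp S4) => //.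
  by move=> l; rewrite w00 subrr.
have cw : continuous (fun y => rhs w k y (t - x + y)).
  exact: (ucont2_slice (x := t - x) (rhs_char_buc k bw).2).
have cw' : continuous (fun y => rhs w' k y (t - x + y)).
  exact: (ucont2_slice (x := t - x) (rhs_char_buc k bw').2).
have y0x : y0 <= x by rewrite /y0 ge_max x0 /=; lra.
rewrite /I /I' -integB //.
apply: le_trans (growth_bound C0 mu0 kp1 C4 t y0 d0 xL).
apply: (integ_le (G := (C * d) \*: growth kp t x)
  (dG := fun y => C * d * expR (kp * (t - x + y)))) => //.
- by move=> y; apply: cvgB; [exact: cw|exact: cw'].
- by move=> y; exact: is_derive_growth.
- move=> y /andP[y0y yx]; rewrite -mulrA.
  apply: rhs_contraction => //.
  by move: y0y; rewrite /y0 gt_max => /andP[? ?]; lra.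
Qed.

Variables (Lmax e1 e2 : R).
Hypothesis Lmax_ge : forall k, L k <= Lmax.
Let emin := expR (- (mu * Lmax)).
Let emax := expR (kp * T).
Let w0 k x (t : R) := r1 k (clamp 0 (L k) x).
(** The first Picard step is bounded by [e2] in the plain norm; dividing by the lower bound [emin]
    of the weight makes this a weighted bound. The steps then add up to at most [2 * d0], and
    [small] keeps all iterates in the unit ball, where the contraction holds. *)
Let d0 := e2 / emin.
Hypothesis e2_ge0 : 0 <= e2.
Hypothesis w0_bound : forall k x, 0 <= x <= L k -> `|r1 k x| <= e1.
Hypothesis w0_start : forall k x t, in_rect k x t ->
  `|picard w0 k x t - w0 k x t| <= e2.
Hypothesis small : e1 + 2 * d0 * emax <= 1.

Lemma weight_max k x t : in_rect k x t -> weight x t <= emax.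
Proof.
move=> [/andP[x0 _] /andP[_ tT]]; apply: le_trans (weight_le t x0) _.
by rewrite ler_expR ler_pM2l // kp0.
Qed.

Lemma weight_min k x t : in_rect k x t -> emin <= weight x t.
Proof.
move=> [/andP[_ xL] /andP[t0 _]]; rewrite ler_expR.
have : mu * x <= mu * Lmax by rewrite ler_pM2l // (le_trans xL).
by have : 0 <= kp * t; [rewrite mulr_ge0 // ltW|lra].
Qed.

Lemma d0_ge0 : 0 <= d0.
Proof. by rewrite divr_ge0 // expR_ge0. Qed.

Let W n := iter n picard w0.

Lemma iter_buc n k : buc (W n k).
Proof.
elim: n k => [|n IHn] k; last exact: picard_buc.
exact: (buc_comp (r1_buc k) (ucont2_clamp _ _ (@ucont2_fst _)) (@ucont2_cst _ 0)).
Qed.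

Lemma iter_init n k x : 0 <= x <= L k -> W n k x 0 = r1 k x.
Proof.
elim: n k x => [|n IHn] k x xL; first by rewrite /W /= /w0 clamp_id.
by apply: picard_init => // l; apply: IHn; rewrite lexx ltW.
Qed.

Lemma clampK (b x : R) : 0 <= b -> clamp 0 b (clamp 0 b x) = clamp 0 b x.
Proof. by move=> b0; rewrite clamp_id // clamp_itv. Qed.

(** The iterates are determined by their values on the rectangle, so bounds proved there give
    uniform convergence on the plane and the limit stays in [buc]. *)
Lemma iter_clamp n k x t : W n k x t = W n k (clamp 0 (L k) x) (clamp 0 T t).
Proof.
case: n => [|n]; first by rewrite /W /= /w0 clampK // ltW.
by rewrite /W /= /picard !clampK // ltW.
Qed.

Lemma clamp_in_rect k x t : in_rect k (clamp 0 (L k) x) (clamp 0 T t).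
Proof. by split; apply: clamp_itv; exact: ltW. Qed.

Lemma iter_estimate n :
  [/\ bounded1 (W n),
    forall k x t, in_rect k x t -> `|W n k x t - w0 k x t| <= 2 * d0 * weight x t &
    forall k x t, in_rect k x t ->
      `|W n.+1 k x t - W n k x t| <= d0 / 2 ^+ n * weight x t].
Proof.
have d00 := d0_ge0; have d20 : 0 <= 2 * d0 := mulr_ge0 (ler0n R 2) d00.
have bounded v : (forall k x t, in_rect k x t ->
    `|v k x t - w0 k x t| <= 2 * d0 * weight x t) -> bounded1 v.
  move=> vw k x t kxt; have := vw _ _ _ kxt.
  have : `|w0 k x t| <= e1 by apply: w0_bound; apply: clamp_itv; exact: ltW.
  have : 2 * d0 * weight x t <= 2 * d0 * emax.
    by rewrite (ler_wpM2l d20) //; exact: weight_max kxt.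
  have := small; rewrite !ler_norml; lra.
have weight0 x t : 0 <= weight x t by exact: expR_ge0.
(* The contraction is available only in the unit ball, so the induction carries the distance from
   [w0] along with the size of the step; [2 * d0 * (1 - 1 / 2 ^+ n)] is the partial sum of the steps
   [d0 / 2 ^+ i]. *)
suff [] : (forall k x t, in_rect k x t ->
      `|W n k x t - w0 k x t| <= 2 * d0 * (1 - 1 / 2 ^+ n) * weight x t) /\
    (forall k x t, in_rect k x t ->
      `|W n.+1 k x t - W n k x t| <= d0 / 2 ^+ n * weight x t).
  move=> h1 h2.
  have h3 k x t : in_rect k x t -> `|W n k x t - w0 k x t| <= 2 * d0 * weight x t.
    move=> kxt; apply: le_trans (h1 _ _ _ kxt) _; rewrite ler_wpM2r //.
    by rewrite (ler_piMr d20) // gerBl divr_ge0 // exprn_ge0.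
  by split=> //; exact: bounded.
elim: n => [|n [IH1 IH2]].
  split=> k x t kxt; first by rewrite subrr normr0 expr0 divr1 subrr mulr0 mul0r.
  rewrite expr0 divr1; apply: le_trans (w0_start kxt) _.
  rewrite /d0 mulrAC ler_pdivlMr ?expR_gt0 // ler_wpM2l //.
  exact: weight_min kxt.
have half : d0 / 2 ^+ n.+1 = d0 / 2 ^+ n / 2.
  by rewrite exprS; field; rewrite expf_neq0.
have IH1' k x t : in_rect k x t ->
    `|W n.+1 k x t - w0 k x t| <= 2 * d0 * (1 - 1 / 2 ^+ n.+1) * weight x t.
  move=> kxt.
  have -> : W n.+1 k x t - w0 k x t =
    (W n.+1 k x t - W n k x t) + (W n k x t - w0 k x t) by ring.
  have -> : 2 * d0 * (1 - 1 / 2 ^+ n.+1) * weight x t =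
    d0 / 2 ^+ n * weight x t + 2 * d0 * (1 - 1 / 2 ^+ n) * weight x t.
    by rewrite exprS; field; rewrite expf_neq0.
  by rewrite (le_trans (ler_normD _ _)) // lerD // ?IH1 ?IH2.
have le2 m k x t : in_rect k x t ->
    2 * d0 * (1 - 1 / 2 ^+ m) * weight x t <= 2 * d0 * weight x t.
  by move=> kxt; rewrite ler_wpM2r // (ler_piMr d20) // gerBl divr_ge0 // exprn_ge0.
split=> // k x t kxt; rewrite half.
apply: picard_contraction => //.
- by move=> l; exact: (iter_buc n.+1).
- by move=> l; exact: (iter_buc n).
- by rewrite divr_ge0 // exprn_ge0.
- by apply: bounded => l y s kys; apply: le_trans (IH1' _ _ _ kys) (le2 _ _ _ _ kys).
- by apply: bounded => l y s kys; apply: le_trans (IH1 _ _ _ kys) (le2 _ _ _ _ kys).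
- move=> l; have lL : 0 <= L l <= L l by rewrite lexx ltW.
  exact: etrans (iter_init n.+1 lL) (esym (iter_init n lL)).
Qed.

Lemma picard_fixpoint : exists w,
  [/\ forall k, buc (w k), forall k x, 0 <= x <= L k -> w k x 0 = r1 k x,
    forall k x t, in_rect k x t -> picard w k x t = w k x t &
    forall k x t, in_rect k x t -> `|w k x t| <= e1 + 2 * d0 * emax].
Proof.
pose A := d0 * emax.
have d00 := d0_ge0.
have A0 : 0 <= A := mulr_ge0 d00 (expR_ge0 _).
have A20 : 0 <= 2 * A := mulr_ge0 (ler0n R 2) A0.
have emin0 : 0 < emin := expR_gt0 _.
have step k x t n : `|W n.+1 k x t - W n k x t| <= A / 2 ^+ n.
  rewrite iter_clamp (iter_clamp n) /A mulrAC.
  have [_ _ h] := iter_estimate n; have kxt := clamp_in_rect k x t.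
  apply: le_trans (h _ _ _ kxt) _; rewrite ler_wpM2l //; first by apply: divr_ge0; rewrite ?exprn_ge0.
  exact: weight_max kxt.
pose w k x t := sval (geometric_limit (step k x t)).
have wP k x t n : `|W n k x t - w k x t| <= 2 * A / 2 ^+ n.
  by rewrite /w; case: (geometric_limit _).
have small_all (z B : R) : (forall n, `|z| <= B / 2 ^+ n) -> z = 0.
  move=> zB; apply/eqP; rewrite -normr_le0; apply/ler_addgt0Pl => e ep.
  by have [n Bn] := half_pow_small B ep; rewrite addr0 (le_trans (zB n)).
have bw k : buc (w k).
  split; last first.
    apply: (@ucont2_lim _ (fun n => W n k)) => [n|e ep]; first by have [] := iter_buc n k.
    have [n An] := half_pow_small (2 * A) ep; exists n => x t.
    exact: le_trans (wP _ _ _ _) An.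
  have [[B WB] _] := iter_buc 0 k; exists (B + 2 * A) => x t.
  have := wP k x t 0%N; have := WB x t; rewrite expr0 divr1 !ler_norml; lra.
have wbound k x t : in_rect k x t -> `|w k x t| <= e1 + 2 * d0 * emax.
  move=> kxt; have := wP k x t 0%N; rewrite expr0 divr1 /A /W /=.
  have : `|w0 k x t| <= e1 by apply: w0_bound; apply: clamp_itv; exact: ltW.
  rewrite !ler_norml; lra.
have winit k x : 0 <= x <= L k -> w k x 0 = r1 k x.
  move=> xL; apply/eqP; rewrite -subr_eq0; apply/eqP/(small_all _ (2 * A)) => n.
  by rewrite -(iter_init n xL) distrC.
exists w; split=> // k x t kxt; apply/eqP; rewrite -subr_eq0; apply/eqP.
(* Two errors of order [1 / 2 ^+ n]: the contraction applied to the limit and [W n], whose weighted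
   distance is at most [2 * A / 2 ^+ n / emin], and the distance from [W n.+1] to the limit. *)
apply: (small_all _ (A / emin * emax + A)) => n.
have -> : picard w k x t - w k x t =
  (picard w k x t - W n.+1 k x t) + (W n.+1 k x t - w k x t) by ring.
have -> : (A / emin * emax + A) / 2 ^+ n =
   (2 * A / 2 ^+ n / emin) / 2 * emax + 2 * A / 2 ^+ n.+1.
  by rewrite exprS; field; rewrite expf_neq0 // lt0r_neq0.
apply: le_trans (ler_normD _ _) _; apply: lerD; last exact: wP.
have D0 : 0 <= 2 * A / 2 ^+ n / emin.
  by apply: divr_ge0; [apply: divr_ge0; rewrite ?exprn_ge0|exact: ltW].
apply: (@le_trans _ _ (2 * A / 2 ^+ n / emin / 2 * weight x t)).
  apply: picard_contraction kxt => //.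
  - by move=> l; exact: (iter_buc n).
  - by move=> l y s kys; apply: le_trans (wbound _ _ _ kys) small.
  - by have [] := iter_estimate n.
  - move=> l; have lL : 0 <= L l <= L l by rewrite lexx ltW.
    exact: etrans (winit _ _ lL) (esym (iter_init n lL)).
  - move=> l y s kys; rewrite distrC; apply: le_trans (wP _ _ _ n) _.
    rewrite [leRHS]mulrAC ler_pdivlMr // ler_wpM2l //.
      by apply: divr_ge0; rewrite ?exprn_ge0.
    exact: weight_min kys.
by apply: ler_wpM2l; [exact: divr_ge0|exact: weight_max kxt].
Qed.

End Contraction.

End Picard.

(** * Differentiability of the time primitive of the fixed point *)

Section Regularity.
Variables (R : realType) (K : finType) (L : K -> R) (T : R).
Variables (kap : K -> K -> R) (th : K -> K -> R -> R).
Variables (a : K -> K -> R -> R) (c : K -> K -> K -> R -> R).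
Hypothesis L0 : forall k, 0 < L k.
Hypothesis T0 : 0 < T.
Hypothesis th_itv : forall k l x, 0 <= th k l x <= L l.
Hypothesis th_uc : forall k l, ucont2 (fun x _ => th k l x).
Hypothesis a_buc : forall k l, buc (fun x _ => a k l x).
Hypothesis c_buc : forall k l m, buc (fun x _ => c k l m x).
Variables r0 dr0 Q dQ : K -> R -> R.
Hypothesis r0_buc : forall k, buc (fun x _ => r0 k x).
Hypothesis dr0_buc : forall k, buc (fun x _ => dr0 k x).
Hypothesis dQ_buc : forall k, buc (fun t _ => dQ k t).
Hypothesis dr0P : forall k x y, 0 <= x <= L k -> 0 <= y <= L k ->
  r0 k y - r0 k x = integ (dr0 k) x y.
Hypothesis dQP : forall k t, 0 <= t <= T -> Q k t = Q k 0 + integ (dQ k) 0 t.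
Hypothesis r0_entry : forall k, r0 k 0 = \sum_l kap k l * r0 l (L l) + Q k 0.

Local Notation r1 := (r1 th a c r0 dr0).
Local Notation tint := (tint T r0).
Local Notation rhs := (rhs T th a c r0).
Local Notation picard := (picard L T kap th a c r0 dr0 dQ).

Variable w : K -> R -> R -> R.
Hypothesis w_buc : forall k, buc (w k).
Hypothesis w_init : forall k x, 0 <= x <= L k -> w k x 0 = r1 k x.
Hypothesis w_fix : forall k x t, in_rect L T k x t -> picard w k x t = w k x t.

Implicit Types (s t x y d : R).

Let w_cont k x : continuous (w k x).
Proof. exact: ucont2_slice (w_buc k).2. Qed.

Let rhs_ok k : buc (rhs w k).
Proof. exact: rhs_buc. Qed.

Let rhs_cont k x : continuous (rhs w k x).
Proof. exact: ucont2_slice (rhs_ok k).2. Qed.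

Let dr0_cont k : continuous (dr0 k).
Proof. exact: (@ucont2_slice _ (fun _ x => dr0 k x) 0 (ucont2_swap (dr0_buc k).2)). Qed.

Let dQ_cont k : continuous (dQ k).
Proof. exact: (@ucont2_slice _ (fun _ x => dQ k x) 0 (ucont2_swap (dQ_buc k).2)). Qed.

Lemma tintE k x t : 0 <= t <= T -> tint w k x t = r0 k x + integ (w k x) 0 t.
Proof. by move=> tT; rewrite /tint clamp_id. Qed.

Lemma tint0 k x : tint w k x 0 = r0 k x.
Proof. by rewrite tintE ?lexx ?ltW // /integ subrr addr0. Qed.

Lemma tint_dt k x t : 0 <= t <= T -> deriv_in 0 T (tint w k x) t (w k x t).
Proof.
move=> tT; apply: (@deriv_in_eq _ _ _ (fun s => r0 k x - primitive (w k x) 0 + primitive (w k x) s)) => //.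
  by move=> s sT; rewrite tintE // /integ; ring.
rewrite -[w k x t]add0r; apply: deriv_inD; first exact: deriv_in_cst.
by apply: is_derive_deriv_in; exact: is_derive_primitive.
Qed.

(** Two points on one characteristic share [t - x], hence the entry and initial terms of [picard];
    only the integral between them remains. *)
Lemma characteristic_step k x x' t : 0 <= x -> x <= x' -> x' <= L k -> 0 <= t ->
  t + (x' - x) <= T ->
  w k x' (t + (x' - x)) - w k x t = integ (fun y => rhs w k y (t - x + y)) x x'.
Proof.
move=> x0 xx' x'L t0 tT.
have h1 : in_rect L T k x' (t + (x' - x)) by split; lra.
have h2 : in_rect L T k x t by split; lra.
rewrite -(w_fix h1) -(w_fix h2) /picard.
have [? ?] := h1; have [? ?] := h2; rewrite !clamp_id //.
have -> : t + (x' - x) - x' = t - x by ring.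
have -> : x' - (t + (x' - x)) = x - t by ring.
set u := Num.max 0 (x - t).
by rewrite -(integ_cat _ u x x'); ring.
Qed.

Lemma w_entry k t : 0 <= t <= T -> w k 0 t = \sum_l kap k l * w l (L l) t + dQ k t.
Proof.
move=> tT; have h : in_rect L T k 0 t by split=> //; rewrite lexx ltW.
rewrite -(w_fix h) /picard; have [? ?] := h; rewrite !clamp_id // subr0 sub0r.
have t0 : 0 <= t by case/andP: tT.
by rewrite (max_r t0) max_l ?oppr_le0 // /integ; ring.
Qed.

(** [w_entry] integrated in time, with the zero-order compatibility [r0_entry] as initial value. *)
Lemma tint_entry k t : 0 <= t <= T ->
  tint w k 0 t = \sum_l kap k l * tint w l (L l) t + Q k t.
Proof.
move=> tT; have t0 : 0 <= t by case/andP: tT.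
have cl l : continuous (fun s => kap k l * w l (L l) s).
  by move=> s; apply: cvgZr; exact: w_cont.
have cS : continuous (fun s => \sum_l kap k l * w l (L l) s).
  by move=> s; apply: cvg_big => [|l _]; [exact: add_continuous|exact: cl].
have E : integ (w k 0) 0 t =
    \sum_l kap k l * integ (w l (L l)) 0 t + 1 * integ (dQ k) 0 t.
  transitivity (integ (fun s => \sum_l kap k l * w l (L l) s + 1 * dQ k s) 0 t).
    apply: eq_integ => // [s|s st].
      by apply: cvgD; [exact: cS|apply: cvgZr; exact: dQ_cont].
    by rewrite w_entry ?mul1r //; lra.
  rewrite integ_lin // integ_sum //; congr (_ + _); apply: eq_bigr => l _.
  by rewrite integZ.
rewrite tintE // E r0_entry (dQP k tT) mul1r.
under [in RHS]eq_bigr do rewrite tintE // mulrDr.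
by rewrite big_split /=; ring.
Qed.

Lemma source_tint k x t : 0 <= t <= T ->
  source a c k x (fun l => tint w l (th k l x) t) =
  source a c k x (fun l => r0 l (th k l x)) + integ (rhs w k x) 0 t.
Proof.
move=> tT; pose f s := source a c k x (fun l => tint w l (th k l x) s).
pose df s := dsource a c k x (fun l => tint w l (th k l x) s) (fun l => w l (th k l x) s).
have dfE s : 0 <= s <= T -> deriv_in 0 T f s (df s).
  move=> sT; apply: (@source_deriv_in _ _ a c k x (fun l => tint w l (th k l x))
      (fun l => w l (th k l x))) => l.
    exact: tint_dt.
have dfr s : 0 < s < T -> df s = rhs w k x s.
  move=> sT; rewrite /df /rhs clamp_id //; lra.
have T00 : 0 <= (0 : R) <= T by rewrite lexx ltW.
rewrite -(deriv_in_integ (rhs_cont (x := x)) dfE dfr T00 tT).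
have -> : f 0 = source a c k x (fun l => r0 l (th k l x)).
  by rewrite /f; congr source; apply/funext => l; rewrite tint0.
by rewrite addrC subrK.
Qed.

(** The value that the equation forces on the space derivative. The equation thus becomes an
    identity, and what remains to be proved is that [tint w] has this derivative in [x]. *)
Definition tint_dx k x t : R :=
  source a c k x (fun l => tint w l (th k l x) t) - w k x t.

Lemma tint_dx_buc k : buc (tint_dx k).
Proof.
apply: bucB => //.
apply: (source_buc (u := fun k l x t => tint w l (th k l x) t) (k := k) a_buc c_buc) => l.
apply: (buc_comp (tint_buc T0 r0_buc l w_buc)); last exact: ucont2_snd.
exact: (ucont2_comp (th_uc k l) (@ucont2_fst _) (@ucont2_snd _)).
Qed.

(** [w] need not be differentiable in [x], so one cannot differentiate under the integral. With
    [tau = x' - x], the value [w x' s] is compared with [w x (s - tau)] on the same characteristic: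
    the difference is about [tau * rhs] and integrates to [tau] times the increment of the source
    over [[0, t]]. The unmatched pieces, [[0, tau]] for [x'] and [[t - tau, t]] for [x], contribute
    [tau * (w x 0 - w x t)]. With [w x 0 = r1] and the increment of [r0], everything adds up to
    [tau * tint_dx]. The estimate is one-sided but uniform in [x]. *)
Lemma tint_dx_estimate k t e : 0 < t <= T -> 0 < e ->
  exists2 d, 0 < d & forall x x', 0 <= x -> x <= x' -> x' <= L k -> x' - x < d ->
    `|tint w k x' t - tint w k x t - tint_dx k x t * (x' - x)| <= e * (x' - x).
Proof.
(* Of the errors [A1] to [A5] below, [A4] contributes at most [e1 * tau * T] and the four others
   [e1 * tau] each, hence the divisor [4 + T]. *)
move=> /andP[t0 tT] e0; pose e1 := e / (4 + T).
have T4 : 0 < 4 + T by have := T0; lra.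
have e10 : 0 < e1 by rewrite divr_gt0.
have [d1 d10 dr0d] := (dr0_buc k).2 _ e10.
have [d2 d20 wd] := (w_buc k).2 _ e10.
have [d3 d30 rhsd] := (rhs_ok k).2 _ e10.
have [B B0 rhsB] := bounded2_ge0 (rhs_ok k).1.
(* [tau < t] leaves room for the shifted interval, and [tau < e1 / B] makes the integral of [rhs]
   over the missing [[0, tau]] negligible. *)
exists (Num.min (Num.min d1 d2) (Num.min d3 (Num.min t (e1 / B)))).
  by rewrite !lt_min d10 d20 d30 t0 divr_gt0.
move=> x x' x0 xx' x'L; rewrite !lt_min => /andP[/andP[xd1 xd2] /and3P[xd3 xt xB]].
set tau := x' - x in xd1 xd2 xd3 xt xB *.
have tau0 : 0 <= tau by rewrite subr_ge0.
have xL : 0 <= x <= L k by lra.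
have x'L' : 0 <= x' <= L k by lra.
have tI : 0 <= t <= T by lra.
have A1 : `|r0 k x' - r0 k x - dr0 k x * tau| <= e1 * tau.
  rewrite dr0P //; apply: integ_near_cst => // y xy; apply/ltW/(dr0d _ _ 0 0).
    by rewrite ger0_norm; move: xd1; rewrite /tau; lra.
  by rewrite subrr normr0.
have A2 : `|integ (w k x') 0 tau - w k x 0 * (tau - 0)| <= e1 * (tau - 0).
  apply: integ_near_cst => // s s0; apply/ltW/wd.
    by rewrite ger0_norm.
  by rewrite subr0 ger0_norm; lra.
have A3 : `|integ (w k x) (t - tau) t - w k x t * (t - (t - tau))| <= e1 * (t - (t - tau)).
  apply: integ_near_cst => // [|s s0]; first lra.
  apply/ltW/wd; first by rewrite subrr normr0.
  by rewrite distrC ger0_norm; lra.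
have cs : continuous (fun s => w k x (s + (- tau))).
  move=> s; apply: continuous_comp; last exact: w_cont.
  by apply: cvgD; [exact: cvg_id|exact: cvg_cst].
have A4 : `|integ (fun s => (w k x' s - w k x (s + (- tau))) - tau * rhs w k x s) tau t|
    <= e1 * tau * `|t - tau|.
  apply: integ_bound => [s|s].
    apply: cvgB; last by apply: cvgZr; exact: rhs_cont.
    by apply: cvgB; [exact: w_cont|exact: cs].
  rewrite (min_l (ltW xt)) (max_r (ltW xt)) => /andP[taus st].
  have st0 : 0 <= s - tau by rewrite subr_ge0 ltW.
  have sT : s - tau + (x' - x) <= T by rewrite -/tau; lra.
  have := characteristic_step x0 xx' x'L st0 sT; rewrite -/tau subrK => ->.
  rewrite [tau * _]mulrC; apply: integ_near_cst => //.
    exact: (ucont2_slice (x := s - tau - x) (rhs_char_buc T0 th_uc a_buc c_buc r0_buc k w_buc).2).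
  move=> y xy; apply/ltW/rhsd; first by rewrite ger0_norm; move: xd3; rewrite /tau; lra.
  by rewrite ler0_norm; move: xd3; rewrite /tau; lra.
have A5 : `|integ (rhs w k x) 0 tau| <= e1.
  apply: (@le_trans _ _ (B * `|tau - 0|)); first exact: integ_bound.
  by rewrite subr0 ger0_norm // -ler_pdivlMl // mulrC ltW.
have -> : tint w k x' t - tint w k x t - tint_dx k x t * tau =
  (r0 k x' - r0 k x - dr0 k x * tau) + (integ (w k x') 0 tau - w k x 0 * (tau - 0))
  - (integ (w k x) (t - tau) t - w k x t * (t - (t - tau)))
  + integ (fun s => (w k x' s - w k x (s + (- tau))) - tau * rhs w k x s) tau t
  - tau * integ (rhs w k x) 0 tau.
  rewrite integB ?integB ?integZ //; first last.
  - by move=> s; apply: cvgZr; exact: rhs_cont.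
  - by move=> s; apply: cvgB; [exact: w_cont|exact: cs].
  rewrite integ_shift // subrr /tint_dx source_tint // w_init // /r1 !tintE //.
  rewrite -(integ_cat (w k x') 0 tau t) -(integ_cat (w k x) 0 (t - tau) t).
  rewrite -(integ_cat (rhs w k x) 0 tau t).
  ring.
have ttau : e1 * tau * `|t - tau| <= e1 * tau * T.
  apply: ler_wpM2l; first by rewrite mulr_ge0 // ltW.
  by rewrite ger0_norm; lra.
have A5' : `|tau * integ (rhs w k x) 0 tau| <= tau * e1.
  by rewrite normrM ger0_norm // ler_wpM2l.
have -> : e * tau = e1 * tau + e1 * tau + e1 * tau + e1 * tau * T + tau * e1.
  by rewrite /e1; field; rewrite lt0r_neq0.
have ttE : t - (t - tau) = tau by ring.
rewrite subr0 in A2; rewrite ttE in A3; rewrite subr0 ttE.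
apply: le_trans (ler_normB _ _) _; apply: lerD => //.
apply: le_trans (ler_normD _ _) _; apply: lerD; last exact: le_trans A4 ttau.
apply: le_trans (ler_normB _ _) _; apply: lerD => //.
by apply: le_trans (ler_normD _ _) _; apply: lerD.
Qed.

Lemma tint_dx_deriv k x t : 0 <= x <= L k -> 0 <= t <= T ->
  deriv_in 0 (L k) (fun x => tint w k x t) x (tint_dx k x t).
Proof.
(* At [t = 0] there is no earlier time to compare with, but [tint w] is then [r0], whose derivative
   is known. *)
move=> xL /andP[]; rewrite le_eqVlt => /predU1P[<- _|t0 tT].
  apply: (@deriv_in_eq _ _ _ (fun y => r0 k 0 - primitive (dr0 k) 0 + primitive (dr0 k) y)) => //.
    move=> y yL; rewrite tint0 -[RHS](subrK (r0 k 0)) (dr0P _ yL) ?lexx ?ltW //.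
    by rewrite /integ; ring.
  have -> : tint_dx k x 0 = 0 + dr0 k x.
    rewrite /tint_dx w_init // /r1 add0r.
    have -> : (fun l => tint w l (th k l x) 0) = (fun l => r0 l (th k l x)).
      by apply/funext => l; rewrite tint0.
    by rewrite opprB addrCA subrr addr0.
  apply: deriv_inD; first exact: deriv_in_cst.
  by apply: is_derive_deriv_in; exact: is_derive_primitive.
apply/deriv_inP => e e0; have e2 : 0 < e / 2 by rewrite divr_gt0.
have ht : 0 < t <= T by rewrite t0.
have [d d0 hd] := tint_dx_estimate k ht e2.
have [d' d'0 hd'] := (tint_dx_buc k).2 _ e2.
exists (Num.min d d') => [|z zL]; first by rewrite lt_min d0.
rewrite lt_min => /andP[zd zd'].
have [x0 xL'] := andP xL; have [z0 zL'] := andP zL.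
case/orP: (le_total x z) => xz.
  rewrite ger0_norm ?subr_ge0 // in zd *.
  apply: le_trans (hd x z x0 xz zL' zd) _; rewrite ler_wpM2r ?subr_ge0 //.
  by lra.
(* For [z <= x] the one-sided estimate starts from [z]; the uniform continuity of [tint_dx] then
   replaces the derivative at [z] by the one at [x], at the cost of the other half of [e]. *)
rewrite distrC ger0_norm ?subr_ge0 // in zd.
have h1 := hd z x z0 xz xL' zd.
have h2 : `|tint_dx k z t - tint_dx k x t| <= e / 2.
  by apply/ltW/hd' => //; rewrite subrr normr0.
rewrite (distrC z x) [`|x - z|]ger0_norm ?subr_ge0 //.
have -> : tint w k z t - tint w k x t - tint_dx k x t * (z - x) =
  - (tint w k x t - tint w k z t - tint_dx k z t * (x - z)) -
  (tint_dx k z t - tint_dx k x t) * (x - z) by ring.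
have -> : e * (x - z) = e / 2 * (x - z) + e / 2 * (x - z) by field.
rewrite (le_trans (ler_normB _ _)) // normrN lerD //.
by rewrite normrM [`|x - z|]ger0_norm ?subr_ge0 // ler_wpM2r // subr_ge0.
Qed.

End Regularity.

(** * Existence for small data, with bounds linear in the data *)

Section Existence.
Variables (R : realType) (K : finType) (L : K -> R) (T : R).
Variables (kap : K -> K -> R) (th : K -> K -> R -> R).
Variables (a : K -> K -> R -> R) (c : K -> K -> K -> R -> R).
Hypothesis L0 : forall k, 0 < L k.
Hypothesis T0 : 0 < T.
Hypothesis th_itv : forall k l x, 0 <= th k l x <= L l.
Hypothesis th_uc : forall k l, ucont2 (fun x _ => th k l x).
Hypothesis a_buc : forall k l, buc (fun x _ => a k l x).
Hypothesis c_buc : forall k l m, buc (fun x _ => c k l m x).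

Lemma source_coef_bound : exists2 M : R, 0 < M & forall k x,
  \sum_l `|a k l x| <= M /\ \sum_(p : K * K) `|c k p.1 p.2 x| <= M.
Proof.
have [A A0 aA] := buc_fin_bound (fun p : K * K => a_buc p.1 p.2).
have [C C0 cC] := buc_fin_bound (fun p : K * (K * K) => c_buc p.1 p.2.1 p.2.2).
exists (1 + (A *+ #|K| + C *+ #|{: K * K}|)).
  by rewrite ltr_pwDl // addr_ge0 // mulrn_wge0 // ltW.
move=> k x; split.
  apply: (@le_trans _ _ (A *+ #|K|)).
    by rewrite -sumr_const; apply: ler_sum => l _; exact: (aA (k, l) x 0).
  by rewrite addrCA lerDl addr_ge0 // mulrn_wge0 // ltW.
apply: (@le_trans _ _ (C *+ #|{: K * K}|)).
  by rewrite -sumr_const; apply: ler_sum => p _; exact: (cC (k, p) x 0).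
by rewrite addrA lerDr addr_ge0 // mulrn_wge0 // ltW.
Qed.

(** For [d <= 1] the source is at most [3 * M * d] and [dr0] adds [d], whence [e1]. In the bound on
    the first step [S * e1] stands for the reflected terms, [d] for [dQ], [3 * e1] for two values of
    [r1] and one of [w0], and the rest for the integral. *)
Lemma picard_start_bound (M S Lmax d : R) (r0 dr0 dQ : K -> R -> R) :
  (forall k x, \sum_l `|a k l x| <= M) ->
  (forall k x, \sum_(p : K * K) `|c k p.1 p.2 x| <= M) ->
  (forall k, \sum_l `|kap k l| <= S) -> (forall k, L k <= Lmax) -> 
  0 <= M -> 0 <= Lmax -> 0 <= d <= 1 -> (3 * M + 1) * d <= 1 ->
  (forall k, buc (fun x _ => r0 k x)) -> (forall k, buc (fun x _ => dr0 k x)) ->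
  (forall k x, `|r0 k x| <= d) -> (forall k x, `|dr0 k x| <= d) ->
  (forall k t, `|dQ k t| <= d) ->
  let e1 := (3 * M + 1) * d in
  let w0 k x t := r1 th a c r0 dr0 k (clamp 0 (L k) x) in
  (forall k x, `|r1 th a c r0 dr0 k x| <= e1) /\
  forall k x t, in_rect L T k x t ->
    `|picard L T kap th a c r0 dr0 dQ w0 k x t - w0 k x t| <=
    S * e1 + d + 3 * e1 + M * (1 + 2 * (2 + T)) * e1 * Lmax.
Proof.
move=> aM cM kapS LM M0 Lmax0 /andP[d0 d1] de1 r0b dr0b r0d dr0d dQd e1 w0.
have e10 : 0 <= e1 by rewrite mulr_ge0 //; lra.
have r1e k x : `|r1 th a c r0 dr0 k x| <= e1.
  apply: le_trans (ler_normB _ _) _.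
  have h1 := source_bound aM cM k x d0 (fun l => r0d l (th k l x)).
  have h2 := dr0d k x.
  have : M * (1 + 2 * d) * d <= M * 3 * d.
    by rewrite ler_wpM2r // ler_wpM2l //; lra.
  rewrite /e1; lra.
split=> // k x t kxt; have [xL tT] := kxt.
have bw0 l : buc (w0 l).
  exact: (buc_comp (r1_buc th_uc a_buc c_buc r0b dr0b l) (ucont2_clamp _ _ (@ucont2_fst _)) (@ucont2_cst _ 0)).
have w0e l y s : `|w0 l y s| <= e1 by exact: r1e.
have r0le1 l y : `|r0 l y| <= 1 by exact: le_trans (r0d l y) d1.
have w01 : bounded1 L T w0 by move=> l y s _; exact: le_trans (w0e _ _ _) de1.
have rhse y s : 0 <= s <= T -> `|rhs T th a c r0 w0 k y s| <= M * (1 + 2 * (2 + T)) * e1.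
  move=> sT; apply: (dsource_bound aM cM) => // [|l]; first by have := T0; lra.
  by apply: (tint_bound (L := L)) => //; split.
rewrite /picard (clamp_id xL) (clamp_id tT).
set s := Num.max 0 (t - x); set y0 := Num.max 0 (x - t).
set I := integ _ y0 x.
have y0x : y0 <= x by rewrite /y0 ge_max; move: xL tT; lra.
have y00 : 0 <= y0 by rewrite /y0 le_max lexx.
have IB : `|I| <= M * (1 + 2 * (2 + T)) * e1 * Lmax.
  apply: (@le_trans _ _ (M * (1 + 2 * (2 + T)) * e1 * `|x - y0|)).
    apply: integ_bound.
      exact: (ucont2_slice (x := t - x) (rhs_char_buc T0 th_uc a_buc c_buc r0b k bw0).2).
    rewrite (min_l y0x) (max_r y0x) => y /andP[y0y yx]; apply: rhse.
    by move: y0y; rewrite /y0 gt_max => /andP[? ?]; move: xL tT; lra.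
  apply: ler_wpM2l; first by rewrite !mulr_ge0 //; have := T0; lra.
  by rewrite ger0_norm ?subr_ge0 //; have := LM k; move: xL; lra.
have SB : `|\sum_l kap k l * w0 l (L l) s| <= S * e1.
  have h : forall l, `|w0 l (L l) s| <= e1 by move=> l; exact: w0e.
  by apply: le_trans (sum_coef_le _ h) _; rewrite ler_wpM2r.
have h1 := r1e k y0; have h2 := r1e k 0; have h3 := w0e k x t; have h4 := dQd k s.
move: IB SB h1 h2 h3 h4; rewrite !ler_norml; clear.
set u1 := I; set u2 := \sum_l _; set u3 := r1 _ _ _ _ _ _ y0.
set u4 := r1 _ _ _ _ _ _ 0; set u5 := dQ k s; set u6 := w0 k x t.
set B1 := _ * Lmax; set B2 := S * e1; lra.
Qed.

Theorem transport_exists : exists2 delta : R, 0 < delta & exists2 C : R, 0 < C &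
  forall (d : R) (r0 dr0 Q dQ : K -> R -> R), 0 <= d <= delta ->
  (forall k, buc (fun x _ => r0 k x)) -> (forall k, buc (fun x _ => dr0 k x)) ->
  (forall k, buc (fun t _ => dQ k t)) ->
  (forall k x y, 0 <= x <= L k -> 0 <= y <= L k -> r0 k y - r0 k x = integ (dr0 k) x y) ->
  (forall k t, 0 <= t <= T -> Q k t = Q k 0 + integ (dQ k) 0 t) ->
  (forall k x, `|r0 k x| <= d) -> (forall k x, `|dr0 k x| <= d) ->
  (forall k t, `|dQ k t| <= d) ->
  (forall k, r0 k 0 = \sum_l kap k l * r0 l (L l) + Q k 0) ->
  (forall k, r1 th a c r0 dr0 k 0 = \sum_l kap k l * r1 th a c r0 dr0 l (L l) + dQ k 0) ->
  exists r w g : K -> R -> R -> R,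
  [/\ forall k, [/\ buc (r k), buc (w k) & buc (g k)],
    forall k x t, in_rect L T k x t ->
     [/\ deriv_in 0 T (r k x) t (w k x t),
         deriv_in 0 (L k) (fun y => r k y t) x (g k x t) &
         w k x t + g k x t = source a c k x (fun l => r l (th k l x) t)],
    forall k x, r k x 0 = r0 k x,
    forall k t, 0 <= t <= T -> r k 0 t = \sum_l kap k l * r l (L l) t + Q k t &
    forall k x t, in_rect L T k x t ->
      [/\ `|r k x t| <= C * d, `|w k x t| <= C * d & `|g k x t| <= C * d]].
Proof.
have [M M0 MP] := source_coef_bound.
have aM k x := (MP k x).1; have cM k x := (MP k x).2.
have [S S0 kapS] := fin_bound (fun k => \sum_l `|kap k l|).
have [Lmax Lmax0 LM] := fin_bound L.
have C0 : 0 <= M * (1 + 4 * (2 + T)) by rewrite mulr_ge0 ?ltW //; have := T0; lra.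
have [mu [kp [mu0 kp1 mukp S4 C4]]] := exp_weights L0 (ltW S0) C0.
pose emin := expR (- (mu * Lmax)); pose emax := expR (kp * T).
have emin0 : 0 < emin := expR_gt0 _; have emax0 : 0 < emax := expR_gt0 _.
pose C1 := 3 * M + 1.
pose C2 := S * C1 + 1 + 3 * C1 + M * (1 + 2 * (2 + T)) * C1 * Lmax.
have T20 : 0 < 1 + 2 * (2 + T) by have := T0; lra.
have C10 : 0 < C1 by rewrite /C1; lra.
have C20 : 0 < C2.
  have : 0 < M * (1 + 2 * (2 + T)) * C1 * Lmax by rewrite !mulr_gt0.
  have : 0 < S * C1 by rewrite mulr_gt0.
  rewrite /C2; lra.
(* [Cw * d] is the bound [e1 + 2 * d0 * emax] of [picard_fixpoint] for [e1 = C1 * d] and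
   [e2 = C2 * d], so [d <= 1 / Cw] is the smallness condition of the iteration. [Cr] comes from
   integrating [w] in time, and [C] also covers [g], read off the equation. *)
pose Cw := C1 + 2 * (C2 / emin) * emax.
have Cw0 : 0 < Cw by rewrite ltr_wpDl ?ltW // !mulr_gt0 // invr_gt0.
pose Cr := 1 + T * Cw.
have Cr0 : 0 < Cr by rewrite ltr_wpDr // ltW // mulr_gt0.
pose C := Cr + Cw + M * (1 + 2 * Cr) * Cr.
have MC0 : 0 < M * (1 + 2 * Cr) * Cr by rewrite !mulr_gt0 //; lra.
exists (Num.min 1 Cw^-1); first by rewrite lt_min ltr01 invr_gt0.
exists C; first by rewrite /C; lra.
move=> d r0 dr0 Q dQ /andP[d0]; rewrite le_min => /andP[d1 dCw].
move=> r0b dr0b dQb dr0P dQP r0d dr0d dQd r0e r1e.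
have Cwd : Cw * d <= 1 by rewrite -ler_pdivlMl // mulr1.
have C1d : C1 * d <= 1.
  apply: le_trans Cwd; rewrite ler_wpM2r // /Cw lerDl ltW //.
  by rewrite !mulr_gt0 // invr_gt0.
have d01 : 0 <= d <= 1 by rewrite d0.
have [r1le start] := @picard_start_bound M S Lmax d r0 dr0 dQ aM cM kapS LM
  (ltW M0) (ltW Lmax0) d01 C1d r0b dr0b r0d dr0d dQd.
have r0le1 k x : `|r0 k x| <= 1 by exact: le_trans (r0d k x) d1.
have E2 : S * (C1 * d) + d + 3 * (C1 * d) + M * (1 + 2 * (2 + T)) * (C1 * d) * Lmax =
   C2 * d by rewrite /C2; ring.
have C2d : 0 <= C2 * d by rewrite mulr_ge0 // ltW.
have start' k x t : in_rect L T k x t -> `|picard L T kap th a c r0 dr0 dQ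
    (fun k x _ => r1 th a c r0 dr0 k (clamp 0 (L k) x)) k x t -
     r1 th a c r0 dr0 k (clamp 0 (L k) x)| <= C2 * d.
  by move=> kxt; rewrite -E2; exact: start.
have small : C1 * d + 2 * (C2 * d / emin) * emax <= 1.
  by apply: le_trans Cwd; rewrite le_eqVlt; apply/orP; left; apply/eqP; rewrite /Cw; field; exact: lt0r_neq0.
have [w [bw winit wfix wb]] := picard_fixpoint L0 T0 th_itv th_uc a_buc c_buc r0b dr0b
  dQb r1e aM cM kapS S0 mu0 kp1 mukp S4 C4 r0le1 LM C2d (fun k x _ => r1le k x) start' small.
have wd k x t : in_rect L T k x t -> `|w k x t| <= Cw * d.
  move=> kxt; apply: le_trans (wb _ _ _ kxt) _.
  have -> : Cw * d = C1 * d + 2 * (C2 * d / emin) * emax.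
    by rewrite /Cw; field; exact: lt0r_neq0.
  exact: lexx.
have rd k x t : in_rect L T k x t -> `|tint T r0 w k x t| <= Cr * d.
  move=> [xL tT]; have [t0 tT'] := andP tT.
  rewrite tintE //; apply: le_trans (ler_normD _ _) _.
  have -> : Cr * d = d + Cw * d * T by rewrite /Cr; ring.
  apply: lerD => //; apply: (@le_trans _ _ (Cw * d * `|t - 0|)).
    apply: integ_bound; first exact: (ucont2_slice (bw k).2).
    rewrite (min_l t0) (max_r t0) => s st; apply: wd; split=> //; lra.
  rewrite subr0 ger0_norm // ler_wpM2l // mulr_ge0 //; lra.
exists (tint T r0 w), w, (tint_dx T th a c r0 w); split.
- move=> k; split=> //; first exact: tint_buc.
  exact: tint_dx_buc.
- move=> k x t [xL tT]; split.
  + exact: tint_dt.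
  + exact: (tint_dx_deriv L0 T0 th_uc a_buc c_buc r0b dr0b dr0P bw winit wfix).
  + by rewrite /tint_dx addrC subrK.
- by move=> k x; rewrite tint0.
- by move=> k t tT; exact: (tint_entry L0 dQb dQP r0e bw wfix).
move=> k x t kxt; have h1 := rd _ _ _ kxt; have h2 := wd _ _ _ kxt.
have Crd : 0 <= Cr * d by rewrite mulr_ge0 // ltW.
have h3 : `|tint_dx T th a c r0 w k x t| <= M * (1 + 2 * Cr) * Cr * d + Cw * d.
  apply: le_trans (ler_normB _ _) _; apply: lerD => //.
  have [xL tT] := kxt.
  have rl l : `|tint T r0 w l (th k l x) t| <= Cr * d by apply: rd; split.
  apply: le_trans (source_bound aM cM k x Crd rl) _.
  rewrite -mulrA -[leRHS]mulrA -[leRHS]mulrA (ler_wpM2l (ltW M0)) //.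
  rewrite ler_wpM2r // lerD2l ler_wpM2l // (ler_piMr (ltW Cr0)) //.
have g1 : 0 <= Cw * d by rewrite mulr_ge0 // ltW.
have g2 : 0 <= M * (1 + 2 * Cr) * Cr * d by rewrite mulr_ge0 // ltW.
have Cd : C * d = Cr * d + Cw * d + M * (1 + 2 * Cr) * Cr * d by rewrite /C; ring.
by split; rewrite [leRHS]Cd; clear -h1 h2 h3 Crd g1 g2; lra.
Qed.

End Existence.

(** * Uniqueness of bounded solutions *)

Section Uniqueness.
Variables (R : realType) (K : finType) (L : K -> R) (T : R).
Variables (kap : K -> K -> R) (th : K -> K -> R -> R).
Variables (a : K -> K -> R -> R) (c : K -> K -> K -> R -> R).
Hypothesis L0 : forall k, 0 < L k.
Hypothesis T0 : 0 < T.
Hypothesis th_itv : forall k l x, 0 <= th k l x <= L l.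
Variable M : R.
Hypothesis aM : forall k x, \sum_l `|a k l x| <= M.
Hypothesis cM : forall k x, \sum_(p : K * K) `|c k p.1 p.2 x| <= M.
Implicit Types (s t x y d B : R).

(** Differentiability is asked for only along characteristic lines and in the interior, which is
    what the Riemann components of a solution in [C1_rect] provide directly. *)
Definition transport_solution (r0 Q : K -> R -> R) B (r : K -> R -> R -> R) :=
  [/\ forall k x t, in_rect L T k x t -> `|r k x t| <= B,
    forall k s u v, in_rect L T k u (s + u) -> in_rect L T k v (s + v) ->
      {within `[u, v], continuous (fun y => r k y (s + y))},
    forall k s y, 0 < y < L k -> 0 < s + y < T ->
      is_derive y 1 (fun y => r k y (s + y))
        (source a c k y (fun l => r l (th k l y) (s + y))),
    forall k x, 0 <= x <= L k -> r k x 0 = r0 k x &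
    forall k t, 0 <= t <= T -> r k 0 t = \sum_l kap k l * r l (L l) t + Q k t].

(** [exp_weights] is applied once [B] is known, with the Lipschitz constant of the source on the
    ball of radius [B]. Each pass through the equation halves the weighted bound on the difference,
    which starts at [2 * B / emin] and must therefore be 0. *)
Theorem transport_unique r0 Q B (r r' : K -> R -> R -> R) :
  transport_solution r0 Q B r -> transport_solution r0 Q B r' ->
  forall k x t, in_rect L T k x t -> r k x t = r' k x t.
Proof.
move=> [rB cr dr ri re] [r'B cr' dr' r'i r'e] k0 x0' t0' kxt0.
have M0 : 0 <= M by apply: le_trans (aM k0 0); rewrite sumr_ge0.
have B0 : 0 <= B by apply: le_trans (rB _ _ _ kxt0).
have [S S0 kapS] := fin_bound (fun k => \sum_l `|kap k l|).
have [Lmax Lmax0 LM] := fin_bound L.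
pose C := M * (1 + 2 * B).
have C0 : 0 <= C by rewrite mulr_ge0 //; lra.
have [mu [kp [mu0 kp1 mukp S4 C4]]] := exp_weights L0 (ltW S0) C0.
have kp0 := kp_gt0 kp1.
pose e k x t := r k x t - r' k x t.
pose emin := expR (- (mu * Lmax)).
have emin0 : 0 < emin := expR_gt0 _.
have weight_min k x t : in_rect L T k x t -> emin <= weight mu kp x t.
  move=> [/andP[x0 xL] /andP[t0 _]]; rewrite ler_expR.
  have : mu * x <= mu * Lmax by rewrite ler_pM2l // (le_trans xL).
  by have : 0 <= kp * t; [rewrite mulr_ge0 // ltW|lra].
have step d : 0 <= d ->
    (forall k x t, in_rect L T k x t -> `|e k x t| <= d * weight mu kp x t) ->
    forall k x t, in_rect L T k x t -> `|e k x t| <= d / 2 * weight mu kp x t.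
  move=> d0 ed k x t kxt; have [xL tT] := kxt.
  have [x0 t0] : 0 <= x /\ 0 <= t by case/andP: xL => ? ?; case/andP: tT.
  (* The characteristic through [(x, t)] starts at [(y0, s)]: on the initial line when [t <= x], at
     the entry end otherwise. *)
  set s := Num.max 0 (t - x); set y0 := Num.max 0 (x - t).
  have y0x : y0 <= x by rewrite /y0 ge_max x0 /=; lra.
  have y0E : t - x + y0 = s.
    rewrite /y0 /s; case/orP: (le_total t x) => tx.
      by rewrite max_r ?subr_ge0 // max_l ?subr_le0 //; ring.
    by rewrite max_l ?subr_le0 // max_r ?subr_ge0 // addr0.
  have xE : t - x + x = t by rewrite subrK.
  have y0R : in_rect L T k y0 (t - x + y0).
    rewrite y0E /y0 /s; split; rewrite le_max lexx ge_max /=; lra.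
  have xR : in_rect L T k x (t - x + x) by rewrite xE.
  have entry : `|e k y0 s| <= d * (1 / 4 * weight mu kp x t).
    have [tx|/ltW xt] := leP t x.
      have sE : s = 0 by rewrite /s max_l // subr_le0.
      have [y0L _] := y0R.
      rewrite sE /e ri // r'i // subrr normr0 !mulr_ge0 ?expR_ge0 //.
    have y0E' : y0 = 0 by rewrite /y0 max_l // subr_le0.
    have [_ sT] := y0R; rewrite y0E in sT.
    rewrite y0E' /e re // r'e // opprD addrACA subrr addr0 -sumrB.
    under eq_bigr do rewrite -mulrBr.
    apply: (entry_contraction (e := e) L0 kapS S0 mukp S4 d0 ed) => // l.
    by rewrite /e ri ?r'i ?subrr // lexx ltW.
  have growth : `|e k x (t - x + x) - e k y0 (t - x + y0)| <= d * (1 / 4 * weight mu kp x t).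
    apply: le_trans (growth_bound C0 mu0 kp1 C4 t y0 d0 xL).
    apply: (@mean_value_ineq _ (fun y => e k y (t - x + y)) (fun y =>
       source a c k y (fun l => r l (th k l y) (t - x + y)) -
       source a c k y (fun l => r' l (th k l y) (t - x + y)))
       ((C * d) \*: growth kp t x) (fun y => C * d * expR (kp * (t - x + y)))) => //.
    - move=> y /andP[y0y yx].
      have [h1 h2] : 0 < y < L k /\ 0 < t - x + y < T.
        by move: y0y; rewrite /y0 gt_max => /andP[? ?]; move: xL tT; split; lra.
      have := dr k (t - x) y h1 h2; have := dr' k (t - x) y h1 h2 => ? ?.
      exact: is_deriveB.
    - by move=> y _; exact: is_derive_growth.
    - by move=> y; apply: cvgB; [exact: cr|exact: cr'].
    - exact: is_derive_continuous (is_derive_growth _ kp1 _ _ _).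
    - move=> y /andP[y0y yx].
      have h : 0 <= t - x + y <= T.
        by move: y0y; rewrite /y0 gt_max => /andP[? ?]; move: xL tT; lra.
      have hr l : in_rect L T l (th k l y) (t - x + y) by split.
      rewrite -mulrA; apply: (source_lip aM cM) => // [|l|l|l].
      + by rewrite mulr_ge0 ?expR_ge0.
      + exact: rB.
      + exact: r'B.
      + apply: le_trans (ed _ _ _ (hr l)) _; rewrite ler_wpM2l //.
        by apply: weight_le => //; case/andP: (th_itv k l y).
  have -> : e k x t = e k y0 s + (e k x (t - x + x) - e k y0 (t - x + y0)).
    by rewrite xE y0E addrC subrK.
  have -> : d / 2 * weight mu kp x t =
    d * (1 / 4 * weight mu kp x t) + d * (1 / 4 * weight mu kp x t) by field.
  by apply: le_trans (ler_normD _ _) _; exact: lerD.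
pose d0 := 2 * B / emin.
have d00 : 0 <= d0 by apply: divr_ge0; [exact: mulr_ge0|exact: ltW].
have all n : forall k x t, in_rect L T k x t -> `|e k x t| <= d0 / 2 ^+ n * weight mu kp x t.
  elim: n => [|n IHn] k x t kxt.
    rewrite expr0 divr1 /d0 mulrAC ler_pdivlMr //.
    apply: (@le_trans _ _ (2 * B * emin)); last first.
      by rewrite ler_wpM2l ?mulr_ge0 //; exact: weight_min kxt.
    rewrite ler_pM2r // mulr_natl mulr2n; apply: le_trans (ler_normB _ _) _.
    by apply: lerD; [exact: rB|exact: r'B].
  have -> : d0 / 2 ^+ n.+1 = d0 / 2 ^+ n / 2.
    by rewrite exprS; field; rewrite expf_neq0 // lt0r_neq0.
  by apply: step => //; apply: divr_ge0 => //; exact: exprn_ge0.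
apply/eqP; rewrite -subr_eq0 -normr_le0; apply/ler_addgt0Pl => z z0; rewrite addr0.
have [n nz] := half_pow_small (d0 * weight mu kp x0' t0') z0.
by apply: le_trans (all n _ _ _ kxt0) _; rewrite mulrAC.
Qed.

End Uniqueness.

(** * Matrix-valued functions *)

Section MatrixNorm.
Variables (R : realType) (m n : nat).
Implicit Types (A : 'M[R]_(m, n)).

Lemma mx_norm_lt A (e : R) : 0 < e -> (forall i j, `|A i j| < e) -> `|A| < e.
Proof.
move=> e0 Ae; have : ball (0 : 'M[R]_(m, n)) e (- A).
  by split=> // i j; rewrite /ball /= !mxE sub0r opprK.
by rewrite mx_norm_ball /ball_ /= sub0r opprK.
Qed.

Lemma mx_norm_entry A i j : `|A i j| <= `|A|.
Proof.
apply/ler_addgt0Pl => e e0; have : ball (0 : 'M[R]_(m, n)) (`|A| + e) A.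
  by rewrite mx_norm_ball /ball_ /= sub0r normrN ltrDl.
by case=> _ /(_ i j); rewrite /ball /= !mxE sub0r normrN addrC => /ltW.
Qed.

Lemma mx_norm_le A (e : R) : 0 <= e -> (forall i j, `|A i j| <= e) -> `|A| <= e.
Proof.
move=> e0 Ae; apply/ler_addgt0Pl => d d0; apply/ltW/mx_norm_lt => [|i j].
  by rewrite ltr_pwDl.
by apply: le_lt_trans (Ae i j) _; rewrite ltrDr.
Qed.

Lemma cvg_mxP (T : Type) (F : set_system T) (f : T -> 'M[R]_(m, n)) A : Filter F ->
  (f @ F --> A) <-> (forall i j, (fun x => f x i j) @ F --> A i j).
Proof.
move=> FF; split=> [fA i j|fA].
  exact: (cvg_comp _ _ fA (@coord_continuous _ _ _ i j A)).
apply/cvgrPdist_lt => e e0.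
have : \forall x \near F, forall i j, `|A i j - f x i j| < e.
  apply: filter_forall => i; apply: filter_forall => j.
  by move/cvgrPdist_lt : (fA i j); exact.
apply: filterS => x xe; apply: mx_norm_lt => // i j.
by rewrite !mxE; exact: xe.
Qed.

End MatrixNorm.

Section Within.
Variables (R : realType) (m n : nat) (a b : R).
Hypothesis ab : a < b.
Implicit Types (f : R -> 'M[R]_(m, n)) (x : R).

Lemma diff_quot_cvgP (f : R -> R) x d : a <= x <= b ->
  (diff_quot f x @ within `[a, b] x^' --> d) <-> deriv_in a b f x d.
Proof.
move=> xab; split=> [/cvgrPdist_lt fd|/deriv_inP fd].
  apply/deriv_inP => e e0; have := fd _ e0.
  rewrite near_withinE near_withinE => /nbhs_ballP[r r0 rf]; exists r => // z zab zx.
  have [->|nzx] := eqVneq z x; first by rewrite !subrr mulr0 subr0 normr0 mulr0.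
  have zx0 : z - x != 0 by rewrite subr_eq0.
  have -> : f z - f x - d * (z - x) = - ((d - diff_quot f x z) * (z - x)).
    by rewrite /diff_quot /GRing.scale /=; field.
  rewrite normrN normrM ler_wpM2r // ltW //; apply: rf => //.
  by rewrite /ball /= distrC.
apply/cvgrPdist_lt => e e0; have e2 : 0 < e / 2 by rewrite divr_gt0.
have [r r0 rf] := fd _ e2.
rewrite near_withinE near_withinE; apply/nbhs_ballP; exists r => // z.
rewrite /ball /= distrC in_itv /= => zx nzx zab.
have zx0 : z - x != 0 by rewrite subr_eq0.
have zx1 : 0 < `|z - x| by rewrite normr_gt0.
rewrite -(ltr_pM2r zx1) -normrM.
have -> : (d - diff_quot f x z) * (z - x) = - (f z - f x - d * (z - x)).
  by rewrite /diff_quot /GRing.scale /=; field.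
rewrite normrN; apply: le_lt_trans (rf _ zab zx) _.
by rewrite ltr_pM2r // gtr_pMr // invf_lt1 // ltr1n.
Qed.

Lemma within_punctured_proper x : a <= x <= b -> ProperFilter (within `[a, b] x^').
Proof.
move=> xab; apply: Build_ProperFilter_ex => P PF.
have : \forall z \near within `[a, b] x^', P z by [].
rewrite near_withinE near_withinE => /nbhs_ballP[r r0 rP].
have [z [zab zr zx]] := itv_punctured_point ab xab r0.
by exists z; apply: rP => //; rewrite /ball /= distrC.
Qed.

(** The bridge from the limit in [deriv_on] to entrywise Caratheodory derivatives; the punctured
    filter has to be proper for [lim] to be determined. *)
Lemma deriv_onP f x (D : 'M[R]_(m, n)) : a <= x <= b ->
  (forall i j, deriv_in a b (fun z => f z i j) x (D i j)) <->
  derivable_on a b f x /\ deriv_on a b f x = D.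
Proof.
move=> xab; have pf := within_punctured_proper xab.
have E i j z : diff_quot f x z i j = diff_quot (fun z => f z i j) x z.
  by rewrite /diff_quot !mxE.
have EE i j : (fun z => diff_quot f x z i j) = diff_quot (fun z => f z i j) x.
  by apply/funext => z.
split=> [dfD|[df <-] i j].
  have fD : diff_quot f x @ within `[a, b] x^' --> D.
    by apply/cvg_mxP => i j; rewrite EE; apply/diff_quot_cvgP.
  by split; [apply/cvg_ex; exists D|apply/cvg_lim].
by apply/diff_quot_cvgP => //; rewrite -EE; move: i j; apply/cvg_mxP.
Qed.

Lemma derivable_on_entries f x : a <= x <= b -> derivable_on a b f x ->
  forall i j, deriv_in a b (fun z => f z i j) x (deriv_on a b f x i j).
Proof. by move=> xab df; apply/deriv_onP. Qed.

Lemma within_cont_mxP f : {within `[a, b], continuous f} <->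
  forall i j x, a <= x <= b -> cont_at a b (fun z => f z i j) x.
Proof.
rewrite subspace_continuousP; split=> [cf i j x xab|cf x /=].
  have fx : f @ within `[a, b] (nbhs x) --> f x by apply: cf; rewrite /= in_itv.
  exact: ((@cvg_mxP _ _ _ _ _ f (f x) _).1 fx i j).
by rewrite in_itv /= => xab; apply/cvg_mxP => i j; exact: cf.
Qed.

Definition C1_entries f (df : R -> 'M[R]_(m, n)) :=
  (forall i j x, a <= x <= b -> deriv_in a b (fun z => f z i j) x (df x i j)) /\
  (forall i j x, a <= x <= b -> cont_at a b (fun z => df z i j) x).

Lemma Ck_on1P f : Ck_on 1 a b f -> C1_entries f (deriv_on a b f).
Proof.
move=> [df /= /within_cont_mxP cf]; split=> // i j x xab.
by apply: derivable_on_entries => //; apply: df; rewrite in_itv.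
Qed.

Lemma Ck_on2P f : Ck_on 2 a b f -> C1_entries f (deriv_on a b f).
Proof.
move=> [df [ddf _]]; split=> i j x xab.
  by apply: derivable_on_entries => //; apply: df; rewrite in_itv.
apply: deriv_in_cont; apply: derivable_on_entries => //.
by apply: ddf; rewrite in_itv.
Qed.

End Within.

Section Rectangle.
Variables (R : realType) (l T : R).
Hypotheses (l0 : 0 < l) (T0 : 0 < T).

Definition clamp_rect (f : R -> R -> R) x t := f (clamp 0 l x) (clamp 0 T t).

Lemma C0_rect_mxP m n (y : R -> R -> 'M[R]_(m, n)) : C0_rect l T y <->
  forall i j, C0_rect l T (fun x t => y x t i j).
Proof.
rewrite /C0_rect subspace_continuousP; split=> [cy i j|cy p pI].
  apply/subspace_continuousP => p pI.
  exact: ((@cvg_mxP _ _ _ _ _ _ (y p.1 p.2) _).1 (cy p pI) i j).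
apply/cvg_mxP => i j.
by have /subspace_continuousP := cy i j; apply.
Qed.

Lemma C0_rect_eps (f : R -> R -> R) : C0_rect l T f <->
  forall x t, 0 <= x <= l -> 0 <= t <= T -> forall e, 0 < e ->
  exists2 r : R, 0 < r & forall x' t', 0 <= x' <= l -> 0 <= t' <= T ->
    `|x' - x| < r -> `|t' - t| < r -> `|f x' t' - f x t| < e.
Proof.
rewrite /C0_rect subspace_continuousP; split=> [cf x t xl tT e e0|cf [x t]].
  have pI : (`[0, l]%classic `*` `[0, T]) (x, t) by split; rewrite /= in_itv.
  move/cvgrPdist_lt/(_ _ e0) : (cf (x, t) pI).
  rewrite near_withinE => /nbhs_ballP[r r0 rf]; exists r => // x' t' xl' tT' xx tt.
  have := rf (x', t'); rewrite /= distrC; apply.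
    by split; rewrite /ball /= distrC.
  by split; rewrite /= in_itv.
move=> [] /=; rewrite !in_itv /= => xl tT; apply/cvgrPdist_lt => e e0.
have [r r0 rf] := cf _ _ xl tT _ e0.
rewrite near_withinE; apply/nbhs_ballP; exists r => //= -[x' t'] [] /=.
rewrite /ball /= => xx tt [] /=; rewrite !in_itv /= => xl' tT'.
by rewrite distrC; apply: rf => //; rewrite distrC.
Qed.

Lemma buc_C0_rect (f g : R -> R -> R) : buc g ->
  (forall x t, 0 <= x <= l -> 0 <= t <= T -> f x t = g x t) -> C0_rect l T f.
Proof.
move=> [_ ug] fg; apply/C0_rect_eps => x t xl tT e e0; have [r r0 rg] := ug _ e0.
by exists r => // x' t' xl' tT' xx tt; rewrite !fg //; exact: rg.
Qed.

(** Uniform continuity on the compact rectangle, carried to the plane by clamping, which is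
    1-Lipschitz with values in the rectangle. *)
Lemma C0_rect_buc (f : R -> R -> R) : C0_rect l T f -> buc (clamp_rect f).
Proof.
move=> cf0; have /C0_rect_eps cf := cf0.
have clx x := clamp_itv x (ltW l0); have clt t := clamp_itv t (ltW T0).
have cpt : compact (`[0, l]%classic `*` `[0, T]%classic).
  by apply: compact_setX; exact: segment_compact.
have /compact_near_coveringP cov := cpt.
have unif e : 0 < e -> exists2 d : R, 0 < d & forall x x' t t',
    0 <= x <= l -> 0 <= x' <= l -> 0 <= t <= T -> 0 <= t' <= T ->
    `|x - x'| < d -> `|t - t'| < d -> `|f x t - f x' t'| < e.
  move=> e0; have e2 : 0 < e / 2 by rewrite divr_gt0.
  (* The covering form of compactness, for the filter of small radii [d], makes a radius valid near
     each point valid at all points at once; [e] and [r] are halved for the passage through the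
     centre [(x, t)]. *)
  have : \forall d \near 0^'+, `[0, l]%classic `*` `[0, T]%classic `<=`
      [set p | 0 <= p.1 <= l -> 0 <= p.2 <= T -> forall x' t',
        0 <= x' <= l -> 0 <= t' <= T -> `|x' - p.1| < d -> `|t' - p.2| < d ->
        `|f x' t' - f p.1 p.2| < e].
    apply: cov => -[x t] /= []; rewrite !in_itv /= => xl tT.
    have [r r0 rf] := cf _ _ xl tT _ e2.
    exists (ball (x, t) (r / 2), [set d | d < r / 2]).
      split; first by apply: nbhsx_ballx; rewrite divr_gt0.
      by apply: nbhs_right_lt; rewrite divr_gt0.
    move=> [[y s] d] /= [[]]; rewrite /ball /= => xy ts dr yl sT z u zl uT zy us.
    have r2 : r / 2 < r by rewrite gtr_pMr // invf_lt1 // ltr1n.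
    rewrite distrC in xy; rewrite distrC in ts.
    have h1 : `|f y s - f x t| < e / 2.
      by apply: rf => //; [exact: lt_trans xy r2|exact: lt_trans ts r2].
    have h2 : `|f z u - f x t| < e / 2.
      apply: rf => //.
        have -> : z - x = (z - y) + (y - x) by ring.
        by rewrite (le_lt_trans (ler_normD _ _)) // [r]splitr ltrD // (lt_trans zy).
      have -> : u - t = (u - s) + (s - t) by ring.
      by rewrite (le_lt_trans (ler_normD _ _)) // [r]splitr ltrD // (lt_trans us).
    rewrite distrC in h1.
    have -> : f z u - f y s = (f z u - f x t) + (f x t - f y s) by ring.
    by rewrite (le_lt_trans (ler_normD _ _)) // [e]splitr ltrD.
  rewrite near_withinE => /nbhs_ballP[r r0 rd].
  have r2 : 0 < r / 2 by rewrite divr_gt0.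
  exists (r / 2) => // x x' t t' xl xl' tT tT' xx tt.
  have rr : ball 0 r (r / 2).
    rewrite /ball /= sub0r normrN gtr0_norm //.
    by rewrite gtr_pMr // invf_lt1 // ltr1n.
  by apply: (rd _ rr r2 (x', t')) => //; split; rewrite /= in_itv.
split; last first.
  move=> e e0; have [d d0 df] := unif _ e0; exists d => // x x' t t' xx tt.
  by apply: df => //; [exact: le_lt_trans (clamp_lip _ _ _ _) xx|exact: le_lt_trans (clamp_lip _ _ _ _) tt].
have /compact_bounded[M [_ /(_ (M + 1))]] := continuous_compact cf0 cpt.
rewrite ltrDl ltr01 => /(_ isT) fM; exists (M + 1) => x t.
apply: fM; exists (clamp 0 l x, clamp 0 T t); last by [].
by split; rewrite /= in_itv /=; [exact: clx|exact: clt].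
Qed.

End Rectangle.

Lemma within_buc (R : realType) (l : R) (f : R -> R) : 0 < l ->
  {within `[0, l], continuous f} -> buc (fun x _ => f (clamp 0 l x)).
Proof.
move=> l0 cf; apply: (C0_rect_buc l0 ltr01 (f := fun x _ => f x)).
apply/C0_rect_eps => x t xl _ e e0.
have [r r0 rf] := (cont_atP _ _ _ _).1 ((within_contP _ _ _).2 cf x xl) e e0.
by exists r => // *; exact: rf.
Qed.

(** * Travel-time coordinates *)

Section TravelCoordinate.
Variable R : realType.
Implicit Types (l x z xi t s : R) (lam mu : R -> R).

(* [phi x] is the time that a wave of velocity [lam] needs to reach [x] from the
   end where it enters, which is 0 if [b] and [l] otherwise; [chi] inverts [phi]. *)
Definition travel_coordinate l lam (b : bool) (Len : R) (phi chi : R -> R) :=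
  [/\ 0 < Len,
    forall x, 0 <= x <= l ->
      [/\ 0 <= phi x <= Len, chi (phi x) = x & deriv_in 0 l phi x (lam x)^-1],
    forall xi, 0 <= xi <= Len ->
      [/\ 0 <= chi xi <= l, phi (chi xi) = xi & deriv_in 0 Len chi xi (lam (chi xi))],
    chi 0 = (if b then 0 else l) & chi Len = (if b then l else 0)].

(** [phi] is a primitive of [1 / mu], with slopes at least [m], the inverse of the maximum of [mu].
    Hence [phi] is injective, its inverse [chi] exists by the intermediate value theorem and is
    Lipschitz with constant [1 / m], and the difference quotients of [chi] are the reciprocals of
    those of [phi]. *)
Lemma travel_coordinate_pos l mu : 0 < l ->
  (forall x, 0 <= x <= l -> cont_at 0 l mu x) -> (forall x, 0 <= x <= l -> 0 < mu x) ->
  exists Len phi chi, travel_coordinate l mu true Len phi chi.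
Proof.
move=> l0 cmu mu0.
pose g x := (mu (clamp 0 l x))^-1.
have clx x := clamp_itv x (ltW l0).
have cg : continuous g.
  have wg : {within `[0, l], continuous (fun x => (mu x)^-1)}.
    apply/within_contP => x xl; apply: cont_atV; last exact: cmu.
    by rewrite gt_eqF // mu0.
  have [_ ug] := within_buc l0 wg.
  exact: (@ucont2_slice _ (fun _ x => g x) 0 (ucont2_swap ug)).
have gE x : 0 <= x <= l -> g x = (mu x)^-1 by move=> xl; rewrite /g clamp_id.
have g0 x : 0 < g x by rewrite invr_gt0 mu0.
have [m m0 gm] : exists2 m, 0 < m & forall x, m <= g x.
  have wmu : {within `[0, l], continuous mu} by apply/within_contP.
  have [c cl mc] := EVT_max (ltW l0) wmu.
  have c0 : 0 < mu c by apply: mu0; rewrite in_itv in cl.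
  exists (mu c)^-1; first by rewrite invr_gt0.
  by move=> x; rewrite lef_pV2 ?posrE ?mu0 //; apply: mc; rewrite in_itv /=.
pose phi := primitive g.
have dphi x : is_derive x 1 phi (g x) by exact: is_derive_primitive.
have phi0 : phi 0 = 0 by exact: primitive0.
have slope x z : exists2 q, m <= q & phi z - phi x = q * (z - x).
  wlog xz : x z / x <= z => [H|].
    case/orP: (le_total x z) => [/H//|/H[q mq E]].
    by exists q => //; rewrite -opprB E; ring.
  have [c _ E] := MVT_segment xz (fun y _ => dphi y) (is_derive_continuous dphi).
  by exists (g c).
have phi_lt x z : x < z -> phi x < phi z.
  move=> xz; have [q mq E] := slope x z; rewrite -subr_gt0 E mulr_gt0 ?subr_gt0 //.
  exact: lt_le_trans m0 mq.
have phi_le x z : x <= z -> phi x <= phi z.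
  by rewrite le_eqVlt => /predU1P[->//|/phi_lt/ltW].
have phi_inj x z : phi x = phi z -> x = z.
  by move=> E; case: (ltgtP x z) => // /phi_lt; rewrite E ltxx.
pose Len := phi l.
have Len0 : 0 < Len by rewrite /Len -phi0 phi_lt.
have phiI x : 0 <= x <= l -> 0 <= phi x <= Len.
  by case/andP=> x0 xl; rewrite -{1}phi0 !phi_le.
have /choice[chi chiP] : forall xi, exists x,
    0 <= xi <= Len -> 0 <= x <= l /\ phi x = xi.
  move=> xi; case: (boolP (0 <= xi <= Len)) => [xiL|]; last by exists 0.
  have := @IVT R phi 0 l xi (ltW l0) (is_derive_continuous dphi).
  rewrite phi0 -/Len min_l ?max_r ?(ltW Len0) // => /(_ xiL)[x xl <-].
  by exists x => _; rewrite in_itv in xl.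
have chiK x : 0 <= x <= l -> chi (phi x) = x.
  by move=> xl; apply: phi_inj; have [] := chiP _ (phiI _ xl).
exists Len, phi, chi; split=> //.
- move=> x xl; split; [exact: phiI|exact: chiK|].
  by rewrite -gE //; exact: is_derive_deriv_in.
- move=> xi xiL; have [chil phichi] := chiP _ xiL; split=> //.
  have [q [fq qx cq]] := is_derive_deriv_in 0 l (dphi (chi xi)).
  have q0 z : 0 <= z <= l -> q z != 0.
    move=> zl; have [->|zx] := eqVneq z (chi xi); first by rewrite qx gt_eqF.
    have [p mp E] := slope (chi xi) z.
    have : q z * (z - chi xi) = p * (z - chi xi) by rewrite -fq.
    move/(mulIf _) => ->; first by rewrite gt_eqF // (lt_le_trans m0).
    by rewrite subr_eq0.
  have cchi : cont_at 0 Len chi xi.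
    apply/cont_atP => e e0; exists (m * e) => [|z zL zxi]; first exact: mulr_gt0.
    have [zl phiz] := chiP _ zL.
    have [p mp E] := slope (chi xi) (chi z).
    rewrite -(ltr_pM2l m0); apply: le_lt_trans zxi.
    rewrite -[in leRHS]phiz -[in leRHS]phichi E normrM ler_wpM2r //.
    by rewrite ger0_norm // ltW // (lt_le_trans m0).
  exists (fun z => (q (chi z))^-1); split.
  + move=> z zL; have [zl phiz] := chiP _ zL.
    by rewrite -[in RHS]phiz -[in RHS]phichi fq // chiK // mulKf // q0.
  + by rewrite qx gE // invrK.
  + apply: cont_atV; first exact: q0.
    by apply: (cont_at_comp (a' := 0) (b' := l)) => // z zL; have [] := chiP _ zL.
- by rewrite -[in LHS]phi0 chiK // lexx ltW.
- by rewrite chiK // lexx ltW.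
Qed.

Lemma travel_coordinate_exists l lam (b : bool) : 0 < l ->
  (forall x, 0 <= x <= l -> cont_at 0 l lam x) ->
  (forall x, 0 <= x <= l -> if b then 0 < lam x else lam x < 0) ->
  exists Len phi chi, travel_coordinate l lam b Len phi chi.
Proof.
case: b => l0 clam lam0; first exact: travel_coordinate_pos.
have cN x : 0 <= x <= l -> cont_at 0 l (fun x => - lam x) x.
  by move=> xl; apply: cvgN; exact: clam.
have N0 x : 0 <= x <= l -> 0 < - lam x by rewrite oppr_gt0; exact: lam0.
have [Len [phi [chi [Len0 phiP chiP chi0 chiL]]]] := travel_coordinate_pos l0 cN N0.
have reflect xi : 0 <= xi <= Len -> 0 <= Len - xi <= Len by lra.
(* A wave of negative speed enters at [l], so the coordinate built for the opposite speed is
   reflected in [[0, Len]]. *)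
exists Len, (fun x => Len + -1 * phi x), (fun xi => chi (Len - xi)); split=> //.
- move=> x xl; have [phil phiK dphi] := phiP _ xl; split; first lra.
    by rewrite mulN1r opprD opprK addrA subrr add0r.
  have -> : (lam x)^-1 = 0 + -1 * (- lam x)^-1 by rewrite add0r mulN1r invrN opprK.
  by apply: deriv_inD; [exact: deriv_in_cst|exact: deriv_inZ].
- move=> xi xiL; have xiL' := reflect _ xiL.
  have [chil chiK dchi] := chiP _ xiL'; split=> //.
    by rewrite chiK mulN1r opprB addrCA subrr addr0.
  have -> : lam (chi (Len - xi)) = - lam (chi (Len - xi)) * -1 by rewrite mulrN1 opprK.
  apply: (@deriv_in_comp _ 0 Len 0 Len chi (fun y => Len - y) xi (-1) _ reflect _ dchi).
  apply/deriv_inP => e e0; exists 1 => // z _ _.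
  have -> : Len - z - (Len - xi) - -1 * (z - xi) = 0 by ring.
  by rewrite normr0 mulr_ge0 // ltW.
- by rewrite subr0.
- by rewrite subrr.
Qed.

End TravelCoordinate.

Section Diagonal.
Variable R : realType.
Variables (l T Len : R).
Hypotheses (l0 : 0 < l) (T0 : 0 < T).
Variables (u ux ut : R -> R -> R) (chi : R -> R).
Hypothesis chiI : forall xi, 0 <= xi <= Len -> 0 <= chi xi <= l.
Hypothesis ut_cont : C0_rect l T ut.
Hypothesis du : forall x t, 0 <= x <= l -> 0 <= t <= T ->
  deriv_in 0 l (fun z => u z t) x (ux x t) /\ deriv_in 0 T (u x) t (ut x t).

Lemma deriv_diagonal (d s xi : R) : 0 < xi < Len -> 0 < s + xi < T ->
  deriv_in 0 Len chi xi d ->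
  is_derive xi 1 (fun y => u (chi y) (s + y)) (ux (chi xi) (s + xi) * d + ut (chi xi) (s + xi)).
Proof.
move=> xiL sT dchi; have xiL' : 0 <= xi <= Len by lra.
have sT' : 0 <= s + xi <= T by lra.
have chil := chiI xiL'; have [dx _] := du chil sT'.
have ubuc := C0_rect_buc l0 T0 ut_cont.
pose a := Num.max 0 (- s); pose b := Num.min Len (T - s).
have abP y : a <= y <= b -> 0 <= y <= Len /\ 0 <= s + y <= T.
  by rewrite /a /b ge_max le_min => /andP[/andP[? ?] /andP[? ?]]; split; lra.
have xiab : a < xi < b by rewrite /a /b gt_max lt_min; lra.
apply: (deriv_in_is_derive xiab); apply/deriv_inP => e e0.
have e2 : 0 < e / 2 by rewrite divr_gt0.
have dcomp : deriv_in 0 Len (fun y => u (chi y) (s + xi)) xi (ux (chi xi) (s + xi) * d).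
  exact: (deriv_in_comp chiI dchi dx).
have [r r0 rx] := (deriv_inP _ _ _ _ _).1 dcomp _ e2.
have [q q0 qt] := ubuc.2 _ e2.
have [p p0 pchi] := (cont_atP _ _ _ _).1 (deriv_in_cont dchi) _ q0.
exists (Num.min r (Num.min p q)) => [|y yab]; first by rewrite !lt_min r0 p0.
rewrite !lt_min => /and3P[yr yp yq]; have [yL syT] := abP _ yab.
have chiy := chiI yL.
have -> : u (chi y) (s + y) - u (chi xi) (s + xi) -
   (ux (chi xi) (s + xi) * d + ut (chi xi) (s + xi)) * (y - xi) =
  (u (chi y) (s + y) - u (chi y) (s + xi) - ut (chi xi) (s + xi) * (y - xi)) +
  (u (chi y) (s + xi) - u (chi xi) (s + xi) - ux (chi xi) (s + xi) * d * (y - xi)) by ring.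
have -> : e * `|y - xi| = e / 2 * `|y - xi| + e / 2 * `|y - xi| by field.
apply: le_trans (ler_normD _ _) _; apply: lerD; last exact: rx.
have cut : continuous (clamp_rect l T ut (chi y)) by exact: (ucont2_slice ubuc.2).
have E : u (chi y) (s + y) - u (chi y) (s + xi) =
    integ (clamp_rect l T ut (chi y)) (s + xi) (s + y).
  apply: (deriv_in_integ (df := ut (chi y)) (a := 0) (b := T)) => // [t tT|t tT].
    by have [] := du chiy tT.
  by rewrite /clamp_rect !clamp_id //; lra.
have cc : continuous (fun _ : R => ut (chi xi) (s + xi)) by move=> ?; exact: cvg_cst.
have -> : ut (chi xi) (s + xi) * (y - xi) =
    integ (fun=> ut (chi xi) (s + xi)) (s + xi) (s + y).
  by rewrite integ_cst; congr (_ * _); ring.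
rewrite E -integB //.
have -> : `|y - xi| = `|(s + y) - (s + xi)| by congr (`|_|); ring.
apply: integ_bound => [z|t tt]; first by apply: cvgB; [exact: cut|exact: cvg_cst].
have -> : ut (chi xi) (s + xi) = clamp_rect l T ut (chi xi) (s + xi).
  by rewrite /clamp_rect !clamp_id.
apply/ltW/qt; first exact: pchi.
move: tt yq; rewrite gt_min lt_max !ltr_norml.
by case/andP=> /orP[?|?] /orP[?|?] /andP[? ?]; apply/andP; split; lra.
Qed.

End Diagonal.

(** * Matrix calculus *)

Section MatrixCalculus.
Variables (R : realType) (a b : R).
Implicit Types (x z : R).

Definition mx_cont_at m n (f : R -> 'M[R]_(m, n)) x :=
  forall i j, cont_at a b (fun z => f z i j) x.

Lemma eq_mx_cont_at m n (f g : R -> 'M[R]_(m, n)) x :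
  (forall z, a <= z <= b -> f z = g z) -> a <= x <= b ->
  mx_cont_at f x -> mx_cont_at g x.
Proof.
move=> fg xab cf i j; apply: (cont_at_eq _ xab (cf i j)) => z zab.
by rewrite fg.
Qed.

Lemma mx_cont_at_cst m n (A : 'M[R]_(m, n)) x : mx_cont_at (fun=> A) x.
Proof. by move=> i j; exact: cont_at_cst. Qed.

Lemma mx_cont_atD m n (f g : R -> 'M[R]_(m, n)) x :
  mx_cont_at f x -> mx_cont_at g x -> mx_cont_at (fun z => f z + g z) x.
Proof.
move=> cf cg i j; under [X in cont_at _ _ X]eq_fun do rewrite mxE.
exact: cont_atD.
Qed.

Lemma mx_cont_atN m n (f : R -> 'M[R]_(m, n)) x :
  mx_cont_at f x -> mx_cont_at (fun z => - f z) x.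
Proof.
move=> cf i j; under [X in cont_at _ _ X]eq_fun do rewrite mxE.
by apply: cvgN; exact: cf.
Qed.

Lemma mx_cont_atM m n p (f : R -> 'M[R]_(m, n)) (g : R -> 'M[R]_(n, p)) x :
  mx_cont_at f x -> mx_cont_at g x -> mx_cont_at (fun z => f z *m g z) x.
Proof.
move=> cf cg i j; under [X in cont_at _ _ X]eq_fun do rewrite mxE.
by apply: cont_at_sum => k; exact: cont_atM.
Qed.

Lemma mx_cont_at_tr m n (f : R -> 'M[R]_(m, n)) x :
  mx_cont_at f x -> mx_cont_at (fun z => (f z)^T) x.
Proof.
by move=> cf i j; under [X in cont_at _ _ X]eq_fun do rewrite mxE; exact: cf.
Qed.

Lemma mx_cont_at_block m1 m2 n1 n2 (f1 : R -> 'M[R]_(m1, n1))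
    (f2 : R -> 'M[R]_(m1, n2)) (f3 : R -> 'M[R]_(m2, n1)) (f4 : R -> 'M[R]_(m2, n2)) x :
  mx_cont_at f1 x -> mx_cont_at f2 x -> mx_cont_at f3 x -> mx_cont_at f4 x ->
  mx_cont_at (fun z => block_mx (f1 z) (f2 z) (f3 z) (f4 z)) x.
Proof.
move=> c1 c2 c3 c4 i j; case: (split_ordP i) => i' ->; case: (split_ordP j) => j' ->.
- by under [X in cont_at _ _ X]eq_fun do rewrite block_mxEul; exact: c1.
- by under [X in cont_at _ _ X]eq_fun do rewrite block_mxEur; exact: c2.
- by under [X in cont_at _ _ X]eq_fun do rewrite block_mxEdl; exact: c3.
- by under [X in cont_at _ _ X]eq_fun do rewrite block_mxEdr; exact: c4.
Qed.

Lemma cont_at_det n (f : R -> 'M[R]_n) x : mx_cont_at f x ->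
  cont_at a b (fun z => \det (f z)) x.
Proof.
move=> cf; apply: cont_at_sum => s; apply: cont_atM; first exact: cont_at_cst.
exact: cont_at_prod.
Qed.

(** By Cramer's formula the entries of the inverse are cofactors divided by the determinant. *)
Lemma mx_cont_atV n (f : R -> 'M[R]_n) x :
  (forall z, a <= z <= b -> f z \in unitmx) -> a <= x <= b ->
  mx_cont_at f x -> mx_cont_at (fun z => invmx (f z)) x.
Proof.
move=> uf xab cf.
apply: (@eq_mx_cont_at _ _ (fun z => (\det (f z))^-1 *: \adj (f z))) => //.
  by move=> z zab; rewrite /invmx uf.
move=> i j.
rewrite (_ : (fun z => _) = (fun z => (\det (f z))^-1 * cofactor (f z) j i)); last first.
  by apply/funext => z; rewrite !mxE.
apply: cont_atM.
  apply: cont_atV; last exact: cont_at_det.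
  by have := uf _ xab; rewrite unitmxE unitfE.
apply: cont_atM; first exact: cont_at_cst.
apply: cont_at_det => i' j'.
by under [X in cont_at _ _ X]eq_fun do rewrite !mxE; exact: cf.
Qed.

(** With a slope matrix [Q] the product and inverse rules become matrix identities. *)
Lemma mx_caratheodory m n (f : R -> 'M[R]_(m, n)) x (D : 'M[R]_(m, n)) :
  (forall i j, deriv_in a b (fun z => f z i j) x (D i j)) <->
  exists Q : R -> 'M[R]_(m, n), [/\ forall z, a <= z <= b -> f z - f x = (z - x) *: Q z,
    Q x = D & mx_cont_at Q x].
Proof.
split=> [df|[Q [fQ Qx cQ]] i j].
  have /choice[q qP] : forall p : 'I_m * 'I_n, exists q : R -> R,
      [/\ forall z, a <= z <= b -> f z p.1 p.2 - f x p.1 p.2 = q z * (z - x),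
       q x = D p.1 p.2 & cont_at a b q x] by move=> p; exact: df.
  exists (fun z => \matrix_(i, j) q (i, j) z); split.
  - move=> z zab; apply/matrixP => i j; rewrite !mxE mulrC.
    by have [/(_ z zab)] := qP (i, j).
  - by apply/matrixP => i j; rewrite mxE; have [] := qP (i, j).
  - move=> i j; under [X in cont_at _ _ X]eq_fun do rewrite mxE.
    by have [] := qP (i, j).
exists (fun z => Q z i j); split; [|by rewrite Qx|exact: cQ].
by move=> z zab; have /matrixP/(_ i j) := fQ z zab; rewrite !mxE mulrC.
Qed.

Notation C1 := (C1_entries a b).

Lemma C1_cont m n (f df : R -> 'M[R]_(m, n)) x : C1 f df -> a <= x <= b -> mx_cont_at f x.
Proof. by move=> [fd _] xab i j; exact: deriv_in_cont (fd i j x xab). Qed.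

Lemma C1_intro m n (f df : R -> 'M[R]_(m, n)) :
  (forall x, a <= x <= b -> exists Q : R -> 'M[R]_(m, n),
    [/\ forall z, a <= z <= b -> f z - f x = (z - x) *: Q z,
        Q x = df x & mx_cont_at Q x]) ->
  (forall x, a <= x <= b -> mx_cont_at df x) -> C1 f df.
Proof.
move=> fQ cdf; split=> i j x xab; last exact: cdf.
by move: i j; apply/mx_caratheodory; exact: fQ.
Qed.

Lemma C1_caratheodory m n (f df : R -> 'M[R]_(m, n)) x : C1 f df -> a <= x <= b ->
  exists Q : R -> 'M[R]_(m, n),
    [/\ forall z, a <= z <= b -> f z - f x = (z - x) *: Q z,
        Q x = df x & mx_cont_at Q x].
Proof. by move=> [fd _] xab; apply/mx_caratheodory => i j; exact: fd. Qed.

Lemma C1_M m n p (f df : R -> 'M[R]_(m, n)) (g dg : R -> 'M[R]_(n, p)) :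
  C1 f df -> C1 g dg ->
  C1 (fun z => f z *m g z) (fun z => df z *m g z + f z *m dg z).
Proof.
move=> cf cg; apply: C1_intro => x xab; last first.
  have h1 := C1_cont cf xab; have h2 := C1_cont cg xab.
  by apply: mx_cont_atD; apply: mx_cont_atM => // i j; [exact: cf.2|exact: cg.2].
have [Q [fQ Qx cQ]] := C1_caratheodory cf xab.
have [P [gP Px cP]] := C1_caratheodory cg xab.
exists (fun z => Q z *m g z + f x *m P z); split; [|by rewrite Qx Px|].
  move=> z zab; rewrite scalerDr scalemxAl scalemxAr -fQ // -gP //.
  by rewrite mulmxBl mulmxBr addrA subrK.
apply: mx_cont_atD; apply: mx_cont_atM => //; first exact: C1_cont cg xab.
exact: mx_cont_at_cst.
Qed.

Lemma C1_V n (f df : R -> 'M[R]_n) : (forall z, a <= z <= b -> f z \in unitmx) ->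
  C1 f df -> C1 (fun z => invmx (f z)) (fun z => - (invmx (f z) *m df z *m invmx (f z))).
Proof.
move=> uf cf; have cV x : a <= x <= b -> mx_cont_at (fun z => invmx (f z)) x.
  by move=> xab; apply: mx_cont_atV => //; exact: C1_cont cf xab.
apply: C1_intro => x xab; last first.
  apply/mx_cont_atN/mx_cont_atM; last exact: cV.
  by apply: mx_cont_atM => [|i j]; [exact: cV|exact: cf.2].
have [Q [fQ Qx cQ]] := C1_caratheodory cf xab.
(* Read off from [1/f(z) - 1/f(x) = - 1/f(z) (f(z) - f(x)) 1/f(x)], with the order of the factors
   kept. *)
exists (fun z => - (invmx (f z) *m Q z *m invmx (f x))); split; [|by rewrite Qx|].
  move=> z zab; rewrite scalerN scalemxAl scalemxAr -fQ // mulmxBr mulmxBl.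
  by rewrite mulVmx ?uf // mul1mx -mulmxA mulmxV ?uf // mulmx1 opprB.
apply/mx_cont_atN/mx_cont_atM; last exact: mx_cont_at_cst.
by apply: mx_cont_atM; [exact: cV|exact: cQ].
Qed.

Lemma C1_block m1 m2 n1 n2 (f1 d1 : R -> 'M[R]_(m1, n1))
    (f2 d2 : R -> 'M[R]_(m1, n2)) (f3 d3 : R -> 'M[R]_(m2, n1)) (f4 d4 : R -> 'M[R]_(m2, n2)) :
  C1 f1 d1 -> C1 f2 d2 -> C1 f3 d3 -> C1 f4 d4 ->
  C1 (fun z => block_mx (f1 z) (f2 z) (f3 z) (f4 z))
     (fun z => block_mx (d1 z) (d2 z) (d3 z) (d4 z)).
Proof.
move=> c1 c2 c3 c4; split; last first.
  by move=> i j x xab; move: i j; apply: mx_cont_at_block => i j;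
    [exact: c1.2|exact: c2.2|exact: c3.2|exact: c4.2].
move=> i j x xab; case: (split_ordP i) => i' ->; case: (split_ordP j) => j' ->.
- by under [X in deriv_in _ _ X]eq_fun do rewrite block_mxEul; rewrite block_mxEul; exact: c1.1.
- by under [X in deriv_in _ _ X]eq_fun do rewrite block_mxEur; rewrite block_mxEur; exact: c2.1.
- by under [X in deriv_in _ _ X]eq_fun do rewrite block_mxEdl; rewrite block_mxEdl; exact: c3.1.
- by under [X in deriv_in _ _ X]eq_fun do rewrite block_mxEdr; rewrite block_mxEdr; exact: c4.1.
Qed.

End MatrixCalculus.

(** * Positive definite matrices *)

Section PosDef.
Variables (R : realType) (n : nat).
Implicit Types (S : 'M[R]_n) (u v : 'cV[R]_n).

Lemma posdefmx_ge0 S v : posdefmx S -> 0 <= (v^T *m S *m v) 0 0.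
Proof.
move=> [_ pS]; have [->|v0] := eqVneq v 0; last exact/ltW/pS.
by rewrite mulmx0 mxE.
Qed.

Lemma posdefmx_unit S : posdefmx S -> S \in unitmx.
Proof.
move=> [sS pS]; rewrite -row_free_unit -kermx_eq0; apply/eqP/row_matrixP => i.
rewrite row0; set w := row i _.
have wS : w *m S = 0 by apply/sub_kermxP; exact: row_sub.
apply/eqP/negPn/negP => w0.
have w0' : w^T != 0 by apply: contra w0 => /eqP e; rewrite -[w]trmxK e trmx0.
by have := pS _ w0'; rewrite trmxK wS mul0mx mxE ltxx.
Qed.

(** The form is nonnegative at [u - (p / q) v], the part of [u] that is [S]-orthogonal to [v]. *)
Lemma cauchy_schwarz S u v : posdefmx S ->
  (u^T *m S *m v) 0 0 ^+ 2 <= (u^T *m S *m u) 0 0 * (v^T *m S *m v) 0 0.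
Proof.
move=> pS; have [sS pos] := pS.
have [->|v0] := eqVneq v 0; first by rewrite !mulmx0 mxE expr2 mulr0 mulr0.
have q0 := pos _ v0; set q := (v^T *m S *m v) 0 0 in q0 *.
set p := (u^T *m S *m v) 0 0; set r := (u^T *m S *m u) 0 0.
have pE : (v^T *m S *m u) 0 0 = p.
  have -> : v^T *m S *m u = (u^T *m S *m v)^T.
    by rewrite !trmx_mul trmxK sS mulmxA.
  by rewrite mxE.
have := posdefmx_ge0 (u - (p / q) *: v) pS.
have -> : ((u - (p / q) *: v)^T *m S *m (u - (p / q) *: v)) 0 0 = r - p ^+ 2 / q.
  have -> : (u - (p / q) *: v)^T *m S *m (u - (p / q) *: v) =
    u^T *m S *m u - (p / q) *: (v^T *m S *m u) - ((p / q) *: (u^T *m S *m v) -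
    (p / q) *: ((p / q) *: (v^T *m S *m v))).
    have -> : (u - (p / q) *: v)^T = u^T - (p / q) *: v^T.
      by apply/matrixP => i j; rewrite !mxE.
    by rewrite !mulmxBr !mulmxBl -!scalemxAr -!scalemxAl.
  have sc (A B C D : 'M[R]_1) (k : R) : (A - k *: B - (k *: C - k *: (k *: D))) 0 0 =
    A 0 0 - k * B 0 0 - (k * C 0 0 - k * (k * D 0 0)) by rewrite !mxE.
  rewrite sc pE -/p -/q -/r; field; exact: lt0r_neq0.
by rewrite subr_ge0 ler_pdivrMr.
Qed.

(** Cauchy-Schwarz with [u = invmx S *m v] reads [|v|^4 <= (v^T S^-1 v) (v^T S v)]. The first factor
    is at most [c |v|^2], [c] being built from the entries of the inverse, and dividing by [|v|^2]
    gives the claim without eigenvalues. *)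
Lemma posdefmx_coercive S : posdefmx S -> exists2 c : R, 0 < c &
  forall v, (v^T *m v) 0 0 <= c * (v^T *m S *m v) 0 0.
Proof.
move=> pS; have uS := posdefmx_unit pS; have [sS pos] := pS.
pose A := invmx S; pose c := 1 + \sum_i \sum_j `|A i j|.
have c0 : 0 < c by rewrite ltr_pwDl // sumr_ge0 // => i _; exact: sumr_ge0.
exists c => // v.
have nE w : (w^T *m w) 0 0 = \sum_i w i 0 ^+ 2 :> R.
  by rewrite mxE; apply: eq_bigr => i _; rewrite mxE expr2.
have n0 : 0 <= (v^T *m v) 0 0 by rewrite nE sumr_ge0 // => i _; exact: sqr_ge0.
have entry i : `|v i 0| ^+ 2 <= (v^T *m v) 0 0.
  rewrite real_normK ?num_real // nE (bigD1 i) //= lerDl sumr_ge0 // => j _.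
  exact: sqr_ge0.
have pr i j : `|v i 0| * `|v j 0| <= (v^T *m v) 0 0.
  have := entry i; have := entry j; have := sqr_ge0 (`|v i 0| - `|v j 0|).
  rewrite !expr2; set x := `|v i 0|; set y := `|v j 0|; nra.
have := cauchy_schwarz (A *m v) v pS.
have -> : (A *m v)^T *m S *m v = v^T *m v.
  have AT : A^T *m S = 1%:M.
    by rewrite -[X in _ *m X]sS -trmx_mul mulmxV // trmx1.
  by rewrite trmx_mul -!mulmxA [A^T *m _]mulmxA AT mul1mx.
have -> : (A *m v)^T *m S *m (A *m v) = v^T *m A *m v.
  have AT : A^T *m S = 1%:M.
    by rewrite -[X in _ *m X]sS -trmx_mul mulmxV // trmx1.
  by rewrite trmx_mul -!mulmxA [A^T *m _]mulmxA AT mul1mx.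
have bound : (v^T *m A *m v) 0 0 <= c * (v^T *m v) 0 0.
  apply: (@le_trans _ _ ((\sum_i \sum_j `|A i j|) * (v^T *m v) 0 0)); last first.
    by rewrite ler_wpM2r // lerDr.
  rewrite -mulmxA mxE mulr_suml; apply: ler_sum => i _.
  rewrite [v^T 0 i]mxE [(A *m v) i 0]mxE mulr_sumr mulr_suml; apply: ler_sum => j _.
  apply: le_trans (ler_norm _) _; rewrite !normrM mulrCA ler_wpM2l //.
have q0 := posdefmx_ge0 v pS.
move=> CS; have fin (p q t : R) : 0 <= p -> 0 <= q -> p ^+ 2 <= t * q -> t <= c * p ->
    p <= c * q.
  move=> p0 q00 tq tp; have [->|pn0] := eqVneq p 0; first by rewrite mulr_ge0 // ltW.
  have ppos : 0 < p by rewrite lt_def pn0.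
  rewrite -(ler_pM2l ppos) -expr2; apply: le_trans tq _.
  by rewrite mulrA (mulrC p) ler_wpM2r.
exact: fin n0 q0 CS bound.
Qed.

Lemma mxtrace_posdef m S (X : 'M[R]_(n, m)) :
  \tr (X^T *m S *m X) = \sum_j ((col j X)^T *m S *m col j X) 0 0.
Proof.
apply: eq_bigr => j _; rewrite !mxE; apply: eq_bigr => i _; rewrite !mxE.
by congr (_ * _); apply: eq_bigr => k _; rewrite !mxE.
Qed.

Lemma mxtrace_posdef_ge0 m S (X : 'M[R]_(n, m)) : posdefmx S -> 0 <= \tr (X^T *m S *m X).
Proof. by move=> pS; rewrite mxtrace_posdef sumr_ge0 // => j _; exact: posdefmx_ge0. Qed.

Lemma mxtrace_posdef_coercive m S (X : 'M[R]_(n, m)) (c : R) : 0 < c ->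
  (forall v, (v^T *m v) 0 0 <= c * (v^T *m S *m v) 0 0) ->
  \sum_j \sum_i X i j ^+ 2 <= c * \tr (X^T *m S *m X).
Proof.
move=> c0 cS; rewrite mxtrace_posdef mulr_sumr; apply: ler_sum => j _.
apply: le_trans (cS _); rewrite mxE; apply: ler_sum => i _.
by rewrite !mxE expr2.
Qed.

End PosDef.

(** * Differentiability of the matrix square root *)

Section SquareRoot.
Variables (R : realType) (a b : R) (n : nat).
Implicit Types (x z : R) (X : 'M[R]_n).

Lemma mx_cont_at_mxvec p q (f : R -> 'M[R]_(p, q)) x :
  mx_cont_at a b f x -> mx_cont_at a b (fun z => mxvec (f z)) x.
Proof.
move=> cf i j; rewrite (ord1 i); case/mxvec_indexP: j => k l.
by under [X in cont_at _ _ X]eq_fun do rewrite mxvecE; exact: cf.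
Qed.

Lemma mx_cont_at_vec_mx p q (f : R -> 'rV[R]_(p * q)) x :
  mx_cont_at a b f x -> mx_cont_at a b (fun z => vec_mx (f z)) x.
Proof.
by move=> cf i j; under [X in cont_at _ _ X]eq_fun do rewrite mxE; exact: cf.
Qed.

(* [X = S z - S x] solves [S z *m X + X *m S x = C z - C x] when [S] is a square
   root of [C], so that the differentiability of [C] passes to [S]. *)
Definition sylvester (A B : 'M[R]_n) : 'M[R]_(n * n) :=
  lin_mx (mulmx A) + lin_mx (mulmxr B).

Lemma mxvec_sylvester A B X : mxvec X *m sylvester A B = mxvec (A *m X + X *m B).
Proof. by rewrite mulmxDr !mul_vec_lin /= linearD. Qed.

Lemma sylvester_cont (f g : R -> 'M[R]_n) x : mx_cont_at a b f x ->
  mx_cont_at a b g x -> mx_cont_at a b (fun z => sylvester (f z) (g z)) x.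
Proof.
move=> cf cg; apply: mx_cont_atD => i j.
  rewrite (_ : (fun z => _) =
      (fun z => mxvec (f z *m vec_mx (delta_mx 0 i)) 0 j)); last first.
    by apply/funext => z; rewrite mxE.
  by apply: mx_cont_at_mxvec; apply: mx_cont_atM => //; exact: mx_cont_at_cst.
rewrite (_ : (fun z => _) =
    (fun z => mxvec (vec_mx (delta_mx 0 i) *m g z) 0 j)); last first.
  by apply/funext => z; rewrite mxE.
by apply: mx_cont_at_mxvec; apply: mx_cont_atM => //; exact: mx_cont_at_cst.
Qed.

Lemma sylvester_trace A B X :
  \tr (X^T *m (A *m X + X *m B)) = \tr (X^T *m A *m X) + \tr (X^T^T *m B *m X^T).
Proof.
rewrite mulmxDr mxtraceD mulmxA; congr (_ + _).
by rewrite trmxK mxtrace_mulC.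
Qed.

Lemma sum_sqr_eq0 X : \sum_j \sum_i X i j ^+ 2 <= 0 -> X = 0.
Proof.
move=> X0; apply/matrixP => i j; rewrite mxE; apply/eqP; rewrite -sqrf_eq0.
have h1 k l : 0 <= X k l ^+ 2 by exact: sqr_ge0.
rewrite eq_le h1 andbT; apply: le_trans X0.
rewrite (bigD1 j) //= (bigD1 i) //= -addrA lerDl addr_ge0 // sumr_ge0 // => l _.
exact: sumr_ge0.
Qed.

(** Pairing [A X + X B = 0] with [X] under the trace gives two nonnegative terms with sum 0, the
    first of which controls every entry of [X]. *)
Lemma sylvester_unit A B : posdefmx A -> posdefmx B -> sylvester A B \in unitmx.
Proof.
move=> pA pB; rewrite -row_free_unit -kermx_eq0; apply/eqP/row_matrixP => i.
rewrite row0; set w := row i _.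
have wK : w *m sylvester A B = 0 by apply/sub_kermxP; exact: row_sub.
rewrite -[w]vec_mxK in wK *; set X := vec_mx w in wK *.
suff -> : X = 0 by rewrite linear0.
have E : A *m X + X *m B = 0.
  by apply: (can_inj mxvecK); rewrite -mxvec_sylvester wK linear0.
have [c c0 cA] := posdefmx_coercive pA.
apply: sum_sqr_eq0; apply: le_trans (mxtrace_posdef_coercive X c0 cA) _.
rewrite pmulr_rle0 //; have := sylvester_trace A B X.
rewrite E mulmx0 mxtrace0; have := mxtrace_posdef_ge0 X^T pB.
by have := mxtrace_posdef_ge0 X pA; lra.
Qed.

Variables (C dC S : R -> 'M[R]_n).
Hypothesis C_C1 : C1_entries a b C dC.
Hypothesis S_pos : forall x, a <= x <= b -> posdefmx (S x).
Hypothesis S_sqr : forall x, a <= x <= b -> S x *m S x = C x.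

Let sqrt_diff x z : a <= x <= b -> a <= z <= b ->
  S z *m (S z - S x) + (S z - S x) *m S x = C z - C x.
Proof.
by move=> xab zab; rewrite mulmxBr mulmxBl !S_sqr // addrA subrK.
Qed.

(** In the trace identity for [S z X + X S x = C z - C x] the term with [S z] is nonnegative and
    dropped. Coercivity is used at [S x] alone, so the constant is the same for all [z] before any
    continuity of [S] is known. The successor in [(n * n).+1] keeps it positive for [n = 0]. *)
Lemma sqrt_lipschitz x : a <= x <= b -> exists2 c : R, 0 < c & forall z, a <= z <= b ->
  `|S z - S x| <= c * `|C z - C x|.
Proof.
move=> xab; have [c c0 cS] := posdefmx_coercive (S_pos xab).
exists (c * (n * n).+1%:R); first by rewrite mulr_gt0.
move=> z zab; set X := S z - S x; set E := C z - C x.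
have m0 : 0 <= `|X| by exact: normr_ge0.
have Xx : `|X| ^+ 2 <= \sum_j \sum_i X i j ^+ 2.
  have [X0|X0] := eqVneq `|X| 0.
    rewrite X0 expr2 mulr0 sumr_ge0 // => j _; apply: sumr_ge0 => i _.
    exact: sqr_ge0.
  have [[i j] /= XE] := mx_norm_neq0 X0.
  have -> : `|X| = `|X i j| by exact: XE.
  rewrite real_normK ?num_real // (bigD1 j) //= (bigD1 i) //= -addrA lerDl addr_ge0 //.
    by apply: sumr_ge0 => k _; exact: sqr_ge0.
  by apply: sumr_ge0 => l _; apply: sumr_ge0 => k _; exact: sqr_ge0.
have sqE : \sum_j \sum_i X i j ^+ 2 = \sum_j \sum_i X^T i j ^+ 2.
  rewrite exchange_big; apply: eq_bigr => i _; apply: eq_bigr => j _.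
  by rewrite [X^T _ _]mxE.
have h1 : \sum_j \sum_i X i j ^+ 2 <= c * \tr (X^T^T *m S x *m X^T).
  by rewrite sqE; exact: mxtrace_posdef_coercive.
have h2 : \tr (X^T^T *m S x *m X^T) <= \tr (X^T *m E).
  rewrite /E -(sqrt_diff xab zab) -/X sylvester_trace lerDr.
  by apply: mxtrace_posdef_ge0; exact: S_pos.
have h3 : \tr (X^T *m E) <= (n * n)%:R * (`|X| * `|E|).
  apply: le_trans (ler_norm _) _; apply: le_trans (ler_norm_sum _ _ _) _.
  apply: (@le_trans _ _ (\sum_(i < n) \sum_(j < n) `|X| * `|E|)).
    apply: ler_sum => i _; rewrite mxE; apply: le_trans (ler_norm_sum _ _ _) _.
    apply: ler_sum => j _; rewrite mxE normrM.
    by apply: ler_pM => //; exact: mx_norm_entry.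
  by rewrite !sumr_const !card_ord -mulrnA mulr_natl.
have [X0|X0] := eqVneq `|X| 0.
  by rewrite X0 !mulr_ge0 // ltW.
have Xpos : 0 < `|X| by rewrite lt_def X0.
rewrite -(ler_pM2l Xpos) -expr2; apply: le_trans Xx _; apply: le_trans h1 _.
apply: (@le_trans _ _ (c * ((n * n)%:R * (`|X| * `|E|)))).
  by rewrite ler_pM2l //; exact: le_trans h2 h3.
have -> : `|X| * (c * (n * n).+1%:R * `|E|) = c * ((n * n).+1%:R * (`|X| * `|E|)) by ring.
by rewrite ler_pM2l // ler_wpM2r ?mulr_ge0 // ler_nat.
Qed.

Lemma sqrt_cont x : a <= x <= b -> mx_cont_at a b S x.
Proof.
move=> xab i j; apply/cont_atP => e e0; have [c c0 cS] := sqrt_lipschitz xab.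
have ec : 0 < e / c by rewrite divr_gt0.
have cC := C1_cont C_C1 xab.
have : \forall z \near within `[a, b] (nbhs x), `|C z - C x| < e / c.
  have /cvgrPdist_lt/(_ _ ec) : C @ within `[a, b] (nbhs x) --> C x.
    by apply/cvg_mxP => k l; exact: cC.
  by apply: filterS => z; rewrite distrC.
rewrite near_withinE => /nbhs_ballP[r r0 rC]; exists r => // z zab zx.
have -> : S z i j - S x i j = (S z - S x) i j by rewrite !mxE.
apply: le_lt_trans (mx_norm_entry _ _ _) _; apply: le_lt_trans (cS _ zab) _.
rewrite mulrC -ltr_pdivlMr //; apply: rC => //.
  by rewrite /ball /= distrC.
Qed.

(** The inverse of the Sylvester operator is applied to the slope matrix of [C]; it is continuous
    because [sqrt_cont] is already known. *)
Lemma sqrt_C1 : exists dS, C1_entries a b S dS.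
Proof.
have uK x z : a <= x <= b -> a <= z <= b -> sylvester (S z) (S x) \in unitmx.
  by move=> xab zab; apply: sylvester_unit; exact: S_pos.
exists (fun x => vec_mx (mxvec (dC x) *m invmx (sylvester (S x) (S x)))).
apply: C1_intro => x xab; last first.
  apply/mx_cont_at_vec_mx/mx_cont_atM.
    by apply: mx_cont_at_mxvec => i j; exact: C_C1.2.
  apply: mx_cont_atV => //; first by move=> z zab; exact: uK.
  by apply: sylvester_cont; exact: sqrt_cont.
have [Q [CQ Qx cQ]] := C1_caratheodory C_C1 xab.
exists (fun z => vec_mx (mxvec (Q z) *m invmx (sylvester (S z) (S x)))); split.
- move=> z zab; apply: (can_inj mxvecK); rewrite -linearZ /= vec_mxK scalemxAl.
  rewrite -linearZ /= -CQ // -(sqrt_diff xab zab) -mxvec_sylvester -mulmxA.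
  by rewrite mulmxV ?uK // mulmx1.
- by rewrite Qx.
- apply/mx_cont_at_vec_mx/mx_cont_atM; first exact: mx_cont_at_mxvec.
  apply: mx_cont_atV => //; first by move=> z zab; exact: uK.
  by apply: sylvester_cont; [exact: sqrt_cont|exact: mx_cont_at_cst].
Qed.

End SquareRoot.

Lemma invmxM (R : fieldType) (d : nat) (A B : 'M[R]_d) :
  A \in unitmx -> B \in unitmx -> invmx (A *m B) = invmx B *m invmx A.
Proof.
move=> uA uB; have uAB : A *m B \in unitmx by rewrite unitmx_mul uA.
rewrite -[RHS]mul1mx -(mulVmx uAB) -!mulmxA (mulmxA B) mulmxV // mul1mx.
by rewrite mulmxV // mulmx1.
Qed.

Section PosDefClosure.
Variables (R : realType) (d : nat).
Implicit Types (A B : 'M[R]_d).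

Lemma posdefmx_inv A : posdefmx A -> posdefmx (invmx A).
Proof.
move=> pA; have uA := posdefmx_unit pA; have [sA pos] := pA.
split; first by rewrite trmx_inv sA.
move=> v v0; pose u := invmx A *m v.
have u0 : u != 0.
  apply: contra v0 => /eqP u0; apply/eqP.
  by rewrite -[v](mulKVmx uA) -/u u0 mulmx0.
have -> : v^T *m invmx A *m v = u^T *m A *m u.
  have sI : (invmx A)^T = invmx A by rewrite trmx_inv sA.
  by rewrite /u trmx_mul sI -!mulmxA (mulKVmx uA).
exact: pos.
Qed.

Lemma posdefmx_congr A B : posdefmx A -> B \in unitmx -> posdefmx (B^T *m A *m B).
Proof.
move=> [sA pos] uB; split; first by rewrite !trmx_mul trmxK sA mulmxA.
move=> v v0; have Bv0 : B *m v != 0.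
  by apply: contra v0 => /eqP e; rewrite -[v](mulKmx uB) e mulmx0.
by have := pos _ Bv0; rewrite trmx_mul !mulmxA.
Qed.

Lemma posdefmx_sum (I : finType) (E : {set I}) (F : I -> 'M[R]_d) i0 : i0 \in E ->
  (forall i, i \in E -> posdefmx (F i)) -> posdefmx (\sum_(i in E) F i).
Proof.
move=> i0E pF; split.
  by rewrite linear_sum; apply: eq_bigr => i iE; have [] := pF i iE.
move=> v v0; rewrite mulmx_sumr mulmx_suml summxE (bigD1 i0) //= ltr_pwDl //.
  by have [_] := pF _ i0E; apply.
by apply: sumr_ge0 => i /andP[iE _]; apply: posdefmx_ge0; exact: pF.
Qed.

End PosDefClosure.

(** * Linear algebra of a multiple node *)

Section NodeAlgebra.
Variables (R : realType) (d : nat) (I : finType) (E : {set I}).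
Variables (Rb P Pi Z : I -> 'M[R]_d).
Hypothesis RbT : forall i, i \in E -> (Rb i)^T *m Rb i = 1%:M.
Hypothesis PiP : forall i, i \in E -> Pi i *m P i = 1%:M.
Variable i0 : I.
Hypothesis i0E : i0 \in E.
Let H := \sum_(i in E) Rb i *m Z i *m Pi i *m (Rb i)^T.
Hypothesis uH : H \in unitmx.
Variables (al be : I -> 'cV[R]_d) (q : 'cV[R]_d).

(** With amplitude [x] and stress [y] the entering and leaving waves are [x + y] and [x - y]:
    prescribing the amplitude amounts to a reflection with sign -1. *)
Lemma add_sub_eq2 (x y X : 'cV[R]_d) : x + y = 2 *: X - (x - y) <-> x = X.
Proof.
split=> [E1|->]; last by rewrite scaler_nat mulr2n opprB addrCA addrK addrC.
have : 2 *: x = 2 *: X.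
  by rewrite -[RHS](subrK (x - y)) -E1 scaler_nat mulr2n addrACA subrr addr0.
have n2 : (2 : R) != 0 by rewrite pnatr_eq0.
by move/(scalerI n2).
Qed.

(* If [u] is the common nodal velocity then [al i = Pi i *m (Rb i)^T *m u], and the
   balance of forces reads [H *m u = q + \sum_j Rb j *m Z j *m (al j - be j)]. *)
Lemma multiple_nodeP :
  (forall i j, i \in E -> j \in E -> Rb i *m (P i *m al i) = Rb j *m (P j *m al j)) /\
  \sum_(i in E) Rb i *m (Z i *m be i) = q <->
  forall i, i \in E -> al i + be i =
    2 *: (Pi i *m (Rb i)^T *m invmx H *m
      (q + \sum_(j in E) Rb j *m Z j *m (al j - be j))) - (al i - be i).
Proof.
pose w := invmx H *m (q + \sum_(j in E) Rb j *m Z j *m (al j - be j)).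
have PPi i : i \in E -> P i *m Pi i = 1%:M by move=> iE; exact/mulmx1C/PiP.
have RRbT i : i \in E -> Rb i *m (Rb i)^T = 1%:M by move=> iE; exact/mulmx1C/RbT.
have sumE : \sum_(j in E) Rb j *m Z j *m (al j - be j) =
    \sum_(j in E) Rb j *m (Z j *m al j) - \sum_(j in E) Rb j *m (Z j *m be j).
  by rewrite -sumrB; apply: eq_bigr => j _; rewrite mulmxBr !mulmxA.
have Hw u : (forall i, i \in E -> al i = Pi i *m (Rb i)^T *m u) ->
    H *m u = \sum_(j in E) Rb j *m (Z j *m al j).
  by move=> alu; rewrite mulmx_suml; apply: eq_bigr => j jE; rewrite alu // !mulmxA.
have E2 : (forall i, i \in E -> al i + be i =
    2 *: (Pi i *m (Rb i)^T *m invmx H *m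
      (q + \sum_(j in E) Rb j *m Z j *m (al j - be j))) - (al i - be i)) <->
    forall i, i \in E -> al i = Pi i *m (Rb i)^T *m w.
  by split=> h i iE; have := h i iE; rewrite -(mulmxA _ (invmx H)) -/w add_sub_eq2.
rewrite E2; split=> [[cond sumq]|alw].
  pose u := Rb i0 *m (P i0 *m al i0).
  have alu i : i \in E -> al i = Pi i *m (Rb i)^T *m u.
    move=> iE; rewrite /u (cond i0 i) // !mulmxA -(mulmxA (Pi i)) RbT // mulmx1.
    by rewrite PiP // mul1mx.
  suff -> : w = u by [].
  by rewrite /w sumE sumq addrC subrK -(Hw u alu) mulKmx.
have Rw i : i \in E -> Rb i *m (P i *m al i) = w.
  move=> iE; rewrite alw // !mulmxA -(mulmxA (Rb i)) PPi // mulmx1.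
  by rewrite RRbT // mul1mx.
split=> [i j iE jE|]; first by rewrite !Rw.
have := Hw w alw; rewrite /w mulKVmx // sumE => /eqP.
by rewrite addrCA -[X in _ == X]addr0 (inj_eq (addrI _)) subr_eq0 => /eqP.
Qed.

End NodeAlgebra.

(** * Diagonalisation of the first-order part of one beam *)

Section Diagonalization.
Variables (R : realType) (d : nat).
Variables (M C S U D : 'M[R]_d).
Hypothesis uM : M \in unitmx.
Hypothesis uS : S \in unitmx.
Hypothesis SS : S *m S = C.
Hypothesis UTU : U^T *m U = 1%:M.
Hypothesis uD : D \in unitmx.
Hypothesis ThetaE : invmx (S *m M *m S) = U^T *m (D *m D) *m U.

Definition amplitude_mx := S *m U^T.
Definition amplitude_inv := U *m invmx S.
Definition stress_mx := invmx S *m U^T *m invmx D.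
Definition stress_inv := D *m U *m S.

(** Takes a state [(v, z)] to [U S^-1 v + D U S z] and [U S^-1 v - D U S z], of speeds [- D] and
    [D]. *)
Definition riemann_mx : 'M[R]_(d + d) :=
  block_mx amplitude_inv stress_inv amplitude_inv (- stress_inv).

Definition speed_mx : 'M[R]_(d + d) := block_mx (- D) 0 0 D.

Let UUT : U *m U^T = 1%:M. Proof. exact: mulmx1C. Qed.

Lemma amplitude_invK : amplitude_inv *m amplitude_mx = 1%:M.
Proof. by rewrite /amplitude_inv /amplitude_mx mulmxA mulmxKV // UUT. Qed.

Lemma stress_invK : stress_inv *m stress_mx = 1%:M.
Proof.
rewrite /stress_inv /stress_mx !mulmxA mulmxK // -(mulmxA D) UUT mulmx1.
by rewrite mulmxV.
Qed.

Lemma riemann_mx_unit : riemann_mx \in unitmx.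
Proof.
have PiP := amplitude_invK; have ZiZ := stress_invK.
suff /mulmx1_unit[] : riemann_mx *m (2^-1 *: block_mx amplitude_mx amplitude_mx
  stress_mx (- stress_mx)) = 1%:M by [].
rewrite -scalemxAr mulmx_block !mulNmx !mulmxN PiP ZiZ opprK.
have half (X : 'M[R]_d) : 2^-1 *: (X + X) = X.
  by rewrite -mulr2n -[X *+ 2]scaler_nat scalerA mulVf ?pnatr_eq0 // scale1r.
by rewrite scale_block_mx subrr scaler0 half -scalar_mx_block.
Qed.

(** Two identities carry it: [stress_inv C^-1 = D amplitude_inv], from [C = S S], and
    [amplitude_inv M^-1 = D stress_inv], which is [ThetaE] multiplied by [U] on the left and by [S]
    on the right. *)
Lemma riemann_mx_diag :
  riemann_mx *m (- block_mx 0 (invmx M) (invmx C) 0) = speed_mx *m riemann_mx.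
Proof.
have uC : C \in unitmx by rewrite -SS unitmx_mul uS.
have h1 : stress_inv *m invmx C = D *m amplitude_inv.
  by rewrite /stress_inv /amplitude_inv -SS invmxM // !mulmxA mulmxK.
have h2 : amplitude_inv *m invmx M = D *m stress_inv.
  have uSMS : S *m M *m S \in unitmx by rewrite !unitmx_mul uS uM.
  have : U *m invmx (S *m M *m S) = D *m D *m U by rewrite ThetaE !mulmxA UUT mul1mx.
  rewrite !invmxM ?unitmx_mul ?uS ?uM // => E.
  rewrite /stress_inv !mulmxA -E !mulmxA mulmxKV //.
rewrite /riemann_mx /speed_mx mulmxN !mulmx_block !mulmx0 !mul0mx !addr0 !add0r.
by rewrite h1 h2 mulNmx h1 !mulNmx !mulmxN opp_block_mx opprK.
Qed.

End Diagonalization.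

Section NormBounds.
Variable R : realType.

Lemma mulmx_entry_le m n (A : 'M[R]_(m, n)) (v : 'cV[R]_n) A0 v0 p :
  (forall j, `|A p j| <= A0) -> (forall j, `|v j 0| <= v0) ->
  `|(A *m v) p 0| <= n%:R * (A0 * v0).
Proof.
move=> hA hv; rewrite mxE (le_trans (ler_norm_sum _ _ _)) //.
have -> : n%:R * (A0 * v0) = \sum_(j < n) A0 * v0 by rewrite sumr_const card_ord mulr_natl.
by apply: ler_sum => j _; rewrite normrM ler_pM.
Qed.

Lemma sup_norm_on_ub (V : normedModType R) a b (f : R -> V) x :
  {within `[a, b], continuous f} -> a <= x <= b -> `|f x| <= sup_norm_on a b f.
Proof.
move=> cf xab; apply: ub_le_sup; last by exists x => //; rewrite /= in_itv.
have /compact_bounded[M [_ /(_ (M + 1))]] := continuous_compact cf (@segment_compact _ a b).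
rewrite ltrDl ltr01 => /(_ isT) fM; exists (M + 1) => _ [z zab <-].
by apply: fM; exists z.
Qed.

Lemma C1_norm_on_ub n a b (f : R -> 'cV[R]_n) x : a < b -> Ck_on 1 a b f ->
  a <= x <= b -> `|f x| <= C1_norm_on a b f /\ `|deriv_on a b f x| <= C1_norm_on a b f.
Proof.
move=> ab fC1 xab.
have cf : {within `[a, b], continuous f}.
  apply/within_cont_mxP => i j z zab.
  exact: (C1_cont (Ck_on1P ab fC1) zab).
have h1 := sup_norm_on_ub cf xab; have h2 := sup_norm_on_ub fC1.2 xab.
have := normr_ge0 (f x); have := normr_ge0 (deriv_on a b f x); rewrite /C1_norm_on.
by split; lra.
Qed.

Lemma C1_norm_rect_le n l T (y : R -> R -> 'cV[R]_n) B : 0 <= l -> 0 <= T ->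
  (forall x t, 0 <= x <= l -> 0 <= t <= T ->
     [/\ `|y x t| <= B, `|partial_x l y x t| <= B & `|partial_t T y x t| <= B]) ->
  C1_norm_rect l T y <= 3 * B.
Proof.
move=> l0 T0 yB.
have sup_le (h : R -> R -> 'cV[R]_n) : (forall x t, 0 <= x <= l -> 0 <= t <= T ->
    `|h x t| <= B) -> sup_norm_rect l T h <= B.
  move=> hB; apply: ge_sup.
    by exists `|h 0 0|; exists (0, 0) => //=; split; rewrite /= in_itv /= lexx.
  move=> z [[x t] [/= xl tT] <-]; apply: hB; first by move: xl; rewrite in_itv.
  by move: tT; rewrite in_itv.
have h1 := sup_le y (fun x t xl tT => let: And3 h _ _ := yB x t xl tT in h).
have h2 := sup_le _ (fun x t xl tT => let: And3 _ h _ := yB x t xl tT in h).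
have h3 := sup_le _ (fun x t xl tT => let: And3 _ _ h := yB x t xl tT in h).
rewrite (_ : 3 * B = B + B + B); last by ring.
exact: lerD (lerD h1 h2) h3.
Qed.

End NormBounds.

(** * Riemann coordinates of a network of beams *)

Section HatContinuity.
Variables (R : realType) (a b : R).
Implicit Types (x z : R).

Lemma hatD (u v : 'cV[R]_3) : hat (u + v) = hat u + hat v.
Proof.
apply/matrixP => -[[|[|[|//]]] hi] -[[|[|[|//]]] hj]; rewrite !mxE /= ?mxE; ring.
Qed.

Lemma hatZ (k : R) (u : 'cV[R]_3) : hat (k *: u) = k *: hat u.
Proof.
apply/matrixP => -[[|[|[|//]]] hi] -[[|[|[|//]]] hj]; rewrite !mxE /= ?mxE; ring.
Qed.

Lemma GmxD (u v : 'cV[R]_(6 + 6)) : Gmx (u + v) = Gmx u + Gmx v.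
Proof.
rewrite /Gmx !linearD /= !hatD !add_block_mx !addr0.
by congr block_mx; apply/esym; (apply: etrans; first exact: (@add_block_mx _ 3 3 3 3));
  rewrite ?addr0.
Qed.

Lemma GmxZ (k : R) (u : 'cV[R]_(6 + 6)) : Gmx (k *: u) = k *: Gmx u.
Proof.
rewrite /Gmx !linearZ /= !hatZ !scale_block_mx !scaler0.
by congr block_mx; apply/esym; (apply: etrans; first exact: (@scale_block_mx _ 3 3 3 3));
  rewrite ?scaler0.
Qed.

Lemma mx_cont_at_hat (u : R -> 'cV[R]_3) x : mx_cont_at a b u x ->
  mx_cont_at a b (fun z => hat (u z)) x.
Proof.
move=> cu i j.
have cN k : cont_at a b (fun z => - u z k 0) x by apply: cvgN; exact: cu.
case: i j => [[|[|[|//]]] hi] [[|[|[|//]]] hj];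
  under [X in cont_at _ _ X]eq_fun do rewrite mxE /=; try exact: cont_at_cst;
  by [exact: cN|exact: cu].
Qed.

Lemma mx_cont_at_vee (A : R -> 'M[R]_3) x : mx_cont_at a b A x ->
  mx_cont_at a b (fun z => vee (A z)) x.
Proof.
move=> cA i j; case: i => [[|[|[|//]]] hi];
  under [X in cont_at _ _ X]eq_fun do rewrite mxE /=; exact: cA.
Qed.

Lemma mx_cont_at_usub m1 m2 n (u : R -> 'M[R]_(m1 + m2, n)) x : mx_cont_at a b u x ->
  mx_cont_at a b (fun z => usubmx (u z)) x.
Proof. by move=> cu i j; under [X in cont_at _ _ X]eq_fun do rewrite mxE; exact: cu. Qed.

Lemma mx_cont_at_dsub m1 m2 n (u : R -> 'M[R]_(m1 + m2, n)) x : mx_cont_at a b u x ->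
  mx_cont_at a b (fun z => dsubmx (u z)) x.
Proof. by move=> cu i j; under [X in cont_at _ _ X]eq_fun do rewrite mxE; exact: cu. Qed.

Lemma mx_cont_at_Gmx (u : R -> 'cV[R]_(6 + 6)) x : mx_cont_at a b u x ->
  mx_cont_at a b (fun z => Gmx (u z)) x.
Proof.
move=> cu; have c0 m n : mx_cont_at a b (fun _ : R => 0 : 'M[R]_(m, n)) x.
  exact: mx_cont_at_cst.
have cv : mx_cont_at a b (fun z => usubmx (u z) : 'cV[R]_(3 + 3)) x.
  exact: (@mx_cont_at_usub 6 6).
have cz : mx_cont_at a b (fun z => dsubmx (u z) : 'cV[R]_(3 + 3)) x.
  exact: (@mx_cont_at_dsub 6 6).
have h1 := mx_cont_at_hat (mx_cont_at_usub cv).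
have h2 := mx_cont_at_hat (mx_cont_at_dsub cv).
have h3 := mx_cont_at_hat (mx_cont_at_usub cz).
have h4 := mx_cont_at_hat (mx_cont_at_dsub cz).
by apply: (@mx_cont_at_block _ _ _ 6 6 6 6) => //;
  apply: (@mx_cont_at_block _ _ _ 3 3 3 3).
Qed.

End HatContinuity.

(** * Riemann coordinates along a beam *)

Section Beam.
Variables (R : realType) (N P : nat) (G : network R N P).
Variables (Mass Flex : 'I_N -> R -> 'M[R]_6) (Rot : 'I_N -> R -> 'M[R]_3).
Variables (U D : 'I_N -> R -> 'M[R]_6).
Hypothesis hRot : forall i, Ck_on 2 0 (len G i) (Rot i) /\
  forall x, x \in `[0, len G i] -> SO3 (Rot i x).
Hypothesis hFlex : forall i, Ck_on 2 0 (len G i) (Flex i) /\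
  forall x, x \in `[0, len G i] -> posdefmx (Flex i x).
Hypothesis hMass : forall i, Ck_on 2 0 (len G i) (Mass i) /\
  forall x, x \in `[0, len G i] -> posdefmx (Mass i x).
Hypothesis hU : forall i, Ck_on 2 0 (len G i) (U i).
Hypothesis hD : forall i, Ck_on 2 0 (len G i) (D i).
Hypothesis hTheta : forall i, Theta_diag G Mass Flex i (U i) (D i).
Implicit Types (i : 'I_N) (x : R).

Local Notation in_beam i x := (0 <= x <= len G i).

Definition sqrt_flex i x := sqrtmx (Flex i x).

Lemma D_posdef i x : in_beam i x -> posdefmx (D i x).
Proof. by move=> xl; have [] := hTheta (i := i) (x := x); rewrite ?in_itv. Qed.

Lemma U_orth i x : in_beam i x -> (U i x)^T *m U i x = 1%:M.
Proof. by move=> xl; have [] := hTheta (i := i) (x := x); rewrite ?in_itv. Qed.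

Lemma ThetaP i x : in_beam i x -> invmx (sqrt_flex i x *m Mass i x *m sqrt_flex i x) =
  (U i x)^T *m (D i x *m D i x) *m U i x.
Proof. by move=> xl; have [] := hTheta (i := i) (x := x); rewrite ?in_itv. Qed.

Lemma D_unit i x : in_beam i x -> D i x \in unitmx.
Proof. by move=> /D_posdef/posdefmx_unit. Qed.

(* Were there no square root, [sqrtmx] would be 0 and so would be [Theta],
   which is invertible. *)
Lemma sqrt_flexP i x : in_beam i x ->
  posdefmx (sqrt_flex i x) /\ sqrt_flex i x *m sqrt_flex i x = Flex i x.
Proof.
move=> xl; rewrite /sqrt_flex /sqrtmx.
have [ex|noS] := pselect (exists S, [set S : 'M[R]_6 | posdefmx S /\ S *m S = Flex i x] S).
  exact: (xgetPex 0 ex).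
have S0 : sqrt_flex i x = 0.
  by apply: xgetPN => S SP; apply: noS; exists S.
have uU : U i x \in unitmx by have /mulmx1_unit[] := U_orth xl.
have uT : (U i x)^T *m (D i x *m D i x) *m U i x \in unitmx.
  by rewrite !unitmx_mul unitmx_tr uU D_unit.
move: uT; rewrite -ThetaP // S0 !mul0mx unitmx_inv unitmxE det0 //.
by rewrite unitr0.
Qed.

Lemma sqrt_flex_unit i x : in_beam i x -> sqrt_flex i x \in unitmx.
Proof. by move=> /sqrt_flexP[/posdefmx_unit]. Qed.

Lemma mass_unit i x : in_beam i x -> Mass i x \in unitmx.
Proof. by move=> xl; apply/posdefmx_unit/(hMass i).2; rewrite in_itv. Qed.

Lemma flex_unit i x : in_beam i x -> Flex i x \in unitmx.
Proof. by move=> xl; apply/posdefmx_unit/(hFlex i).2; rewrite in_itv. Qed.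

Definition Lmx i x : 'M[R]_(6 + 6) := riemann_mx (sqrt_flex i x) (U i x) (D i x).

Definition Wmx i x : 'M[R]_(6 + 6) := invmx (Lmx i x).

Definition Smx i x : 'M[R]_(6 + 6) := speed_mx (D i x).

Lemma Lmx_unit i x : in_beam i x -> Lmx i x \in unitmx.
Proof.
move=> xl; apply: riemann_mx_unit; first exact: sqrt_flex_unit.
  exact: U_orth.
exact: D_unit.
Qed.

Lemma Lmx_diag i x : in_beam i x -> Lmx i x *m Amx Mass Flex i x = Smx i x *m Lmx i x.
Proof.
move=> xl; have [_ SS] := sqrt_flexP xl.
apply: riemann_mx_diag => //; first exact: mass_unit.
- exact: sqrt_flex_unit.
- exact: U_orth.
- exact: ThetaP.
Qed.

Lemma Lmx_C1 i : exists dL, C1_entries 0 (len G i) (Lmx i) dL.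
Proof.
have l0 := len_gt0 G i.
have cC := Ck_on2P l0 (hFlex i).1.
have [dS cS] : exists dS, C1_entries 0 (len G i) (sqrt_flex i) dS.
  by apply: (sqrt_C1 cC) => x xl; have [] := sqrt_flexP xl.
have cU := Ck_on2P l0 (hU i); have cD := Ck_on2P l0 (hD i).
have cSV := C1_V (fun z => @sqrt_flex_unit i z) cS.
have cPi := C1_M cU cSV.
have cZi := C1_M (C1_M cD cU) cS.
(* The sign in the last block is written as a product with the constant matrix -1, so that the
   product rule covers it. *)
have cN : C1_entries 0 (len G i) (fun _ : R => - 1%:M : 'M[R]_6) (fun=> 0).
  split=> p q x xl; first by rewrite [X in deriv_in _ _ _ _ X]mxE; exact: deriv_in_cst.
  exact: cont_at_cst.
have := C1_block cPi cZi cPi (C1_M cN cZi).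
set dL := (X in C1_entries _ _ _ X) => cL; exists dL.
rewrite (_ : Lmx i = fun z => block_mx (U i z *m invmx (sqrt_flex i z))
  (D i z *m U i z *m sqrt_flex i z) (U i z *m invmx (sqrt_flex i z))
  (- 1%:M *m (D i z *m U i z *m sqrt_flex i z))) //.
by apply/funext => z; rewrite mulNmx mul1mx.
Qed.

Definition speed i (j : 'I_(6 + 6)) x : R := Smx i x j j.

Lemma Smx_mul i x m (X : 'M[R]_(6 + 6, m)) p q : in_beam i x ->
  (Smx i x *m X) p q = speed i p x * X p q.
Proof.
move=> xl; have dD : is_diag_mx (D i x).
  by have [] := hTheta (i := i) (x := x); rewrite ?in_itv.
have off r s : r != s -> D i x r s = 0 by move/is_diag_mxP : dD; apply.
rewrite mxE (bigD1 p) //= big1 ?addr0 // => r rp.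
have -> : Smx i x p r = 0; last by rewrite mul0r.
rewrite /Smx /speed_mx; case: (split_ordP p) rp => p' -> ; case: (split_ordP r) => r' ->.
- by rewrite block_mxEul mxE (inj_eq (@lshift_inj _ _)) eq_sym => /off ->; rewrite oppr0.
- by rewrite block_mxEur mxE.
- by rewrite block_mxEdl mxE.
- by rewrite block_mxEdr (inj_eq (@rshift_inj _ _)) eq_sym => /off ->.
Qed.

Lemma D_diag_gt0 i x j : in_beam i x -> 0 < D i x j j.
Proof.
move=> xl; have [_ pD] := D_posdef xl.
have e0 : delta_mx j 0 != 0 :> 'cV[R]_6.
  apply/eqP => /matrixP/(_ j 0); rewrite !mxE !eqxx => /eqP.
  by rewrite oner_eq0.
by have := pD _ e0; rewrite trmx_delta -rowE -colE !mxE.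
Qed.

(* Left-moving components come first. *)
Definition rightward (j : 'I_(6 + 6)) : bool := (6 <= j)%N.

Lemma speed_sign i j x : in_beam i x ->
  if rightward j then 0 < speed i j x else speed i j x < 0.
Proof.
move=> xl; rewrite /speed /Smx /speed_mx /rightward; case: (split_ordP j) => j' ->.
  by rewrite block_mxEul mxE /= leqNgt ltn_ord /= oppr_lt0 D_diag_gt0.
by rewrite block_mxEdr (leq_addr j' 6 : (6 <= rshift 6 j')%N) D_diag_gt0.
Qed.

Lemma speed_neq0 i j x : in_beam i x -> speed i j x != 0.
Proof.
move=> xl; have := speed_sign j xl.
by case: (rightward j) => h; [rewrite gt_eqF|rewrite lt_eqF].
Qed.

Lemma Smx_cont i x : in_beam i x -> mx_cont_at 0 (len G i) (Smx i) x.
Proof.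
move=> xl; have cD := Ck_on2P (len_gt0 G i) (hD i).
apply: mx_cont_at_block.
- by apply: mx_cont_atN; exact: C1_cont cD xl.
- exact: mx_cont_at_cst.
- exact: mx_cont_at_cst.
- exact: C1_cont cD xl.
Qed.

Lemma inv_mass_cont i x : in_beam i x ->
  mx_cont_at 0 (len G i) (fun z => invmx (Mass i z)) x.
Proof.
move=> xl; apply: mx_cont_atV => //; first by move=> z; exact: mass_unit.
exact: C1_cont (Ck_on2P (len_gt0 G i) (hMass i).1) xl.
Qed.

Lemma inv_flex_cont i x : in_beam i x ->
  mx_cont_at 0 (len G i) (fun z => invmx (Flex i z)) x.
Proof.
move=> xl; apply: mx_cont_atV => //; first by move=> z; exact: flex_unit.
exact: C1_cont (Ck_on2P (len_gt0 G i) (hFlex i).1) xl.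
Qed.

Lemma Bmx_cont i x : in_beam i x ->
  mx_cont_at 0 (len G i) (Bmx G Mass Flex Rot i) x.
Proof.
move=> xl; have cR := Ck_on2P (len_gt0 G i) (hRot i).1.
have cE : mx_cont_at 0 (len G i) (Emx G Rot i) x.
  have cc : mx_cont_at 0 (len G i) (fun z => hat (curvature G Rot i z)) x.
    apply/mx_cont_at_hat/mx_cont_at_vee/mx_cont_atM.
      exact/mx_cont_at_tr/(C1_cont cR).
    by move=> p q; exact: cR.2.
  by apply: (@mx_cont_at_block _ _ _ 3 3 3 3) => //; exact: mx_cont_at_cst.
have cM := inv_mass_cont xl; have cC := inv_flex_cont xl.
apply: mx_cont_at_block.
- exact: mx_cont_at_cst.
- by apply: mx_cont_atN; apply: mx_cont_atM.
- by apply: mx_cont_atM => //; exact: mx_cont_at_tr.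
- exact: mx_cont_at_cst.
Qed.

(* Polarisation of the quadratic map [gfun]. *)
Definition gbil i x (u v : 'cV[R]_(6 + 6)) : 'cV[R]_(6 + 6) :=
  - (block_mx (invmx (Mass i x)) 0 0 (invmx (Flex i x)) *m Gmx u
     *m block_mx (Mass i x) 0 0 (Flex i x) *m v).

Lemma gfunE i x u : gfun Mass Flex i x u = gbil i x u u.
Proof. by []. Qed.

Lemma gbil_cont i x (u v : R -> 'cV[R]_(6 + 6)) : in_beam i x ->
  mx_cont_at 0 (len G i) u x -> mx_cont_at 0 (len G i) v x ->
  mx_cont_at 0 (len G i) (fun z => gbil i z (u z) (v z)) x.
Proof.
move=> xl cu cv; have cM := inv_mass_cont xl; have cC := inv_flex_cont xl.
have cM' := C1_cont (Ck_on2P (len_gt0 G i) (hMass i).1) xl.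
have cC' := C1_cont (Ck_on2P (len_gt0 G i) (hFlex i).1) xl.
apply: mx_cont_atN; apply: mx_cont_atM => //; apply: mx_cont_atM; last first.
  by apply: mx_cont_at_block => //; exact: mx_cont_at_cst.
apply: mx_cont_atM; last exact: mx_cont_at_Gmx.
by apply: mx_cont_at_block => //; exact: mx_cont_at_cst.
Qed.

Lemma gbil_suml i x (r : 'cV[R]_(6 + 6)) (u : 'I_(6 + 6) -> 'cV[R]_(6 + 6)) v :
  gbil i x (\sum_p r p 0 *: u p) v = \sum_p r p 0 *: gbil i x (u p) v.
Proof.
have lin (k : R) u1 u2 : gbil i x (k *: u1 + u2) v = k *: gbil i x u1 v + gbil i x u2 v.
  rewrite /gbil GmxD GmxZ mulmxDr !mulmxDl -scalemxAr -!scalemxAl opprD.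
  by rewrite scalerN.
elim/big_rec2 : _ => [|p y1 y2 _ <-]; last by rewrite lin.
have := lin (-1) 0 0; rewrite scaleN1r oppr0 addr0 scaleN1r addNr; exact.
Qed.

Lemma gbil_sumr i x (r : 'cV[R]_(6 + 6)) u (v : 'I_(6 + 6) -> 'cV[R]_(6 + 6)) :
  gbil i x u (\sum_p r p 0 *: v p) = \sum_p r p 0 *: gbil i x u (v p).
Proof.
rewrite /gbil mulmx_sumr -sumrN; apply: eq_bigr => p _.
by rewrite -scalemxAr scalerN.
Qed.

Lemma mulmx_delta_sum (r : 'cV[R]_(6 + 6)) (X : 'M[R]_(6 + 6)) :
  X *m r = \sum_p r p 0 *: (X *m delta_mx p 0).
Proof.
rewrite {1}[r]matrix_sum_delta mulmx_sumr; apply: eq_bigr => p _.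
by rewrite big_ord1 -scalemxAr.
Qed.

Lemma gbil_sum i x (r : 'cV[R]_(6 + 6)) (X : 'M[R]_(6 + 6)) :
  gbil i x (X *m r) (X *m r) =
  \sum_p \sum_q (r p 0 * r q 0) *: gbil i x (X *m delta_mx p 0) (X *m delta_mx q 0).
Proof.
rewrite mulmx_delta_sum gbil_suml; apply: eq_bigr => p _.
rewrite gbil_sumr scaler_sumr; apply: eq_bigr => q _.
by rewrite scalerA.
Qed.

Section RiemannForm.
Variable dL : 'I_N -> R -> 'M[R]_(6 + 6).
Hypothesis Lmx_deriv : forall i, C1_entries 0 (len G i) (Lmx i) (dL i).
Local Notation AA := (Amx Mass Flex).
Local Notation BB := (Bmx G Mass Flex Rot).

(** Since [r_x = L y_x + L' y], the equation for [r = L y] gains the zero-order term [S L' y]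
    besides [- L B y]. *)
Definition riemann_lin i x : 'M[R]_(6 + 6) :=
  (Smx i x *m dL i x - Lmx i x *m BB i x) *m Wmx i x.

Definition riemann_quad i x p q : 'cV[R]_(6 + 6) :=
  Lmx i x *m gbil i x (Wmx i x *m delta_mx p 0) (Wmx i x *m delta_mx q 0).

Definition riemann_rhs i x (r : 'cV[R]_(6 + 6)) : 'cV[R]_(6 + 6) :=
  riemann_lin i x *m r + Lmx i x *m gbil i x (Wmx i x *m r) (Wmx i x *m r).

Lemma riemann_rhsE i x r j : riemann_rhs i x r j 0 =
  \sum_p riemann_lin i x j p * r p 0 +
  \sum_p \sum_q riemann_quad i x p q j 0 * (r p 0 * r q 0).
Proof.
rewrite mxE [in X in X + _]mxE; congr (_ + _).
rewrite gbil_sum mulmx_sumr summxE; apply: eq_bigr => p _.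
rewrite mulmx_sumr summxE; apply: eq_bigr => q _.
by rewrite -scalemxAr mxE mulrC.
Qed.

(** Comes from moving [L] across [A] by [Lmx_diag]. At the initial data it expresses [L y^1] by the
    Riemann data and their derivative, which carries first-order compatibility over to the transport
    problem; it also yields [riemann_pdeP]. *)
Lemma riemann_rhs_initial i x (y yx : 'cV[R]_(6 + 6)) : in_beam i x ->
  Lmx i x *m (- (AA i x *m yx) - BB i x *m y + gfun Mass Flex i x y) =
  riemann_rhs i x (Lmx i x *m y) - Smx i x *m (Lmx i x *m yx + dL i x *m y).
Proof.
move=> xl; have uL := Lmx_unit xl.
rewrite /riemann_rhs /riemann_lin -(mulmxA _ (Wmx i x)) /Wmx mulKmx // gfunE.
move: (gbil i x y y) => g.
rewrite (mulmxDr _ _ g) mulmxBr mulmxN (mulmxA _ (AA i x)) Lmx_diag // -mulmxA.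
rewrite mulmxBl -!mulmxA ?mulmxDr.
move: (Smx i x *m (Lmx i x *m yx)) (Smx i x *m (dL i x *m y)) => p s.
move: (Lmx i x *m (BB i x *m y)) (Lmx i x *m g) => q r.
by apply/matrixP => k l; rewrite !mxE; ring.
Qed.

Lemma riemann_pdeP i x (y yt yx : 'cV[R]_(6 + 6)) : in_beam i x ->
  yt + AA i x *m yx + BB i x *m y = gfun Mass Flex i x y <->
  Lmx i x *m yt + Smx i x *m (Lmx i x *m yx + dL i x *m y) =
    riemann_rhs i x (Lmx i x *m y).
Proof.
move=> xl; have uL := Lmx_unit xl.
have := riemann_rhs_initial y yx xl.
move: (Smx i x *m _) (riemann_rhs i x _) (gfun Mass Flex i x y) => s r g.
move: (AA i x *m yx) (BB i x *m y) => p q E.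
have E' : Lmx i x *m (yt - (- p - q + g)) = Lmx i x *m yt + s - r.
  by rewrite mulmxBr E opprB addrA.
split=> [h|h].
  apply/eqP; rewrite -subr_eq0 -E' -h; apply/eqP.
  rewrite -[RHS](mulmx0 _ (Lmx i x)); congr (_ *m _).
  by apply/matrixP => k l; rewrite !mxE; ring.
have : Lmx i x *m (yt - (- p - q + g)) = 0 by rewrite E' h subrr.
move=> h0; have : yt - (- p - q + g) = 0.
  by rewrite -[LHS](mulKmx uL) h0 mulmx0.
move/eqP; rewrite subr_eq0 => /eqP ->.
by apply/matrixP => k l; rewrite !mxE; ring.
Qed.

Lemma Wmx_deriv i : C1_entries 0 (len G i) (Wmx i)
  (fun x => - (Wmx i x *m dL i x *m Wmx i x)).
Proof. by apply: C1_V => // z; exact: Lmx_unit. Qed.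

(* The left-hand side of [riemann_pdeP] when [y = W r]; recall [W' = - W L' W]. *)
Lemma Wmx_deriv_mul i x (r rx : 'cV[R]_(6 + 6)) : in_beam i x ->
  Lmx i x *m (- (Wmx i x *m dL i x *m Wmx i x) *m r + Wmx i x *m rx) +
  dL i x *m (Wmx i x *m r) = rx.
Proof.
move=> xl; have uL := Lmx_unit xl.
rewrite mulmxDr mulNmx mulmxN -!mulmxA /Wmx !(mulKVmx uL).
by rewrite addrAC addNr add0r.
Qed.

Lemma riemann_lin_cont i x : in_beam i x ->
  mx_cont_at 0 (len G i) (riemann_lin i) x.
Proof.
move=> xl; apply: mx_cont_atM; last exact: C1_cont (Wmx_deriv i) xl.
apply: mx_cont_atD; first apply: mx_cont_atM.
- exact: Smx_cont.
- by move=> p q; exact: (Lmx_deriv i).2.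
- apply: mx_cont_atN; apply: mx_cont_atM; last exact: Bmx_cont.
  exact: C1_cont (Lmx_deriv i) xl.
Qed.

Lemma riemann_quad_cont i x p q : in_beam i x ->
  mx_cont_at 0 (len G i) (fun z => riemann_quad i z p q) x.
Proof.
move=> xl; have cW := C1_cont (Wmx_deriv i) xl.
apply: mx_cont_atM; first exact: C1_cont (Lmx_deriv i) xl.
by apply: gbil_cont => //; apply: mx_cont_atM => //; exact: mx_cont_at_cst.
Qed.

End RiemannForm.

(** * Nodal conditions as reflection of waves *)

Section Nodes.
Local Notation YY := ('I_N -> R -> 'cV[R]_(6 + 6)).
Implicit Types (n : 'I_P) (y : YY) (q : 'I_P -> 'cV[R]_6).

Definition node_rot i n := Rbar Rot i (end_of G i n).
Definition node_amp i n :=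
  amplitude_mx (sqrt_flex i (end_of G i n)) (U i (end_of G i n)).
Definition node_amp_inv i n :=
  amplitude_inv (sqrt_flex i (end_of G i n)) (U i (end_of G i n)).
Definition node_stress i n :=
  stress_mx (sqrt_flex i (end_of G i n)) (U i (end_of G i n)) (D i (end_of G i n)).
Definition node_stress_inv i n :=
  stress_inv (sqrt_flex i (end_of G i n)) (U i (end_of G i n)) (D i (end_of G i n)).

Definition entering y i n : 'cV[R]_6 :=
  let r := Lmx i (end_of G i n) *m y i (end_of G i n) in
  if src G i == n then dsubmx r else usubmx r.

Definition leaving y i n : 'cV[R]_6 :=
  let r := Lmx i (end_of G i n) *m y i (end_of G i n) in
  if src G i == n then usubmx r else dsubmx r.

Definition node_impedance n : 'M[R]_6 := \sum_(i in edges G n)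
  node_rot i n *m node_stress i n *m node_amp_inv i n *m (node_rot i n)^T.

(* Entering waves are [reflection] times leaving waves plus [control] times
   the nodal datum. *)
Definition reflection n i j : 'M[R]_6 :=
  if n \in multiple_nodes G then
    (if j \in edges G n then 2 *: (node_amp_inv i n *m (node_rot i n)^T *m
       invmx (node_impedance n) *m (node_rot j n *m node_stress j n)) else 0)
    - (if j == i then 1%:M else 0)
  else if n \in dirichlet_nodes G then - (if j == i then 1%:M else 0)
  else if j == i then 1%:M else 0.

Definition control n i : 'M[R]_6 :=
  if n \in multiple_nodes G then
    2 *: (node_amp_inv i n *m (node_rot i n)^T *m invmx (node_impedance n))
  else if n \in dirichlet_nodes G then 2 *: node_amp_inv i n
  else 2 *: node_stress_inv i n.

Lemma end_in_beam i n : in_beam i (end_of G i n).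
Proof.
have l0 := len_gt0 G i; rewrite /end_of.
by case: (src G i == n); rewrite lexx ltW.
Qed.

Lemma node_rotT i n : (node_rot i n)^T *m node_rot i n = 1%:M.
Proof.
have [RT _] : SO3 (Rot i (end_of G i n)).
  by apply: (hRot i).2; rewrite in_itv /=; exact: end_in_beam.
rewrite /node_rot /Rbar; set Q := Rot i _ in RT *.
rewrite (@tr_block_mx _ 3 3 3 3) !trmx0.
apply: etrans; first exact: (@mulmx_block _ 3 3 3 3 3 3).
by rewrite !mulmx0 !mul0mx !addr0 add0r RT -(@scalar_mx_block _ 3 3).
Qed.

Lemma node_ampK i n : node_amp_inv i n *m node_amp i n = 1%:M.
Proof. exact: amplitude_invK (sqrt_flex_unit (end_in_beam i n)) (U_orth (end_in_beam i n)). Qed.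

Lemma node_stressK i n : node_stress_inv i n *m node_stress i n = 1%:M.
Proof.
have xl := end_in_beam i n.
exact: stress_invK (sqrt_flex_unit xl) (U_orth xl) (D_unit xl).
Qed.

(** Each summand equals [B^T D^-1 B] with [B = U S^-1 Rb^T] invertible, hence is positive definite,
    and every node has an incident beam. *)
Lemma node_impedance_unit n : node_impedance n \in unitmx.
Proof.
have [i0 i0E] := incident_edge G n.
apply: posdefmx_unit; apply: (posdefmx_sum i0E) => i iE.
have xl := end_in_beam i n.
set B := node_amp_inv i n *m (node_rot i n)^T.
have uB : B \in unitmx.
  rewrite unitmx_mul; apply/andP; split.
    by have [] := mulmx1_unit (node_ampK i n).
  by have [] := mulmx1_unit (node_rotT i n).
have [[sS _] _] := sqrt_flexP xl.
have -> : node_rot i n *m node_stress i n *m node_amp_inv i n *m (node_rot i n)^T =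
   B^T *m invmx (D i (end_of G i n)) *m B.
  rewrite /B !trmx_mul trmxK /node_stress /stress_mx /node_amp_inv /amplitude_inv.
  by rewrite ?trmx_mul ?trmxK trmx_inv sS !mulmxA.
by apply: posdefmx_congr => //; exact/posdefmx_inv/D_posdef.
Qed.

Lemma first_edge_in n : first_edge G n \in edges G n.
Proof.
rewrite /first_edge; case: arg_minnP => //.
by rewrite /edges; exact: xchooseP.
Qed.

Section OneNode.
Variables (y : YY) (n : 'I_P) (qn : 'cV[R]_6).
Let v i := usubmx (y i (end_of G i n)).
Let z i := dsubmx (y i (end_of G i n)).
Let al i := node_amp_inv i n *m v i.
Let be i := end_sign G i n *: (node_stress_inv i n *m z i).

Lemma Lmx_split i x (u : 'cV[R]_(6 + 6)) :
  Lmx i x *m u = col_mx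
   (amplitude_inv (sqrt_flex i x) (U i x) *m usubmx u +
    stress_inv (sqrt_flex i x) (U i x) (D i x) *m dsubmx u)
   (amplitude_inv (sqrt_flex i x) (U i x) *m usubmx u -
    stress_inv (sqrt_flex i x) (U i x) (D i x) *m dsubmx u).
Proof.
by rewrite -{1}[u]vsubmxK /Lmx /riemann_mx mul_block_col mulNmx.
Qed.

(** [end_sign] is built into [be], which compensates for the exchange of the two Riemann halves at
    the end 0: the algebra then treats both ends of a beam alike. *)
Lemma enteringE i : entering y i n = al i + be i.
Proof.
rewrite /entering Lmx_split /be /end_sign; case: (src G i == n).
  by rewrite col_mxKd scaleN1r.
by rewrite col_mxKu scale1r.
Qed.

Lemma leavingE i : leaving y i n = al i - be i.
Proof.
rewrite /leaving Lmx_split /be /end_sign; case: (src G i == n).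
  by rewrite col_mxKu scaleN1r opprK.
by rewrite col_mxKd scale1r.
Qed.

Lemma amplitudeE i : v i = node_amp i n *m al i.
Proof. by rewrite /al mulmxA (mulmx1C (node_ampK i n)) mul1mx. Qed.

Lemma stressE i : end_sign G i n *: z i = node_stress i n *m be i.
Proof. by rewrite /be -scalemxAr mulmxA (mulmx1C (node_stressK i n)) mul1mx. Qed.

Let reflection_sum i : \sum_j (if j == i then 1%:M else 0) *m leaving y j n = leaving y i n.
Proof.
rewrite (bigD1 i) //= eqxx mul1mx big1 ?addr0 // => j /negPf ->.
by rewrite mul0mx.
Qed.

Lemma multiple_conditionP : n \in multiple_nodes G ->
  ((forall i j, i \in edges G n -> j \in edges G n ->
     node_rot i n *m v i = node_rot j n *m v j) /\
   \sum_(i in edges G n) end_sign G i n *: (node_rot i n *m z i) = qn) <->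
  forall i, i \in edges G n ->
    entering y i n = \sum_j reflection n i j *m leaving y j n + control n i *m qn.
Proof.
move=> nm; have [i0 i0E] := incident_edge G n.
have iff := multiple_nodeP (fun i _ => node_rotT i n) (fun i _ => node_ampK i n)
  i0E (node_impedance_unit n) al be qn.
have E1 : (forall i, i \in edges G n ->
    entering y i n = \sum_j reflection n i j *m leaving y j n + control n i *m qn) <->
  forall i, i \in edges G n -> al i + be i =
    2 *: (node_amp_inv i n *m (node_rot i n)^T *m invmx (node_impedance n) *m
      (qn + \sum_(j in edges G n) node_rot j n *m node_stress j n *m (al j - be j)))
      - (al i - be i).
  have E2 i : \sum_j reflection n i j *m leaving y j n + control n i *m qn =
    2 *: (node_amp_inv i n *m (node_rot i n)^T *m invmx (node_impedance n) *m
      (qn + \sum_(j in edges G n) node_rot j n *m node_stress j n *m (al j - be j)))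
      - (al i - be i).
    set A := node_amp_inv i n *m _ *m _.
    have -> : control n i *m qn = 2 *: (A *m qn) by rewrite /control nm [RHS]scalemxAl.
    have -> : \sum_j reflection n i j *m leaving y j n = 2 *: (A *m
        \sum_(j in edges G n) node_rot j n *m node_stress j n *m (al j - be j)) -
        (al i - be i).
      rewrite -leavingE -[in RHS]reflection_sum.
      rewrite mulmx_sumr scaler_sumr [X in X - _]big_mkcond -sumrB /=.
      apply: eq_bigr => j _; rewrite /reflection nm mulmxBl; congr (_ - _).
      case: ifP => _; last by rewrite mul0mx.
      by rewrite -scalemxAl !mulmxA leavingE.
    by rewrite mulmxDr scalerDr addrC addrA.
  by split=> h i iE; have := h i iE; rewrite enteringE E2.
rewrite E1 -iff; split=> -[c1 c2]; split.
- by move=> i j iE jE; rewrite -!amplitudeE; exact: c1.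
- rewrite -c2; apply: eq_bigr => i _; rewrite -stressE scalemxAr //.
- by move=> i j iE jE; rewrite !amplitudeE; exact: c1.
- by rewrite -c2; apply: eq_bigr => i _; rewrite -stressE scalemxAr.
Qed.

(** The amplitude [al] is prescribed, and [al + be = 2 al - (al - be)]: reflection with sign -1. *)
Lemma dirichlet_conditionP i : n \in dirichlet_nodes G -> n \notin multiple_nodes G ->
  v i = qn <->
  entering y i n = \sum_j reflection n i j *m leaving y j n + control n i *m qn.
Proof.
move=> nd nm; rewrite /control /reflection (negPf nm) nd.
under eq_bigr do rewrite mulNmx.
rewrite sumrN reflection_sum enteringE leavingE (addrC (- _)) -scalemxAl add_sub_eq2.
split=> [<-|E]; first by [].
by rewrite amplitudeE E mulmxA (mulmx1C (node_ampK i n)) mul1mx.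
Qed.

(** The stress [be] is prescribed, and [al + be = (al - be) + 2 be]: reflection with sign +1. *)
Lemma neumann_conditionP i : n \notin dirichlet_nodes G -> n \notin multiple_nodes G ->
  end_sign G i n *: z i = qn <->
  entering y i n = \sum_j reflection n i j *m leaving y j n + control n i *m qn.
Proof.
move=> nd nm; rewrite /control /reflection (negPf nm) (negPf nd).
rewrite reflection_sum enteringE leavingE -scalemxAl.
have -> : al i + be i = al i - be i + 2 *: (node_stress_inv i n *m qn) <->
    be i = node_stress_inv i n *m qn.
  split=> [E|->]; last by rewrite scaler_nat mulr2n addrA subrK.
  have n2 : (2 : R) != 0 by rewrite pnatr_eq0.
  apply: (scalerI n2); apply: (addrI (al i - be i)).
  by rewrite -E scaler_nat mulr2n addrA subrK.
split=> [<-|E]; first by rewrite /be -scalemxAr.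
by rewrite stressE E mulmxA (mulmx1C (node_stressK i n)) mul1mx.
Qed.

End OneNode.

Lemma simple_edge n i : n \notin multiple_nodes G -> i \in edges G n -> i = first_edge G n.
Proof.
rewrite inE -ltnNge => c2 iE; have fE := first_edge_in n.
apply/eqP/negPn/negP => nif; have : (#|[set i; first_edge G n]%SET| <= #|edges G n|)%N.
  by apply: subset_leq_card; apply/fintype.subsetP => j; rewrite in_set2 => /orP[]/eqP ->.
by rewrite cards2 nif leqNgt c2.
Qed.

(** One reflection law for the three kinds of nodes. As [nodal_compat] takes any family of states,
    it serves for the solution at each time and for both orders of compatibility. *)
Lemma nodal_compatP y q : nodal_compat G Rot y q <->
  forall n i, i \in edges G n ->
    entering y i n = \sum_j reflection n i j *m leaving y j n + control n i *m q n.
Proof.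
have simple n : (n \in simple_nodes G) = (n \notin multiple_nodes G).
  have [i iE] := incident_edge G n.
  have : (0 < #|edges G n|)%N by apply/card_gt0P; exists i.
  by rewrite !inE; case: #|_| => [|[|k]].
have dir n : n \in dirichlet_nodes G -> n \notin multiple_nodes G.
  by move=> nd; rewrite -simple inE /edges; apply/eqP/dirichlet_simple.
split=> [[c1 c2 c3 c4] n i iE|h].
  case: (boolP (n \in multiple_nodes G)) => nm.
    by apply: (multiple_conditionP y (q n) nm).1 i iE; split; [exact: c1|exact: c2].
  have ie := simple_edge nm iE.
  case: (boolP (n \in dirichlet_nodes G)) => nd.
    by apply/dirichlet_conditionP => //; rewrite ie; exact: c4.
  apply/neumann_conditionP => //; rewrite ie; apply: c3.
  by rewrite inE nd simple nm.
split=> [n nm|n nm|n|n nd].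
- exact: ((multiple_conditionP y (q n) nm).2 (h n)).1.
- exact: ((multiple_conditionP y (q n) nm).2 (h n)).2.
- rewrite inE simple => /andP[nd nm] j.
  by apply/neumann_conditionP => //; apply: h; exact: first_edge_in.
- have nm := dir n nd; move=> j.
  by apply/dirichlet_conditionP => //; apply: h; exact: first_edge_in.
Qed.

Definition comp6 (j : 'I_(6 + 6)) : 'I_6 :=
  match fintype.split j with inl j' => j' | inr j' => j' end.

Implicit Types (k l : 'I_N * 'I_(6 + 6)).
Definition entry_node k := if rightward k.2 then src G k.1 else tgt G k.1.
Definition exit_node k := if rightward k.2 then tgt G k.1 else src G k.1.
Definition entry_pos k : R := if rightward k.2 then 0 else len G k.1.
Definition exit_pos k : R := if rightward k.2 then len G k.1 else 0.

Definition kappa k l : R :=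
  if exit_node l == entry_node k then
    reflection (entry_node k) k.1 l.1 (comp6 k.2) (comp6 l.2)
  else 0.

Lemma rightward_lshift (j : 'I_6) : rightward (lshift 6 j) = false.
Proof. by rewrite /rightward /= leqNgt ltn_ord. Qed.

Lemma rightward_rshift (j : 'I_6) : rightward (rshift 6 j) = true.
Proof. exact: (leq_addr j 6). Qed.

Lemma comp6_lshift (j : 'I_6) : comp6 (lshift 6 j) = j.
Proof. by rewrite /comp6 (unsplitK (inl j)). Qed.

Lemma comp6_rshift (j : 'I_6) : comp6 (rshift 6 j) = j.
Proof. by rewrite /comp6 (unsplitK (inr j)). Qed.

Lemma entry_node_edge k : k.1 \in edges G (entry_node k).
Proof. by rewrite !inE /entry_node; case: (rightward _); rewrite eqxx ?orbT. Qed.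

Lemma entering_entry y k :
  entering y k.1 (entry_node k) (comp6 k.2) 0 =
  (Lmx k.1 (entry_pos k) *m y k.1 (entry_pos k)) k.2 0.
Proof.
case: k => i j; rewrite /entering /entry_pos /entry_node /end_of /=.
case: (split_ordP j) => j' ->.
  by rewrite rightward_lshift (negPf (src_neq_tgt G i)) comp6_lshift mxE.
by rewrite rightward_rshift eqxx comp6_rshift mxE.
Qed.

Lemma kappa_sum y k :
  \sum_l kappa k l * (Lmx l.1 (exit_pos l) *m y l.1 (exit_pos l)) l.2 0 =
  (\sum_j reflection (entry_node k) k.1 j *m leaving y j (entry_node k)) (comp6 k.2) 0.
Proof.
set n := entry_node k.
rewrite -(pair_bigA _ (fun i j => kappa k (i, j) *
  (Lmx i (exit_pos (i, j)) *m y i (exit_pos (i, j))) j 0)) /= summxE.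
apply: eq_bigr => i _; rewrite big_split_ord /= [RHS]mxE.
have L j' : kappa k (i, lshift 6 j') *
    (Lmx i (exit_pos (i, lshift 6 j')) *m y i (exit_pos (i, lshift 6 j'))) (lshift 6 j') 0 =
    (if src G i == n then reflection n k.1 i (comp6 k.2) j' * leaving y i n j' 0 else 0).
  rewrite /kappa /exit_node /exit_pos /= rightward_lshift -/n comp6_lshift.
  case: (boolP (src G i == n)) => sn; last by rewrite mul0r.
  by rewrite /leaving /end_of sn [usubmx _ _ _]mxE.
have Rr j' : kappa k (i, rshift 6 j') *
    (Lmx i (exit_pos (i, rshift 6 j')) *m y i (exit_pos (i, rshift 6 j'))) (rshift 6 j') 0 =
    (if tgt G i == n then reflection n k.1 i (comp6 k.2) j' * leaving y i n j' 0 else 0).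
  rewrite /kappa /exit_node /exit_pos /= ?rightward_rshift -/n comp6_rshift.
  case: (boolP (tgt G i == n)) => tn; last by rewrite mul0r.
  have sn : (src G i == n) = false.
    by apply/negP => /eqP sn; have := src_neq_tgt G i; rewrite sn (eqP tn) eqxx.
  by rewrite /leaving /end_of sn [dsubmx _ _ _]mxE.
under eq_bigr do rewrite L; under [X in _ + X]eq_bigr do rewrite Rr.
case: (boolP (src G i == n)) => sn.
  have tn : (tgt G i == n) = false.
    by apply/negP => /eqP tn; have := src_neq_tgt G i; rewrite tn (eqP sn) eqxx.
  by rewrite tn big1_eq addr0.
case: (boolP (tgt G i == n)) => tn; first by rewrite big1_eq add0r.
(* For a beam away from the node, [leaving] reads the default [len] of [end_of]; this is harmless
   because the beam is neither incident nor equal to [k.1], so its reflection coefficient is 0. *)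
rewrite !big1_eq addr0 big1 // => j' _.
have iE : i \notin edges G n by rewrite !inE negb_or sn.
have ik : (i == k.1) = false.
  by apply/negP => /eqP ik; move: iE; rewrite ik entry_node_edge.
rewrite /reflection (negPf iE) ik oppr0 addr0.
by case: ifP => _; last case: ifP => _; rewrite mxE mul0r.
Qed.

Lemma nodal_compat_riemannP y q : nodal_compat G Rot y q <->
  forall k, (Lmx k.1 (entry_pos k) *m y k.1 (entry_pos k)) k.2 0 =
    \sum_l kappa k l * (Lmx l.1 (exit_pos l) *m y l.1 (exit_pos l)) l.2 0 +
    (control (entry_node k) k.1 *m q (entry_node k)) (comp6 k.2) 0.
Proof.
rewrite nodal_compatP; split=> [h k|h n i iE].
  by rewrite kappa_sum -entering_entry (h _ _ (entry_node_edge k)) mxE.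
apply/colP => j.
pose k : 'I_N * 'I_(6 + 6) := (i, if src G i == n then rshift 6 j else lshift 6 j).
have kn : entry_node k = n.
  rewrite /entry_node /k /=; move: iE; rewrite !inE.
  case: (boolP (src G i == n)) => [/eqP sn _|_ /= /eqP tn].
    by rewrite ?rightward_rshift.
  by rewrite rightward_lshift.
have kj : comp6 k.2 = j.
  by rewrite /k /=; case: (src G i == n); rewrite ?comp6_rshift ?comp6_lshift.
have := h k; rewrite kappa_sum -entering_entry kn kj /= => ->.
by rewrite [RHS]mxE.
Qed.

End Nodes.

(** * The network as a transport problem in travel time *)

Section Transport.
Local Notation K := ('I_N * 'I_(6 + 6))%type.
Variable dL : 'I_N -> R -> 'M[R]_(6 + 6).
Hypothesis Lmx_deriv : forall i, C1_entries 0 (len G i) (Lmx i) (dL i).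
Variables (Len : K -> R) (phi chi : K -> R -> R).
Hypothesis travel : forall k, travel_coordinate (len G k.1) (speed k.1 k.2)
  (rightward k.2) (Len k) (phi k) (chi k).
Implicit Types (k l m : K) (xi t s : R).
Local Notation rlin := (riemann_lin dL).

Lemma Len_gt0 k : 0 < Len k. Proof. by have [] := travel k. Qed.

Definition pos k xi : R := chi k (clamp 0 (Len k) xi).

Lemma chi_in_beam k xi : 0 <= xi <= Len k -> in_beam k.1 (chi k xi).
Proof. by have [_ _ h _ _] := travel k; case/h. Qed.

Lemma chi_deriv k xi : 0 <= xi <= Len k ->
  deriv_in 0 (Len k) (chi k) xi (speed k.1 k.2 (chi k xi)).
Proof. by have [_ _ h _ _] := travel k; case/h. Qed.

Lemma phiP k x : in_beam k.1 x -> 0 <= phi k x <= Len k /\ chi k (phi k x) = x.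
Proof. by have [_ h _ _ _] := travel k; case/h. Qed.

Lemma phi_deriv k x : in_beam k.1 x ->
  deriv_in 0 (len G k.1) (phi k) x (speed k.1 k.2 x)^-1.
Proof. by have [_ h _ _ _] := travel k; case/h. Qed.

Lemma chi_entry k : chi k 0 = entry_pos k.
Proof. by have [_ _ _ -> _] := travel k. Qed.

Lemma chi_exit k : chi k (Len k) = exit_pos k.
Proof. by have [_ _ _ _ ->] := travel k. Qed.

Lemma phi_chi k xi : 0 <= xi <= Len k -> phi k (chi k xi) = xi.
Proof. by have [_ _ h _ _] := travel k; case/h. Qed.

(** The differential equation is imposed in the open beam, so interior travel times have to stay off
    the ends. *)
Lemma chi_interior k xi : 0 < xi < Len k -> 0 < chi k xi < len G k.1.
Proof.
move=> /andP[xi0 xiL].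
have xiI : 0 <= xi <= Len k by rewrite !ltW.
have L0 := ltW (Len_gt0 k).
have n0 : chi k xi != chi k 0.
  apply/eqP => /(congr1 (phi k)); rewrite !phi_chi ?lexx // => xiE.
  by rewrite xiE ltxx in xi0.
have nL : chi k xi != chi k (Len k).
  apply/eqP => /(congr1 (phi k)); rewrite !phi_chi ?lexx ?L0 // => xiE.
  by rewrite xiE ltxx in xiL.
have /andP[x0 xl] := chi_in_beam xiI.
move: n0 nL; rewrite chi_entry chi_exit /entry_pos /exit_pos !lt_def x0 xl.
by case: (rightward k.2) => n0 nL; rewrite !andbT ?n0 ?nL eq_sym ?n0 ?nL.
Qed.

Lemma pos_in_beam k xi : in_beam k.1 (pos k xi).
Proof. exact: chi_in_beam (clamp_itv _ (ltW (Len_gt0 k))). Qed.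

Lemma posE k xi : 0 <= xi <= Len k -> pos k xi = chi k xi.
Proof. by move=> xiL; rewrite /pos clamp_id. Qed.

Lemma pos_buc k (f : R -> R) : (forall x, in_beam k.1 x -> cont_at 0 (len G k.1) f x) ->
  buc (fun xi _ => f (pos k xi)).
Proof.
move=> cf; apply: (within_buc (f := fun xi => f (chi k xi)) (Len_gt0 k)).
apply/within_contP => xi xiL.
apply: (cont_at_comp (a' := 0) (b' := len G k.1)).
- by move=> z; exact: chi_in_beam.
- exact: deriv_in_cont (chi_deriv xiL).
- exact/cf/chi_in_beam.
Qed.

(** The travel time of component [l] at the point that component [k] reaches at [xi]. Across
    different beams 0 is a default, harmless since [acoef] and [ccoef] vanish there. *)
Definition theta k l xi : R := if k.1 == l.1 then phi l (pos k xi) else 0.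

Definition acoef k l xi : R :=
  if k.1 == l.1 then rlin k.1 (pos k xi) k.2 l.2 else 0.

Definition ccoef k l m xi : R :=
  if (k.1 == l.1) && (k.1 == m.1) then riemann_quad k.1 (pos k xi) l.2 m.2 k.2 0 else 0.

Lemma theta_itv k l xi : 0 <= theta k l xi <= Len l.
Proof.
rewrite /theta; case: eqP => [kl|_]; last by rewrite lexx ltW // Len_gt0.
by have [] := @phiP l (pos k xi); rewrite -?kl //; exact: pos_in_beam.
Qed.

Lemma theta_ucont k l : ucont2 (fun xi _ => theta k l xi).
Proof.
rewrite /theta; case: eqP => [kl|_]; last exact: ucont2_cst.
have [] // := @pos_buc k (phi l).
by move=> x xl; rewrite kl in xl *; exact: deriv_in_cont (phi_deriv xl).
Qed.

Lemma acoef_buc k l : buc (fun xi _ => acoef k l xi).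
Proof.
rewrite /acoef; case: eqP => [kl|_]; last exact: buc_cst.
apply: (@pos_buc k (fun x => rlin k.1 x k.2 l.2)) => x xl.
exact: (riemann_lin_cont Lmx_deriv).
Qed.

Lemma ccoef_buc k l m : buc (fun xi _ => ccoef k l m xi).
Proof.
rewrite /ccoef; case: (_ && _); last exact: buc_cst.
apply: (@pos_buc k (fun x => riemann_quad k.1 x l.2 m.2 k.2 0)) => x xl.
exact: (riemann_quad_cont Lmx_deriv).
Qed.

Lemma same_beam_sum (i : 'I_N) (F : 'I_(6 + 6) -> R) (u : K -> R) :
  \sum_(l : K) (if i == l.1 then F l.2 else 0) * u l = \sum_j F j * u (i, j).
Proof.
rewrite (eq_bigr (fun l => (if i == l.1 then F l.2 else 0) * u (l.1, l.2))); last first.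
  by move=> [].
rewrite -(pair_bigA _ (fun i' j => (if i == i' then F j else 0) * u (i', j))) /=.
rewrite (bigD1 i) //= [X in _ + X]big1 ?addr0.
  by apply: eq_bigr => j _; rewrite eqxx.
move=> i' ii'; rewrite big1 // => j _.
by rewrite eq_sym (negPf ii') mul0r.
Qed.

Lemma source_riemann k xi (u : K -> R) :
  source acoef ccoef k xi u =
  riemann_rhs dL k.1 (pos k xi) (\col_j u (k.1, j)) k.2 0.
Proof.
rewrite riemann_rhsE /source; congr (_ + _).
  rewrite /acoef same_beam_sum; apply: eq_bigr => j _.
  by rewrite mxE.
rewrite -(pair_bigA _ (fun l m => ccoef k l m xi * (u l * u m))) /=.
transitivity (\sum_(l : K) (if k.1 == l.1 then
   \sum_q riemann_quad k.1 (pos k xi) l.2 q k.2 0 * u (k.1, q) else 0) * u l).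
  apply: eq_bigr => l _; rewrite /ccoef; case: (k.1 == l.1) => /=; last first.
    by rewrite mul0r big1 // => m _; rewrite mul0r.
  rewrite -(same_beam_sum k.1 (fun q => riemann_quad k.1 (pos k xi) l.2 q k.2 0)).
  by rewrite mulr_suml; apply: eq_bigr => m _; ring.
rewrite (same_beam_sum k.1 (fun j =>
  \sum_q riemann_quad k.1 (pos k xi) j q k.2 0 * u (k.1, q))).
apply: eq_bigr => p _; rewrite mulr_suml.
by apply: eq_bigr => q _; rewrite !mxE; ring.
Qed.

(** Carries the initial and nodal equations, stated on open intervals, to the end points. The point
    [z] is [x] moved towards the midpoint by a fraction [d], hence interior even if [x] is an
    end. *)
Lemma eq_on_closure (a b : R) (f g : R -> R) : a < b ->
  (forall x, a <= x <= b -> cont_at a b f x) ->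
  (forall x, a <= x <= b -> cont_at a b g x) ->
  (forall x, a < x < b -> f x = g x) -> forall x, a <= x <= b -> f x = g x.
Proof.
move=> ab cf cg fg x xab; apply/eqP; rewrite -subr_eq0 -normr_le0.
apply/ler_addgt0Pl => e e0; rewrite addr0.
have e2 : 0 < e / 2 by rewrite divr_gt0.
have [r r0 rf] := (cont_atP _ _ _ _).1 (cf _ xab) _ e2.
have [q q0 qg] := (cont_atP _ _ _ _).1 (cg _ xab) _ e2.
pose d := Num.min 1 (Num.min r q / (b - a)) / 2.
have ba : 0 < b - a by rewrite subr_gt0.
have rq0 : 0 < Num.min r q by rewrite lt_min r0.
have d0 : 0 < d by rewrite divr_gt0 // lt_min ltr01 divr_gt0.
have [d1 drq] : 2 * d <= 1 /\ 2 * d * (b - a) <= Num.min r q.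
  have dE : 2 * d = Num.min 1 (Num.min r q / (b - a)) by rewrite /d; field.
  split; first by rewrite dE ge_min lexx.
  by rewrite dE -(ler_pdivlMr _ _ ba) ge_min lexx orbT.
pose z := x + ((a + b) / 2 - x) * d.
have [xa xb] := andP xab.
have zab : a < z < b.
  have -> : z = x * (1 - d) + (a + b) / 2 * d by rewrite /z; ring.
  have h1 : a * (1 - d) <= x * (1 - d) by rewrite ler_wpM2r //; lra.
  have h2 : x * (1 - d) <= b * (1 - d) by rewrite ler_wpM2r //; lra.
  have h3 : a * d < (a + b) / 2 * d by rewrite ltr_pM2r //; lra.
  have h4 : (a + b) / 2 * d < b * d by rewrite ltr_pM2r //; lra.
  by lra.
have zab' : a <= z <= b by case/andP: zab => ? ?; rewrite !ltW.
have zx : `|z - x| < Num.min r q.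
  rewrite /z [x + _]addrC addrK normrM (gtr0_norm d0).
  apply: lt_le_trans drq; rewrite mulrC -mulrA mulrCA ltr_pM2l //.
  by rewrite ltr_norml; lra.
move: zx; rewrite lt_min => /andP[zr zq].
have h1 := rf _ zab' zr; have h2 := qg _ zab' zq.
rewrite (fg _ zab) in h1; rewrite distrC in h1.
have -> : f x - g x = (f x - g z) + (g z - g x) by ring.
by rewrite [e]splitr (le_trans (ler_normD _ _)) // lerD // ltW.
Qed.

(** * From a solution of the system to the transport problem *)

Section SolutionToTransport.
Variable T : R.
Hypothesis T0 : 0 < T.
Variables (y0 : 'I_N -> R -> 'cV[R]_(6 + 6)) (q : 'I_P -> R -> 'cV[R]_6).
Variable y : 'I_N -> R -> R -> 'cV[R]_(6 + 6).
Hypothesis y0_cont : forall i x, in_beam i x -> mx_cont_at 0 (len G i) (y0 i) x.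
Hypothesis q_cont : forall n t, 0 <= t <= T -> mx_cont_at 0 T (q n) t.
Hypothesis yC1 : forall i, C1_rect (len G i) T (y i).
Hypothesis ysol : igeb_solution G Mass Flex Rot T q y0 y.

Definition riemann_val k xi t : R := (Lmx k.1 (chi k xi) *m y k.1 (chi k xi) t) k.2 0.

Definition riemann_init k xi : R := (Lmx k.1 (chi k xi) *m y0 k.1 (chi k xi)) k.2 0.

Definition riemann_ctl k t : R :=
  (control (entry_node k) k.1 *m q (entry_node k) t) (comp6 k.2) 0.

Let rvb k xi t := \sum_p Lmx k.1 (pos k xi) k.2 p *
  clamp_rect (len G k.1) T (fun x t => y k.1 x t p 0) (pos k xi) t.

Let rvb_buc k : buc (rvb k).
Proof.
apply: buc_sum => p; apply: bucM.
  apply: (@pos_buc k (fun x => Lmx k.1 x k.2 p)) => x xl.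
  exact: (C1_cont (Lmx_deriv k.1) xl).
have [_ cy _ _] := yC1 k.1; have cyp := (C0_rect_mxP _ _ _).1 cy p 0.
apply: (buc_comp (C0_rect_buc (len_gt0 G k.1) T0 cyp)); last exact: ucont2_snd.
have [] // := @pos_buc k id.
by move=> x xl; exact: cvg_within.
Qed.

Let rvbE k xi t : 0 <= xi <= Len k -> 0 <= t <= T -> riemann_val k xi t = rvb k xi t.
Proof.
move=> xiL tT; rewrite /riemann_val /rvb posE // mxE; apply: eq_bigr => p _.
by rewrite /clamp_rect !clamp_id //; exact: chi_in_beam.
Qed.

Lemma y_derivs i x t : in_beam i x -> 0 <= t <= T -> forall p,
  deriv_in 0 (len G i) (fun z => y i z t p 0) x (partial_x (len G i) (y i) x t p 0) /\
  deriv_in 0 T (fun s => y i x s p 0) t (partial_t T (y i) x t p 0).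
Proof.
move=> xl tT p; have [dy _ _ _] := yC1 i.
have [] := dy x t; rewrite ?in_itv //= => dx dt; split.
  exact: (derivable_on_entries (len_gt0 G i) xl dx p 0).
exact: (derivable_on_entries T0 tT dt p 0).
Qed.

Lemma y_initial i x : in_beam i x -> y i x 0 = y0 i x.
Proof.
move=> xl; apply/colP => p; move: x xl.
have T00 : 0 <= (0 : R) <= T by rewrite lexx ltW.
apply: (@eq_on_closure 0 (len G i) (fun x => y i x 0 p 0) (fun x => y0 i x p 0)).
- exact: len_gt0.
- by move=> x xl; have [dx _] := y_derivs xl T00 p; exact: deriv_in_cont dx.
- by move=> x xl; exact: y0_cont.
- by move=> x xl; have [_ _ _ _ ->] := ysol; rewrite // in_itv.
Qed.

Lemma y_nodal t : 0 < t < T -> nodal_compat G Rot (fun i x => y i x t) (fun n => q n t).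
Proof.
move=> tT; have [_ mult neum dir _] := ysol.
have tI : t \in `]0, T[ by rewrite in_itv.
split=> [n nm i j iE jE|n nm|n nn|n nd].
- have [h _] := mult n nm t tI; have hi := h i iE; have hj := h j jE.
  exact: etrans hi (esym hj).
- by have [_] := mult n nm t tI.
- exact: neum.
- exact: dir.
Qed.

Lemma riemann_entry k t : 0 <= t <= T ->
  riemann_val k 0 t = \sum_l kappa k l * riemann_val l (Len l) t + riemann_ctl k t.
Proof.
have L00 l : 0 <= (0 : R) <= Len l by rewrite lexx ltW // Len_gt0.
have LL l : 0 <= Len l <= Len l by rewrite lexx ltW // Len_gt0.
have cv l xi s : 0 <= xi <= Len l -> 0 <= s <= T -> cont_at 0 T (riemann_val l xi) s.
  move=> xiL sT; apply: (@cont_at_eq _ _ _ (rvb l xi)) => //.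
    by move=> z zT; rewrite rvbE.
  apply: cvg_within_filter; exact: (ucont2_slice (rvb_buc l).2).
move: t; apply: eq_on_closure => // t tT.
- exact: cv.
- apply: cont_atD.
    by apply: cont_at_sum => l; apply: cont_atM; [exact: cont_at_cst|exact: cv].
  by apply: mx_cont_atM; [exact: mx_cont_at_cst|exact: q_cont].
- have /nodal_compat_riemannP/(_ k) := y_nodal tT.
  rewrite -chi_entry /riemann_val /riemann_ctl => ->; congr (_ + _).
  by apply: eq_bigr => l _; rewrite -chi_exit.
Qed.

Lemma riemann_val_theta k xi t j : 0 <= xi <= Len k ->
  riemann_val (k.1, j) (theta k (k.1, j) xi) t =
  (Lmx k.1 (chi k xi) *m y k.1 (chi k xi) t) j 0.
Proof.
move=> xiL; rewrite /riemann_val /theta /= eqxx posE //.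
by have [_ ->] := @phiP (k.1, j) (chi k xi) (chi_in_beam xiL).
Qed.

(** [chi] moves at the speed of its component, so the derivative along [(chi z, s + z)] is row [k.2]
    of [L y_t + S (L y_x + L' y)], the left-hand side of [riemann_pdeP]. *)
Lemma riemann_char k s xi : 0 < xi < Len k -> 0 < s + xi < T ->
  is_derive xi 1 (fun z => riemann_val k z (s + z))
    (source acoef ccoef k xi (fun l => riemann_val l (theta k l xi) (s + xi))).
Proof.
move=> xiL sT.
have xiL' : 0 <= xi <= Len k by case/andP: xiL => ? ?; rewrite !ltW.
have sT' : 0 <= s + xi <= T by case/andP: sT => ? ?; rewrite !ltW.
set i := k.1; set x := chi k xi; have xl : in_beam i x := chi_in_beam xiL'.
set yt := partial_t T (y i) x (s + xi); set yx := partial_x (len G i) (y i) x (s + xi).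
have xlo : 0 < x < len G i := chi_interior xiL.
have pde : Lmx i x *m yt + Smx i x *m (Lmx i x *m yx + dL i x *m y i x (s + xi)) =
    riemann_rhs dL i x (Lmx i x *m y i x (s + xi)).
  by apply/riemann_pdeP => //; have [h _ _ _ _] := ysol; apply: h;
    rewrite in_itv.
have -> : source acoef ccoef k xi (fun l => riemann_val l (theta k l xi) (s + xi)) =
    speed i k.2 x * (Lmx i x *m yx + dL i x *m y i x (s + xi)) k.2 0 +
    (Lmx i x *m yt) k.2 0.
  rewrite source_riemann posE //.
  rewrite (_ : \col_j _ = Lmx i x *m y i x (s + xi)); last first.
    by apply/colP => j; rewrite [LHS]mxE riemann_val_theta.
  by rewrite -pde mxE Smx_mul // addrC.
apply: (deriv_in_is_derive xiL).
have -> : (fun z => riemann_val k z (s + z)) =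
    (fun z => \sum_p Lmx i (chi k z) k.2 p * y i (chi k z) (s + z) p 0).
  by apply/funext => z; rewrite /riemann_val mxE.
have -> : speed i k.2 x * (Lmx i x *m yx + dL i x *m y i x (s + xi)) k.2 0 +
    (Lmx i x *m yt) k.2 0 =
  \sum_p ((dL i x k.2 p * speed i k.2 x) * y i x (s + xi) p 0 +
    Lmx i x k.2 p * (yx p 0 * speed i k.2 x + yt p 0)).
  rewrite [in LHS]mxE [in LHS]mxE [X in _ * (_ + X)]mxE [X in _ + X]mxE.
  rewrite mulrDr !mulr_sumr -!big_split /=; apply: eq_bigr => p _; ring.
apply: deriv_in_sum => p; apply: deriv_inM.
  apply: (@deriv_in_comp _ 0 (Len k) 0 (len G i) (fun x => Lmx i x k.2 p) (chi k)).
  - by move=> z; exact: chi_in_beam.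
  - exact: chi_deriv.
  - exact: (Lmx_deriv i).1.
apply: is_derive_deriv_in.
apply: (@deriv_diagonal _ (len G i) T (Len k) _ T0 (fun x t => y i x t p 0)
  (fun x t => partial_x (len G i) (y i) x t p 0)
  (fun x t => partial_t T (y i) x t p 0)) => //.
- exact: len_gt0.
- by move=> z; exact: chi_in_beam.
- by have [_ _ _ ct] := yC1 i; exact: ((C0_rect_mxP _ _ _).1 ct p 0).
- by move=> z t zl tT; exact: y_derivs.
- exact: chi_deriv.
Qed.

(** The bound is left open upwards so that two solutions can be given a common one. *)
Lemma solution_to_transport : exists B0, forall B, B0 <= B ->
  transport_solution Len T kappa theta acoef ccoef riemann_init riemann_ctl B riemann_val.
Proof.
have /choice[B BP] : forall k, exists B : R, forall xi t, `|rvb k xi t| <= B.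
  by move=> k; have [] := rvb_buc k.
have [B0 B00 BB] := fin_bound B; exists B0 => B' B0B'; split.
- move=> k xi t [xiL tT]; rewrite rvbE //.
  exact: le_trans (BP _ _ _) (le_trans (BB k) B0B').
- move=> k s u v [uL uT] [vL vT]; apply/within_contP => z zuv.
  have inL w : u <= w <= v -> 0 <= w <= Len k /\ 0 <= s + w <= T.
    by move: uL uT vL vT; split; lra.
  apply: (@cont_at_eq _ _ _ (fun w => rvb k w (s + w))) => //.
    by move=> w /inL[? ?]; rewrite rvbE.
  apply: cvg_within_filter.
  have /ucont2_slice h : ucont2 (fun s w => rvb k w (s + w)).
    apply: (ucont2_comp (rvb_buc k).2); first exact: ucont2_snd.
    exact: ucont2D (@ucont2_fst _) (@ucont2_snd _).
  exact: (h s).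
- exact: riemann_char.
- by move=> k xi xiL; rewrite /riemann_val /riemann_init y_initial //; exact: chi_in_beam.
- exact: riemann_entry.
Qed.

End SolutionToTransport.

Lemma beam_bound (J : finType) (f : 'I_N -> J -> R -> R) :
  (forall i j x, in_beam i x -> cont_at 0 (len G i) (f i j) x) ->
  exists2 M : R, 0 < M & forall i j x, in_beam i x -> `|f i j x| <= M.
Proof.
move=> cf; have bf (p : 'I_N * J) : buc (fun x _ => f p.1 p.2 (clamp 0 (len G p.1) x)).
  apply: (within_buc (len_gt0 G p.1)).
  by apply/within_contP => x; exact: cf.
have [M M0 fM] := buc_fin_bound bf; exists M => // i j x xl.
by have := fM (i, j) x 0; rewrite /= clamp_id.
Qed.

Local Notation dW := (fun i x => - (Wmx i x *m dL i x *m Wmx i x)).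

Lemma coefficient_bound : exists2 M : R, 0 < M & forall i x, in_beam i x -> forall p j,
  [/\ `|Lmx i x p j| <= M, `|dL i x p j| <= M, `|Wmx i x p j| <= M,
      `|dW i x p j| <= M & `|speed i p x| <= M /\ `|(speed i p x)^-1| <= M].
Proof.
pose JJ := ('I_(6 + 6) * 'I_(6 + 6))%type.
have [|M1 M10 h1] := @beam_bound JJ (fun i p x => Lmx i x p.1 p.2).
  by move=> i p x xl; exact: (C1_cont (Lmx_deriv i) xl).
have [|M2 M20 h2] := @beam_bound JJ (fun i p x => dL i x p.1 p.2).
  by move=> i p x xl; exact: (Lmx_deriv i).2.
have [|M3 M30 h3] := @beam_bound JJ (fun i p x => Wmx i x p.1 p.2).
  by move=> i p x xl; exact: (C1_cont (Wmx_deriv Lmx_deriv i) xl).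
have [|M4 M40 h4] := @beam_bound JJ (fun i p x => dW i x p.1 p.2).
  by move=> i p x xl; exact: (Wmx_deriv Lmx_deriv i).2.
have [|M5 M50 h5] := @beam_bound _ (fun i p x => speed i p x).
  by move=> i p x xl; exact: (Smx_cont xl).
have [|M6 M60 h6] := @beam_bound _ (fun i p x => (speed i p x)^-1).
  by move=> i p x xl; apply: cont_atV; [exact: speed_neq0|exact: (Smx_cont xl)].
exists (M1 + M2 + M3 + M4 + M5 + M6); first lra.
move=> i x xl p j.
have := h1 i (p, j) x xl; have := h2 i (p, j) x xl; have := h3 i (p, j) x xl.
have := h4 i (p, j) x xl; have := h5 i p x xl; have := h6 i p x xl.
rewrite /= => g6 g5 g4 g3 g2 g1; split; [| | | |split]; lra.
Qed.

Lemma control_bound : exists2 M : R, 0 < M & forall n i p j, `|control n i p j| <= M.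
Proof.
have [M M0 MP] := fin_bound (fun e : ('I_P * 'I_N) * ('I_6 * 'I_6) =>
  `|control e.1.1 e.1.2 e.2.1 e.2.2|).
by exists M => // n i p j; exact: (MP ((n, i), (p, j))).
Qed.

(** * From the transport problem back to the system *)

Section TransportToSolution.
Variables (T : R) (T0 : 0 < T).
Variables (y0 dy0 : 'I_N -> R -> 'cV[R]_(6 + 6)) (q dq : 'I_P -> R -> 'cV[R]_6).
Hypothesis y0_C1 : forall i, C1_entries 0 (len G i) (y0 i) (dy0 i).
Hypothesis q_C1 : forall n, C1_entries 0 T (q n) (dq n).

Definition rinit k xi : R := riemann_init y0 k (clamp 0 (Len k) xi).
(** The derivative of [rinit] by the chain rule, [speed] being the derivative of [chi]. *)
Definition drinit k xi : R := speed k.1 k.2 (pos k xi) *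
  (Lmx k.1 (pos k xi) *m dy0 k.1 (pos k xi) +
   dL k.1 (pos k xi) *m y0 k.1 (pos k xi)) k.2 0.
Definition dctl k t : R :=
  (control (entry_node k) k.1 *m dq (entry_node k) (clamp 0 T t)) (comp6 k.2) 0.

Lemma rinit_buc k : buc (fun xi _ => rinit k xi).
Proof.
apply: (@pos_buc k (fun x => (Lmx k.1 x *m y0 k.1 x) k.2 0)) => x xl.
by apply: mx_cont_atM; [exact: C1_cont (Lmx_deriv _) xl|exact: C1_cont (y0_C1 _) xl].
Qed.

Lemma drinit_buc k : buc (fun xi _ => drinit k xi).
Proof.
apply: (@pos_buc k (fun x => speed k.1 k.2 x *
  (Lmx k.1 x *m dy0 k.1 x + dL k.1 x *m y0 k.1 x) k.2 0)) => x xl.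
apply: cont_atM; first exact: Smx_cont.
apply: mx_cont_atD; apply: mx_cont_atM.
- exact: C1_cont (Lmx_deriv _) xl.
- by move=> p j; exact: (y0_C1 _).2.
- by move=> p j; exact: (Lmx_deriv _).2.
- exact: C1_cont (y0_C1 _) xl.
Qed.

Lemma dctl_buc k : buc (fun t _ => dctl k t).
Proof.
apply: (@within_buc _ T (fun t =>
  (control (entry_node k) k.1 *m dq (entry_node k) t) (comp6 k.2) 0) T0).
apply/within_contP => t tT; apply: mx_cont_atM; first exact: mx_cont_at_cst.
by move=> p j; exact: (q_C1 _).2.
Qed.

Lemma rinitP k x z : 0 <= x <= Len k -> 0 <= z <= Len k ->
  rinit k z - rinit k x = integ (drinit k) x z.
Proof.
move=> xL zL; rewrite /rinit !clamp_id //.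
have cd : continuous (drinit k).
  exact: (@ucont2_slice _ (fun _ x => drinit k x) 0 (ucont2_swap (drinit_buc k).2)).
have F xi : 0 <= xi <= Len k -> deriv_in 0 (Len k) (riemann_init y0 k) xi (drinit k xi).
  move=> xiL; rewrite /drinit posE // mulrC.
  apply: (@deriv_in_comp _ 0 (Len k) 0 (len G k.1)
    (fun x => (Lmx k.1 x *m y0 k.1 x) k.2 0) (chi k)).
  - by move=> w; exact: chi_in_beam.
  - exact: chi_deriv.
  - have [d _] := C1_M (Lmx_deriv k.1) (y0_C1 k.1).
    by rewrite addrC; exact: d (chi_in_beam xiL).
exact: (deriv_in_integ cd F).
Qed.

Lemma ctlP k t : 0 <= t <= T ->
  riemann_ctl q k t = riemann_ctl q k 0 + integ (dctl k) 0 t.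
Proof.
move=> tT; have T00 : 0 <= (0 : R) <= T by rewrite lexx ltW.
have cd : continuous (dctl k).
  exact: (@ucont2_slice _ (fun _ x => dctl k x) 0 (ucont2_swap (dctl_buc k).2)).
have F s : 0 <= s <= T -> deriv_in 0 T (riemann_ctl q k) s (dctl k s).
  move=> sT; rewrite /dctl clamp_id // /riemann_ctl [X in deriv_in _ _ _ _ X]mxE.
  rewrite (_ : (fun t => _) = (fun t => \sum_j control (entry_node k) k.1 (comp6 k.2) j *
    q (entry_node k) t j 0)); last by apply/funext => z; rewrite mxE.
  by apply: deriv_in_sum => j; apply: deriv_inZ; exact: (q_C1 _).1.
by rewrite -(deriv_in_integ cd F _ T00 tT) // addrC subrK.
Qed.

Lemma rinit_theta k xi j : rinit (k.1, j) (theta k (k.1, j) xi) =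
  (Lmx k.1 (pos k xi) *m y0 k.1 (pos k xi)) j 0.
Proof.
rewrite /rinit clamp_id; last exact: theta_itv.
rewrite /riemann_init /theta /= eqxx.
by have [_ ->] := @phiP (k.1, j) (pos k xi) (pos_in_beam k xi).
Qed.

(** Identifies the initial value of [w] with [L y^1] read in travel time, so that [r1_entry] is the
    compatibility condition of order one. *)
Lemma r1_initial_dt k xi : 
  (forall i x, in_beam i x -> deriv_on 0 (len G i) (y0 i) x = dy0 i x) ->
  r1 theta acoef ccoef rinit drinit k xi =
  (Lmx k.1 (pos k xi) *m initial_dt G Mass Flex Rot y0 k.1 (pos k xi)) k.2 0.
Proof.
move=> dyE; have xl := pos_in_beam k xi.
rewrite /r1 source_riemann /initial_dt dyE // (riemann_rhs_initial dL) //.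
rewrite (_ : \col_j _ = Lmx k.1 (pos k xi) *m y0 k.1 (pos k xi)); last first.
  by apply/colP => j; rewrite [LHS]mxE rinit_theta.
by rewrite [RHS]mxE; congr (_ + _); rewrite [RHS]mxE Smx_mul.
Qed.

Variables r w g : K -> R -> R -> R.
Hypothesis rwg_buc : forall k, [/\ buc (r k), buc (w k) & buc (g k)].
Hypothesis rwg_deriv : forall k xi t, in_rect Len T k xi t ->
  [/\ deriv_in 0 T (r k xi) t (w k xi t),
      deriv_in 0 (Len k) (fun z => r k z t) xi (g k xi t) &
      w k xi t + g k xi t = source acoef ccoef k xi (fun l => r l (theta k l xi) t)].
Hypothesis r_init : forall k xi, r k xi 0 = rinit k xi.
Hypothesis r_entry : forall k t, 0 <= t <= T ->
  r k 0 t = \sum_l kappa k l * r l (Len l) t + riemann_ctl q k t.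

(** Each component is read at its own travel time, all at the same point [x] of the beam. *)
Definition col_at (h : K -> R -> R -> R) i x t : 'cV[R]_(6 + 6) :=
  \col_j h (i, j) (phi (i, j) x) t.

Definition ysol_ i x t : 'cV[R]_(6 + 6) := Wmx i x *m col_at r i x t.
Definition ysol_t i x t : 'cV[R]_(6 + 6) := Wmx i x *m col_at w i x t.
Definition ysol_x i x t : 'cV[R]_(6 + 6) :=
  dW i x *m col_at r i x t +
  Wmx i x *m \col_j (g (i, j) (phi (i, j) x) t * (speed i j x)^-1).

Lemma phi_rect i j x t : in_beam i x -> 0 <= t <= T -> in_rect Len T (i, j) (phi (i, j) x) t.
Proof. by move=> xl tT; split=> //; have [] := @phiP (i, j) x xl. Qed.

Lemma ysol_derivs i x t p : in_beam i x -> 0 <= t <= T ->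
  deriv_in 0 (len G i) (fun z => ysol_ i z t p 0) x (ysol_x i x t p 0) /\
  deriv_in 0 T (fun s => ysol_ i x s p 0) t (ysol_t i x t p 0).
Proof.
move=> xl tT; split.
  rewrite (_ : (fun z => _) = fun z => \sum_j Wmx i z p j * r (i, j) (phi (i, j) z) t); last first.
    by apply/funext => z; rewrite mxE; apply: eq_bigr => j _; rewrite mxE.
  rewrite (_ : ysol_x i x t p 0 = \sum_j (dW i x p j * r (i, j) (phi (i, j) x) t +
    Wmx i x p j * (g (i, j) (phi (i, j) x) t * (speed i j x)^-1))); last first.
    rewrite mxE mxE [X in _ + X]mxE -big_split /=; apply: eq_bigr => j _.
    by congr (_ * _ + _ * _); rewrite mxE.
  apply: deriv_in_sum => j; apply: deriv_inM; first exact: (Wmx_deriv Lmx_deriv i).1.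
  have [_ dg _] := rwg_deriv (phi_rect j xl tT).
  apply: (@deriv_in_comp _ 0 (len G i) 0 (Len (i, j)) (fun z => r (i, j) z t) (phi (i, j))) => //.
  - by move=> z zl; have [] := @phiP (i, j) z zl.
  - exact: (@phi_deriv (i, j)).
rewrite (_ : (fun z => _) = fun z => \sum_j Wmx i x p j * r (i, j) (phi (i, j) x) z); last first.
  by apply/funext => z; rewrite mxE; apply: eq_bigr => j _; rewrite mxE.
rewrite (_ : ysol_t i x t p 0 = \sum_j Wmx i x p j * w (i, j) (phi (i, j) x) t); last first.
  by rewrite mxE; apply: eq_bigr => j _; rewrite mxE.
apply: deriv_in_sum => j; apply: deriv_inZ.
by have [] := rwg_deriv (phi_rect j xl tT).
Qed.

Lemma ysol_partial i x t : in_beam i x -> 0 <= t <= T ->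
  [/\ derivable_on 0 (len G i) (fun z => ysol_ i z t) x,
      derivable_on 0 T (fun s => ysol_ i x s) t,
      partial_x (len G i) (ysol_ i) x t = ysol_x i x t &
      partial_t T (ysol_ i) x t = ysol_t i x t].
Proof.
move=> xl tT.
have [d1 e1] := (deriv_onP (len_gt0 G i) (fun z => ysol_ i z t) (ysol_x i x t) xl).1
  (fun p j => eq_ind 0 (fun j => deriv_in 0 (len G i) (fun z => ysol_ i z t p j) x
     (ysol_x i x t p j)) (ysol_derivs p xl tT).1 j (esym (ord1 j))).
have [d2 e2] := (deriv_onP T0 (fun s => ysol_ i x s) (ysol_t i x t) tT).1
  (fun p j => eq_ind 0 (fun j => deriv_in 0 T (fun s => ysol_ i x s p j) t
     (ysol_t i x t p j)) (ysol_derivs p xl tT).2 j (esym (ord1 j))).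
by split; [exact: d1|exact: d2|exact: e1|exact: e2].
Qed.

Lemma beam_fun_buc i (f : R -> R) : (forall x, in_beam i x -> cont_at 0 (len G i) f x) ->
  buc (fun x _ => f (clamp 0 (len G i) x)).
Proof.
by move=> cf; apply: (within_buc (len_gt0 G i)); apply/within_contP.
Qed.

Lemma phi_comp_buc (h : K -> R -> R -> R) i j : (forall k, buc (h k)) ->
  buc (fun x t => h (i, j) (phi (i, j) (clamp 0 (len G i) x)) t).
Proof.
move=> bh; apply: (buc_comp (bh (i, j))); last exact: ucont2_snd.
have [] // := @beam_fun_buc i (phi (i, j)).
by move=> x xl; exact: deriv_in_cont (@phi_deriv (i, j) x xl).
Qed.

Lemma ysol_C1 i : C1_rect (len G i) T (ysol_ i).
Proof.
have br k : buc (r k) by have [] := rwg_buc k.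
have bw k : buc (w k) by have [] := rwg_buc k.
have bg k : buc (g k) by have [] := rwg_buc k.
have cW p j : buc (fun x (_ : R) => Wmx i (clamp 0 (len G i) x) p j).
  apply: (@beam_fun_buc i (fun x => Wmx i x p j)) => x xl.
  exact: (C1_cont (Wmx_deriv Lmx_deriv i) xl).
have cdW p j : buc (fun x (_ : R) => dW i (clamp 0 (len G i) x) p j).
  apply: (@beam_fun_buc i (fun x => dW i x p j)) => x xl.
  exact: (Wmx_deriv Lmx_deriv i).2.
have cs j : buc (fun x (_ : R) => (speed i j (clamp 0 (len G i) x))^-1).
  apply: (@beam_fun_buc i (fun x => (speed i j x)^-1)) => x xl.
  by apply: cont_atV; [exact: speed_neq0|exact: (Smx_cont xl)].
split.
- move=> x t; rewrite !in_itv /= => xl tT.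
  by have [] := ysol_partial xl tT.
- apply/C0_rect_mxP => p j; apply: (buc_C0_rect (g := fun x t => \sum_k
    Wmx i (clamp 0 (len G i) x) p k * r (i, k) (phi (i, k) (clamp 0 (len G i) x)) t)).
    by apply: buc_sum => k; apply: bucM => //; exact: phi_comp_buc.
  move=> x t xl tT; rewrite clamp_id // (ord1 j) mxE.
  by apply: eq_bigr => k _; rewrite mxE.
- apply/C0_rect_mxP => p j; apply: (buc_C0_rect (g := fun x t => \sum_k
    (dW i (clamp 0 (len G i) x) p k * r (i, k) (phi (i, k) (clamp 0 (len G i) x)) t +
     Wmx i (clamp 0 (len G i) x) p k * (g (i, k) (phi (i, k) (clamp 0 (len G i) x)) t *
       (speed i k (clamp 0 (len G i) x))^-1)))).
    apply: buc_sum => k; apply: bucD; apply: bucM => //; first exact: phi_comp_buc.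
    by apply: bucM => //; exact: phi_comp_buc.
  move=> x t xl tT; rewrite clamp_id // (ord1 j).
  have [_ _ -> _] := ysol_partial xl tT.
  rewrite mxE mxE [X in _ + X]mxE -big_split /=; apply: eq_bigr => k _.
  by congr (_ * _ + _ * _); rewrite mxE.
- apply/C0_rect_mxP => p j; apply: (buc_C0_rect (g := fun x t => \sum_k
    Wmx i (clamp 0 (len G i) x) p k * w (i, k) (phi (i, k) (clamp 0 (len G i) x)) t)).
    by apply: buc_sum => k; apply: bucM => //; exact: phi_comp_buc.
  move=> x t xl tT; rewrite clamp_id // (ord1 j).
  have [_ _ _ ->] := ysol_partial xl tT.
  by rewrite mxE; apply: eq_bigr => k _; rewrite mxE.
Qed.

Lemma Lmx_ysol i x t : in_beam i x -> Lmx i x *m ysol_ i x t = col_at r i x t.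
Proof. by move=> xl; rewrite /ysol_ /Wmx mulKVmx // Lmx_unit. Qed.

Lemma Lmx_ysol_chi k xi t : 0 <= xi <= Len k ->
  (Lmx k.1 (chi k xi) *m ysol_ k.1 (chi k xi) t) k.2 0 = r k xi t.
Proof.
move=> xiL; rewrite Lmx_ysol; last exact: chi_in_beam.
by rewrite mxE -surjective_pairing phi_chi.
Qed.

(** The factor [speed^-1] from the derivative of [phi] cancels against the diagonal speeds, leaving
    [w + g = source] in each row. *)
Lemma ysol_pde i x t : in_beam i x -> 0 <= t <= T ->
  ysol_t i x t + Amx Mass Flex i x *m ysol_x i x t +
  Bmx G Mass Flex Rot i x *m ysol_ i x t = gfun Mass Flex i x (ysol_ i x t).
Proof.
move=> xl tT; apply/(riemann_pdeP dL) => //.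
rewrite Lmx_ysol // {1}/ysol_t {1}/Wmx (mulKVmx (Lmx_unit xl)).
rewrite /ysol_x /ysol_ Wmx_deriv_mul //; apply/colP => j.
have [_ _ E] := rwg_deriv (phi_rect j xl tT).
have xj : pos (i, j) (phi (i, j) x) = x.
  by have [pL cp] := @phiP (i, j) x xl; rewrite posE.
rewrite mxE Smx_mul // mxE [X in _ * X]mxE mulrCA divff ?mulr1 ?speed_neq0 //.
rewrite E source_riemann /= xj; congr (riemann_rhs dL i x _ j 0).
by apply/colP => p; rewrite !mxE /theta /= eqxx xj.
Qed.

Lemma ysol_nodal t : 0 <= t <= T ->
  nodal_compat G Rot (fun i x => ysol_ i x t) (fun n => q n t).
Proof.
move=> tT; apply/nodal_compat_riemannP => k.
have L00 l : 0 <= (0 : R) <= Len l by rewrite lexx ltW // Len_gt0.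
have LL l : 0 <= Len l <= Len l by rewrite lexx ltW // Len_gt0.
rewrite -chi_entry Lmx_ysol_chi // r_entry //; congr (_ + _).
by apply: eq_bigr => l _; rewrite -chi_exit Lmx_ysol_chi.
Qed.

Lemma ysol_solution : igeb_solution G Mass Flex Rot T q y0 ysol_.
Proof.
split.
- move=> i x t; rewrite !in_itv /= => /andP[x0 xl] /andP[t0 tT].
  have xl' : in_beam i x by rewrite !ltW.
  have tT' : 0 <= t <= T by rewrite !ltW.
  have [_ _ -> ->] := ysol_partial xl' tT'.
  exact: ysol_pde.
- move=> n nm t; rewrite in_itv /= => /andP[t0 tT].
  have tT' : 0 <= t <= T by rewrite !ltW.
  have [c1 c2 _ _] := ysol_nodal tT'; split; last exact: c2.
  by move=> i iE; apply: c1 => //; exact: first_edge_in.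
- move=> n nn t; rewrite in_itv /= => /andP[t0 tT].
  have tT' : 0 <= t <= T by rewrite !ltW.
  by have [_ _ c3 _] := ysol_nodal tT'; exact: c3.
- move=> n nn t; rewrite in_itv /= => /andP[t0 tT].
  have tT' : 0 <= t <= T by rewrite !ltW.
  by have [_ _ _ c4] := ysol_nodal tT'; exact: c4.
- move=> i x; rewrite in_itv /= => /andP[x0 xl].
  have xl' : in_beam i x by rewrite !ltW.
  rewrite /ysol_ (_ : col_at r i x 0 = Lmx i x *m y0 i x).
    by rewrite /Wmx mulKmx // Lmx_unit.
  apply/colP => j; rewrite mxE r_init.
  have [pL cp] := @phiP (i, j) x xl'.
  by rewrite /rinit clamp_id // /riemann_init cp.
Qed.

End TransportToSolution.

Lemma small_solution_exists T : 0 < T ->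
  exists2 delta : R, 0 < delta & exists2 C : R, 0 < C &
  forall d y0 q, 0 <= d <= delta ->
  (forall i, Ck_on 1 0 (len G i) (y0 i)) -> (forall n, Ck_on 1 0 T (q n)) ->
  (forall i x, in_beam i x -> `|y0 i x| <= d /\ `|deriv_on 0 (len G i) (y0 i) x| <= d) ->
  (forall n t, 0 <= t <= T -> `|deriv_on 0 T (q n) t| <= d) ->
  compat1 G Mass Flex Rot T y0 q ->
  exists y, [/\ forall i, C1_rect (len G i) T (y i),
    igeb_solution G Mass Flex Rot T q y0 y &
    forall i, C1_norm_rect (len G i) T (y i) <= C * d].
Proof.
move=> T0.
have [delta delta0 [C C0 CP]] := transport_exists kappa Len_gt0 T0 theta_itv theta_ucont
  acoef_buc ccoef_buc.
have [M M0 MP] := coefficient_bound; have [M' M'0 M'P] := control_bound.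
set c : R := (6 + 6)%:R; have c0 : 0 <= c by exact: ler0n.
(* Turns the size [d] of the data into a bound for the transport data: the last three summands come
   from [rinit], [drinit] and [dctl], and the 1 makes [CD] positive. *)
pose CD := 1 + c * M + 2 * (M * (c * M)) + 6%:R * M'.
have cM0 : 0 <= c * M by rewrite mulr_ge0 // ltW.
have McM0 : 0 <= M * (c * M) by rewrite mulr_ge0 // ltW.
have CD0 : 0 < CD by rewrite /CD; lra.
(* Leads back from bounds on [r], [w], [g] to bounds on [y] and its derivatives; the extra [M] in
   the second product accounts for [g / speed]. The factor 3 below counts the suprema in the
   norm. *)
pose CB := c * (M * (C * CD)) + c * (M * (C * CD * M)).
have CCD0 : 0 < C * CD by rewrite mulr_gt0.
have CB1 : 0 <= c * (M * (C * CD)) by rewrite mulr_ge0 // ltW // mulr_gt0.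
have CB2 : 0 <= c * (M * (C * CD * M)) by rewrite mulr_ge0 // ltW // !mulr_gt0.
exists (delta / CD); first by rewrite divr_gt0.
exists (3 * (CB + 1)); first by rewrite /CB; lra.
move=> d y0 q /andP[d0 dd] y0C qC y0d qd [compat0 compat1].
pose dy0 i := deriv_on 0 (len G i) (y0 i); pose dq n := deriv_on 0 T (q n).
have y0_C1 i : C1_entries 0 (len G i) (y0 i) (dy0 i) := Ck_on1P (len_gt0 G i) (y0C i).
have q_C1 n : C1_entries 0 T (q n) (dq n) := Ck_on1P T0 (qC n).
have dyE i x : in_beam i x -> deriv_on 0 (len G i) (y0 i) x = dy0 i x by [].
have T00 : 0 <= (0 : R) <= T by rewrite lexx ltW.
have L00 l : 0 <= (0 : R) <= Len l by rewrite lexx ltW // Len_gt0.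
have LL l : 0 <= Len l <= Len l by rewrite lexx ltW // Len_gt0.
have entry_le (m n : nat) (A : 'M[R]_(m, n)) (i : 'I_m) (j : 'I_n) e : `|A| <= e -> `|A i j| <= e.
  exact/le_trans/mx_norm_entry.
have Md0 : 0 <= c * (M * d) by rewrite !mulr_ge0 // ltW.
have MMd0 : 0 <= M * (c * (M * d)) by rewrite mulr_ge0 // ltW.
have M'd0 : 0 <= 6%:R * (M' * d) by rewrite !mulr_ge0 // ltW.
have CDd : CD * d = d + c * (M * d) + 2 * (M * (c * (M * d))) + 6%:R * (M' * d).
  by rewrite /CD; ring.
have CDd0 : 0 <= CD * d by rewrite mulr_ge0 // ltW.
have CDdd : 0 <= CD * d <= delta by rewrite CDd0 mulrC -ler_pdivlMr.
have hL i x p : in_beam i x -> `|(Lmx i x *m y0 i x) p 0| <= c * (M * d).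
  move=> xl; apply: mulmx_entry_le => j; first by have [] := MP i x xl p j.
  by apply: entry_le; have [] := y0d i x xl.
have hr k xi : `|rinit y0 k xi| <= CD * d.
  by apply: le_trans (hL _ _ _ (pos_in_beam k xi)) _; rewrite CDd; lra.
have hdr k xi : `|drinit y0 dy0 k xi| <= CD * d.
  have xl := pos_in_beam k xi.
  have h1 : `|(Lmx k.1 (pos k xi) *m dy0 k.1 (pos k xi)) k.2 0| <= c * (M * d).
    apply: mulmx_entry_le => j; first by have [] := MP _ _ xl k.2 j.
    by apply: entry_le; have [] := y0d _ _ xl.
  have h2 : `|(dL k.1 (pos k xi) *m y0 k.1 (pos k xi)) k.2 0| <= c * (M * d).
    apply: mulmx_entry_le => j; first by have [] := MP _ _ xl k.2 j.
    by apply: entry_le; have [] := y0d _ _ xl.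
  rewrite /drinit normrM; apply: (@le_trans _ _ (M * (c * (M * d) + c * (M * d)))).
    apply: ler_pM => //; first by have [_ _ _ _ []] := MP _ _ xl k.2 k.2.
    by rewrite mxE (le_trans (ler_normD _ _)) // lerD.
  by rewrite CDd mulrDr; lra.
have hdq k t : `|dctl T dq k t| <= CD * d.
  apply: (@le_trans _ _ (6%:R * (M' * d))); last by rewrite CDd; lra.
  apply: mulmx_entry_le => j; first exact: M'P.
  by apply: entry_le; apply: qd; exact: clamp_itv (ltW T0).
have r0e k : rinit y0 k 0 = \sum_l kappa k l * rinit y0 l (Len l) + riemann_ctl q k 0.
  have /nodal_compat_riemannP/(_ k) := compat0.
  rewrite -chi_entry /rinit clamp_id // => h; apply: etrans h _; congr (_ + _).
  by apply: eq_bigr => l _; rewrite clamp_id // /riemann_init chi_exit.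
have r1e k : r1 theta acoef ccoef (rinit y0) (drinit y0 dy0) k 0 =
    \sum_l kappa k l * r1 theta acoef ccoef (rinit y0) (drinit y0 dy0) l (Len l) +
    dctl T dq k 0.
  have /nodal_compat_riemannP/(_ k) := compat1.
  rewrite (r1_initial_dt _ _ dyE) (posE (L00 k)) chi_entry => ->; congr (_ + _); last first.
    by rewrite /dctl clamp_id.
  by apply: eq_bigr => l _; rewrite (r1_initial_dt _ _ dyE) (posE (LL l)) chi_exit.
have [r [w [g [rwg_buc rwg_deriv r_init r_entry rb]]]] := CP (CD * d) _ _ (riemann_ctl q) _
  CDdd (rinit_buc y0_C1) (drinit_buc y0_C1) (dctl_buc T0 q_C1) (rinitP y0_C1)
  (ctlP T0 q_C1) hr hdr hdq r0e r1e.
exists (ysol_ r); split.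
- by move=> i; exact: (ysol_C1 T0 rwg_buc rwg_deriv).
- exact: (ysol_solution T0 rwg_deriv r_init r_entry).
move=> i; rewrite -mulrA; apply: C1_norm_rect_le; rewrite ?ltW ?len_gt0 // => x t xl tT.
have [_ _ -> ->] := ysol_partial T0 rwg_deriv xl tT.
have B1 : 0 <= c * (M * (C * (CD * d))) by rewrite !mulr_ge0 // ltW.
have B2 : 0 <= c * (M * (C * (CD * d) * M)) by rewrite !mulr_ge0 // ltW.
have EB : (CB + 1) * d = c * (M * (C * (CD * d))) + c * (M * (C * (CD * d) * M)) + d.
  by rewrite /CB; ring.
have B0 : 0 <= (CB + 1) * d by rewrite EB; lra.
have hW p j : `|Wmx i x p j| <= M by have [] := MP i x xl p j.
have hdW p j : `|(- (Wmx i x *m dL i x *m Wmx i x)) p j| <= M.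
  by have [] := MP i x xl p j.
have hrw j : [/\ `|r (i, j) (phi (i, j) x) t| <= C * (CD * d),
   `|w (i, j) (phi (i, j) x) t| <= C * (CD * d) & `|g (i, j) (phi (i, j) x) t| <= C * (CD * d)].
  exact: rb (phi_rect _ xl tT).
split; apply: mx_norm_le => // p j; rewrite (ord1 j).
- apply: (@le_trans _ _ (c * (M * (C * (CD * d))))); last by rewrite EB; lra.
  by apply: mulmx_entry_le => // j'; rewrite mxE; have [] := hrw j'.
- rewrite EB mxE; apply: le_trans (ler_normD _ _) _.
  rewrite -[leLHS]addr0; apply: lerD => //; apply: lerD.
    by apply: mulmx_entry_le => // j'; rewrite mxE; have [] := hrw j'.
  apply: mulmx_entry_le => // j'; rewrite mxE normrM; apply: ler_pM => //.
    by have [] := hrw j'.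
  by have [_ _ _ _ [_]] := MP i x xl j' j'.
- apply: (@le_trans _ _ (c * (M * (C * (CD * d))))); last by rewrite EB; lra.
  by apply: mulmx_entry_le => // j'; rewrite mxE; have [] := hrw j'.
Qed.

Lemma solution_unique T y0 q y y' : 0 < T ->
  (forall i x, in_beam i x -> mx_cont_at 0 (len G i) (y0 i) x) ->
  (forall n t, 0 <= t <= T -> mx_cont_at 0 T (q n) t) ->
  (forall i, C1_rect (len G i) T (y i)) -> igeb_solution G Mass Flex Rot T q y0 y ->
  (forall i, C1_rect (len G i) T (y' i)) -> igeb_solution G Mass Flex Rot T q y0 y' ->
  forall i x t, in_beam i x -> 0 <= t <= T -> y' i x t = y i x t.
Proof.
move=> T0 y0c qc yC yS y'C y'S i x t xl tT.
have [B BP] := solution_to_transport T0 y0c qc yC yS.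
have [B' B'P] := solution_to_transport T0 y0c qc y'C y'S.
have [M _ MP] := source_coef_bound acoef_buc ccoef_buc.
have [BM B'M] : B <= Num.max B B' /\ B' <= Num.max B B' by rewrite !le_max !lexx orbT.
have solB := BP _ BM; have solB' := B'P _ B'M.
have E := transport_unique Len_gt0 theta_itv (fun k x => (MP k x).1)
  (fun k x => (MP k x).2) solB' solB.
apply: (can_inj (mulKmx (Lmx_unit xl))); apply/colP => j.
have := E (i, j) (phi (i, j) x) t (phi_rect j xl tT).
by rewrite /riemann_val /=; have [_ ->] := @phiP (i, j) x xl.
Qed.

End Transport.

End Beam.

Theorem theorem2p3 (R : realType) (N P : nat) (G : network R N P)
    (Mass Flex : 'I_N -> R -> 'M[R]_6) (Rot : 'I_N -> R -> 'M[R]_3)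
    (hRot : forall i, Ck_on 2 0 (len G i) (Rot i) /\
      forall x, x \in `[0, len G i] -> SO3 (Rot i x))
    (hFlex : forall i, Ck_on 2 0 (len G i) (Flex i) /\
      forall x, x \in `[0, len G i] -> posdefmx (Flex i x))
    (hMass : forall i, Ck_on 2 0 (len G i) (Mass i) /\
      forall x, x \in `[0, len G i] -> posdefmx (Mass i x))
    (hTheta : forall i, exists U D : R -> 'M[R]_6,
      [/\ Ck_on 2 0 (len G i) U, Ck_on 2 0 (len G i) D &
          Theta_diag G Mass Flex i U D]) :
  forall T : R, 0 < T ->
  exists2 eps0 : R, 0 < eps0 &
  forall eps : R, 0 < eps < eps0 ->
  exists2 delta : R, 0 < delta &
  forall (y0 : 'I_N -> R -> 'cV[R]_(6 + 6)) (q : 'I_P -> R -> 'cV[R]_6),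
    (forall i, Ck_on 1 0 (len G i) (y0 i)) ->
    (forall n, Ck_on 1 0 T (q n)) ->
    (forall i n, C1_norm_on 0 (len G i) (y0 i) + C1_norm_on 0 T (q n) <= delta) ->
    compat1 G Mass Flex Rot T y0 q ->
  exists y : 'I_N -> R -> R -> 'cV[R]_(6 + 6),
    [/\ forall i, C1_rect (len G i) T (y i),
        igeb_solution G Mass Flex Rot T q y0 y,
        forall y' : 'I_N -> R -> R -> 'cV[R]_(6 + 6),
          (forall i, C1_rect (len G i) T (y' i)) ->
          igeb_solution G Mass Flex Rot T q y0 y' ->
          forall i x t, x \in `[0, len G i] -> t \in `[0, T] ->
          y' i x t = y i x t &
        forall i, C1_norm_rect (len G i) T (y i) <= eps].
Proof.
move=> T T0.
have /choice[U /choice[D UDP]] := hTheta.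
have hU i : Ck_on 2 0 (len G i) (U i) by have [] := UDP i.
have hD i : Ck_on 2 0 (len G i) (D i) by have [] := UDP i.
have hT i : Theta_diag G Mass Flex i (U i) (D i) by have [] := UDP i.
have /choice[dL dLP] := Lmx_C1 hFlex hU hD hT.
have /choice[Len /choice[phi /choice[chi travel]]] : forall k : 'I_N * 'I_(6 + 6),
    exists Len phi chi, travel_coordinate (len G k.1) (speed D k.1 k.2) (rightward k.2)
      Len phi chi.
  move=> k; apply: travel_coordinate_exists (len_gt0 G k.1) _ _ => x xl.
    exact: (Smx_cont hD xl).
  exact: (speed_sign hT).
have [delta delta0 [C C0 small]] := small_solution_exists hRot hFlex hMass hD hT dLP travel T0.
(* The bound [C * d] can be brought below any positive [eps] by the choice of [delta], so 1 is an
   arbitrary choice. *)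
exists 1 => // eps /andP[eps0 _].
exists (Num.min delta (eps / C)); first by rewrite lt_min delta0 divr_gt0.
move=> y0 q y0C qC y0q compat.
have T00 : 0 <= (0 : R) <= T by rewrite lexx ltW.
have l00 i : 0 <= (0 : R) <= len G i by rewrite lexx ltW // len_gt0.
have y0_ge0 i : 0 <= C1_norm_on 0 (len G i) (y0 i).
  exact: le_trans (normr_ge0 _) (C1_norm_on_ub (len_gt0 G i) (y0C i) (l00 i)).1.
have q_ge0 n : 0 <= C1_norm_on 0 T (q n).
  exact: le_trans (normr_ge0 _) (C1_norm_on_ub T0 (qC n) T00).1.
have d0 : 0 <= Num.min delta (eps / C) by rewrite le_min !ltW // divr_gt0.
(* The data are bounded through sums over a beam and a node, so each norm needs a partner: the
   source node of the beam here, an incident beam of the node next. *)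
have y0_le i : C1_norm_on 0 (len G i) (y0 i) <= Num.min delta (eps / C).
  by apply: le_trans (y0q i (src G i)); rewrite lerDl.
have q_le n : C1_norm_on 0 T (q n) <= Num.min delta (eps / C).
  have [i _] := incident_edge G n.
  by apply: le_trans (y0q i n); rewrite lerDr.
have [|i x xl|n t tT|y [yC ysol yle]] := small (Num.min delta (eps / C)) y0 q _ y0C qC _ _ compat.
- by rewrite d0 ge_min lexx.
- have [h1 h2] := C1_norm_on_ub (len_gt0 G i) (y0C i) xl.
  by split; [exact: le_trans h1 _|exact: le_trans h2 _].
- exact: le_trans (C1_norm_on_ub T0 (qC n) tT).2 _.
exists y; split=> //.
- move=> y' y'C y'sol i x t; rewrite !in_itv /= => xl tT.
  apply: (solution_unique hRot hFlex hMass hD hT dLP travel T0 _ _ yC ysol y'C y'sol xl tT).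
    by move=> j z zl p r; exact: (C1_cont (Ck_on1P (len_gt0 G j) (y0C j)) zl).
  by move=> n z zT p r; exact: (C1_cont (Ck_on1P T0 (qC n)) zT).
- move=> i; apply: le_trans (yle i) _.
  by rewrite mulrC -ler_pdivlMr // ge_min lexx orbT.
Qed.
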